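(* Let $n\ge 1$, $1<p<\infty$, let $\Theta\subset\mathbb{R}^{n+1}$ be a bounded open set, and let $\xi_0=(0,0)\in\partial\Theta$. Assume that $\Theta$ satisfies the tusk condition at $\xi_0$, i.e. there are $\hat{x}\in\mathbb{R}^n$ and $R,T>0$ such that $$\{(x,t)\in\mathbb{R}^{n}\times\mathbb{R}: -T<t<0 \text{ and } |x-(-t)^{1/2}\hat{x}|^2<R^2(-t)\}\subset\mathbb{R}^{n+1}\setminus\Theta.$$ Then $\xi_0$ is regular with respect to $\Theta$ for the normalized $p$-parabolic equation $u_t=\Delta_p^N u$. Moreover, if $f:\partial\Theta\to\mathbb{R}$ is bounded and Hölder continuous at $\xi_0$, then the upper Perron solution $\overline{P}f$ is Hölder continuous at $\xi_0$.
   Context: Points of $\mathbb{R}^{n+1}$ are written $(x,t)$, $x\in\mathbb{R}^n$, $t\in\mathbb{R}$; $\nabla$, $D^2$, $\Delta$ are taken in $x$ only. For $\nabla u\ne0$, $\Delta_p^N u=\Delta u+(p-2)|\nabla u|^{-2}\langle D^2u\,\nabla u,\nabla u\rangle$. Viscosity supersolution: for $\Theta$ open, $u:\Theta\to(-\infty,\infty]$ is a viscosity supersolution of $u_t=\Delta_p^N u$ in $\Theta$ if (i) $u$ is lower semicontinuous; (ii) $u$ is finite in a dense subset of $\Theta$; (iii) whenever $(x_0,t_0)\in\Theta$ and $\varphi\in C^2(\Theta)$ satisfy $u(x_0,t_0)=\varphi(x_0,t_0)$ and $u>\varphi$ in $\Theta\setminus\{(x_0,t_0)\}$, then at $(x_0,t_0)$: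 $\varphi_t-\Delta_p^N\varphi\ge0$ if $\nabla\varphi\ne0$, and $\varphi_t-\Delta\varphi-(p-2)\lambda_{\rm eig}\ge0$ if $\nabla\varphi=0$, where $\lambda_{\rm eig}$ is the smallest (if $p\ge2$) or largest (if $p<2$) eigenvalue of $D^2\varphi(x_0,t_0)$. A function $u$ is a viscosity subsolution if $-u$ is a viscosity supersolution, and a viscosity solution if it is both. Superparabolic: a space-time box is $Q_{t_1,t_2}=Q\times(t_1,t_2)$ with $Q=(a_1,b_1)\times\dots\times(a_n,b_n)$; its parabolic boundary is $\partial_pQ_{t_1,t_2}=(Q\times\{t_1\})\cup(\partial Q\times[t_1,t_2])$. A function $u:\Theta\to(-\infty,\infty]$ is superparabolic in $\Theta$ if it is lower semicontinuous, finite in a dense subset of $\Theta$, and for each space-time box $Q_{t_1,t_2}$ with compact closure in $\Theta$ and each $h\in C(\overline{Q_{t_1,t_2}})$ that is a viscosity solution in $Q_{t_1,t_2}$ with $h\le u$ on $\partial_pQ_{t_1,t_2}$, one has $h\le u$ in $Q_{t_1,t_2}$. Perron solution: for bounded open $\Theta$ and bounded $f:\partial\Theta\to\mathbb{R}$, $\overline{P}f(\xi)=\inf u(\xi)$, $\xi\in\Theta$, the infimum over all superparabolic $u$ in $\Theta$ with $\liminf_{\Theta\ni\eta\to\zeta}u(\eta)\ge f(\zeta)$ for all $\zeta\in\partial\Theta$. Regularity: $\xi_0\in\partial\Theta$ is regular with respect to $\Theta$ if $\lim_{\Theta\ni\xi\to\xi_0}\overline{P}f(\xi)=f(\xi_0)$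 for every $f\in C(\partial\Theta)$. Hölder continuity is with respect to parabolic scaling: $g$ is Hölder continuous at $(0,0)$ if there are $C,\beta>0$ such that $|g(x,t)-g(0,0)|\le C(|x|+|t|^{1/2})^\beta$ on its domain; for $g=\overline{P}f$ one sets $g(0,0)=f(0,0)$. The exponents for $f$ and $\overline{P}f$ may differ. *)

(* Defs.v *)
From HB Require Import structures.
From mathcomp Require Import all_boot all_order all_algebra.
From mathcomp Require Import all_classical all_reals all_analysis.

Set Implicit Arguments.
Unset Strict Implicit.
Unset Printing Implicit Defensive.

Import Order.TTheory GRing.Theory Num.Theory.
Import numFieldNormedType.Exports.

Local Open Scope classical_set_scope.
Local Open Scope ring_scope.

Definition boundary {T : topologicalType} (A : set T) : set T :=
  closure A `\` interior A.

Section Euclidean.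
Context {R : realType} {n : nat}.

Definition dotv (x y : 'rV[R]_n) : R := \sum_i x 0 i * y 0 i.

                                                                       
                                   
Definition enorm (x : 'rV[R]_n) : R := Num.sqrt (dotv x x).

End Euclidean.

                                                                            
                        
Section SpaceTime.
Context {R : realType} {n : nat}.

Notation X := ('rV[R]_n * R)%type.
Implicit Types (Theta : set X) (u : X -> \bar R) (f g h phi : X -> R).
Implicit Types (xi zeta eta : X).

Definition origin : X := (0, 0).

Definition dir_x (i : 'I_n) : X := (delta_mx 0 i, 0).
Definition dir_t : X := (0, 1).

                                                                                    
                                                 
Definition C1_on Theta g := forall xi, Theta xi -> {for xi, continuous g} /\
  forall v : X, derivable g xi v /\ {for xi, continuous ('D_v g)}.

Definition C2_on Theta g := C1_on Theta g /\ forall v : X, C1_on Theta ('D_v g).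

Definition dt phi xi : R := 'D_dir_t phi xi.
Definition grad phi xi : 'rV[R]_n := \row_i 'D_(dir_x i) phi xi.
Definition hess phi xi : 'M[R]_n :=
  \matrix_(i, j) 'D_(dir_x i) ('D_(dir_x j) phi) xi.
Definition lapl phi xi : R := \tr (hess phi xi).

Definition normalized_plapl (p : R) phi xi : R :=
  lapl phi xi + (p - 2) * (enorm (grad phi xi) ^+ 2)^-1
                * dotv (grad phi xi *m hess phi xi) (grad phi xi).

                                                                              
                                                                    
Definition eig_ext (p : R) (A : 'M[R]_n) : R :=
  if 2 <= p then inf [set a | eigenvalue A a] else sup [set a | eigenvalue A a].

                                                                            
                                          
Definition lsc_dense_finite Theta u :=
  [/\ forall xi, Theta xi -> u xi != -oo%E,
      lower_semicontinuous (u : subspace Theta -> \bar R)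
    & Theta `<=` closure [set xi | Theta xi /\ u xi \is a fin_num]].

Definition viscosity_supersolution (p : R) Theta u :=
  lsc_dense_finite Theta u /\
  forall xi0 phi, Theta xi0 -> C2_on Theta phi ->
    u xi0 = (phi xi0)%:E ->
    (forall xi, Theta xi -> xi != xi0 -> ((phi xi)%:E < u xi)%E) ->
    (grad phi xi0 != 0 -> 0 <= dt phi xi0 - normalized_plapl p phi xi0) /\
    (grad phi xi0 = 0 ->
      0 <= dt phi xi0 - lapl phi xi0 - (p - 2) * eig_ext p (hess phi xi0)).

Definition viscosity_subsolution (p : R) Theta u :=
  viscosity_supersolution p Theta (fun xi => (- u xi)%E).

Definition viscosity_solution (p : R) Theta u :=
  viscosity_supersolution p Theta u /\ viscosity_subsolution p Theta u.

Definition space_box (a b : 'rV[R]_n) : set 'rV[R]_n :=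
  [set x | forall i, a 0 i < x 0 i < b 0 i].

Definition box (a b : 'rV[R]_n) (t1 t2 : R) : set X :=
  space_box a b `*` [set t | t1 < t < t2].

Definition parabolic_boundary (a b : 'rV[R]_n) (t1 t2 : R) : set X :=
  (space_box a b `*` [set t1]) `|`
  (boundary (space_box a b) `*` [set t | t1 <= t <= t2]).

Definition superparabolic (p : R) Theta u :=
  lsc_dense_finite Theta u /\
  forall (a b : 'rV[R]_n) (t1 t2 : R),
    (forall i, a 0 i < b 0 i) -> t1 < t2 ->
    compact (closure (box a b t1 t2)) -> closure (box a b t1 t2) `<=` Theta ->
    forall h, {within closure (box a b t1 t2), continuous h} ->
      viscosity_solution p (box a b t1 t2) (EFin \o h) ->
      (forall xi, parabolic_boundary a b t1 t2 xi -> ((h xi)%:E <= u xi)%E) ->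
      forall xi, box a b t1 t2 xi -> ((h xi)%:E <= u xi)%E.

Definition upper_perron (p : R) Theta f xi : \bar R :=
  ereal_inf [set u xi | u in
    [set u | superparabolic p Theta u /\
             forall zeta, boundary Theta zeta ->
               ((f zeta)%:E <= limf_einf u (within Theta (nbhs zeta)))%E]].

Definition regular_point (p : R) Theta xi0 :=
  forall f, {within boundary Theta, continuous f} ->
    upper_perron p Theta f xi @[xi --> within Theta (nbhs xi0)] --> (f xi0)%:E.

Definition tusk (xhat : 'rV[R]_n) (r T : R) : set X :=
  [set xi | - T < xi.2 < 0 /\
            enorm (xi.1 - Num.sqrt (- xi.2) *: xhat) ^+ 2 < r ^+ 2 * (- xi.2)].

Definition tusk_condition Theta :=
  exists (xhat : 'rV[R]_n) (r T : R),
    [/\ 0 < r, 0 < T & tusk xhat r T `<=` ~` Theta].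

Definition holder_at_origin (D : set X) (g : X -> \bar R) :=
  exists C beta : R, [/\ 0 < C, 0 < beta & forall xi, D xi ->
    (`| g xi - g origin |
       <= (C * (enorm xi.1 + Num.sqrt `|xi.2|) `^ beta)%:E)%E].

                                                                          
                         
Definition upper_perron0 (p : R) Theta f xi : \bar R :=
  if xi == origin then (f origin)%:E else upper_perron p Theta f xi.

End SpaceTime.

(* Main.v *)
(* A positive barrier W on the closure of Theta minus the origin, comparable to
   (|x|^2 + |t|)^g for a small g > 0, gives both conclusions: if
   |f - f(0,0)| <= K W + e on the boundary, then |Pf - f(0,0)| <= K W + e inside.
   With s = - t and the tusk around x = sqrt s xhat, the barrier is
   s^g (B - exp (- k |x - sqrt s xhat|^2 / s)) within a fixed multiple of sqrt s
   of the origin of space, and (|x|^2 + A t)^g elsewhere, a minimum of the two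
   in between.  At each point it is touched from above by a paraboloid with
   Hessian beta I - k q^T q, q its gradient, which is a strict supersolution.
   By the definition of viscosity solutions such functions are superparabolic,
   which bounds Pf from above.  From below, a superparabolic u violating
   u >= f(0,0) - K W - e would be touched from below by a paraboloid which is a
   strict subsolution.  This is impossible by comparison on a small box with an
   explicit solution of almost the same jet, a Gaussian added to a constant. *)
Require Import Defs.
From HB Require Import structures.
From mathcomp Require Import all_boot all_order all_algebra.
From mathcomp Require Import all_classical all_reals all_analysis.
From mathcomp Require Import ring lra.
From mathcomp Require spectral complex.
Import Order.TTheory GRing.Theory Num.Theory.
Import numFieldNormedType.Exports.
Local Open Scope classical_set_scope.
Local Open Scope ring_scope.

(** The Hessian [beta I - k q^T q] is chosen because the equation is explicit on it: if [q] is the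
    gradient, the normalized p-Laplacian equals [(n + p - 2) beta - (p - 1) k |q|^2], and for
    [q = 0] the eigenvalue form of the operator gives the same expression. One strict inequality
    thus covers both cases of the definition, with no limit towards vanishing gradients. Touching
    from above is inherited by minima, so pieces that are smooth only separately can be glued. A
    Gaussian of height [E] has Hessian [- B I + E^-1 q^T q]; with [E = 1 / k] this is the negative
    of such a jet, and strictness pays for [B] slightly above [beta]. This is how a paraboloid is
    turned into a solution, the only kind of function with which a superparabolic function can be
    compared. The gradient of the exponential vanishes on the curve [x = sqrt s xhat]. The tusk
    removes a neighbourhood of it, so the rescaled squared distance [d] is bounded below on [Theta]
    and the term in [k^2 d] dominates for large [k]. Since [E = exp (- k d)] decays, [g (B - E)] is
    dominated only for bounded [d]; this is why a second piece takes over farther out and why [g] is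
    small. *)

(** * Calculus of functions with prescribed first and second directional derivatives *)

Section Smooth2.
Context {R : realType} {V : normedModType R}.
Implicit Types (U : set V) (x v w : V).

(* The first and second directional derivatives are given as data, and their
   linearity in the directions is required, so that the derivatives of composite
   functions come out as formulas, multilinear by construction. *)
Definition smooth2 U (f : V -> R) (f1 : V -> V -> R) (f2 : V -> V -> V -> R) :=
  forall x, U x ->
  [/\ {for x, continuous f},
      forall v, {for x, continuous (f1 v)} /\ is_derive x v f (f1 v x),
      forall v w,
        {for x, continuous (f2 v w)} /\ is_derive x w (f1 v) (f2 v w x),
      forall a v w, f1 (a *: v + w) x = a * f1 v x + f1 w x
    & forall a v v' w,
        f2 (a *: v + v') w x = a * f2 v w x + f2 v' w x /\
        f2 w (a *: v + v') x = a * f2 w v x + f2 w v' x].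

(** Restriction to lines: it gives access to the one-variable chain rule and mean value theorem. *)
Lemma is_derive_path (f : V -> R) x v (s : R) df :
  is_derive (s *: v + x) v f df ->
  is_derive s 1 (fun s : R => f (s *: v + x)) df.
Proof.
move=> [d e].
have E : (fun h : R => h^-1 *: (((fun s : R => f (s *: v + x)) \o shift s) (h *: 1)
            - (fun s : R => f (s *: v + x)) s)) =
         (fun h : R => h^-1 *: ((f \o shift (s *: v + x)) (h *: v) - f (s *: v + x))).
  apply/funext => h /=; congr (_ *: (f _ - _)).
  by rewrite [_%:A]mulr1 scalerDl addrA.
by apply: DeriveDef; rewrite /derivable/derive E.
Qed.

Lemma is_derive_unpath (f : V -> R) x v df :
  is_derive (0 : R) 1 (fun s : R => f (s *: v + x)) df -> is_derive x v f df.
Proof.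
move=> [d e].
have E : (fun h : R => h^-1 *: (((fun s : R => f (s *: v + x)) \o shift 0) (h *: 1)
            - (fun s : R => f (s *: v + x)) 0)) =
         (fun h : R => h^-1 *: ((f \o shift x) (h *: v) - f x)).
  by apply/funext => h /=; rewrite [_%:A]mulr1 addr0 scale0r add0r.
by move: d e; rewrite /derivable/derive E => d e; apply: DeriveDef.
Qed.

Lemma is_derive_comp1 (f : V -> R) (F : R -> R) x v df dF :
  is_derive x v f df -> is_derive (f x) 1 F dF ->
  is_derive x v (F \o f) (dF * df).
Proof.
move=> hf hF; apply: is_derive_unpath.
have h1 : is_derive (0 : R) 1 (fun s : R => f (s *: v + x)) df.
  by apply: is_derive_path; rewrite scale0r add0r.
have h2 : is_derive ((fun s : R => f (s *: v + x)) 0) 1 F dF.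
  by rewrite scale0r add0r.
by have := is_derive1_comp; apply.
Qed.

Lemma is_derive_continuous1 (F : R -> R) (y dF : R) :
  is_derive y 1 F dF -> {for y, continuous F}.
Proof.
by move=> [d _]; apply/differentiable_continuous/derivable1_diffP.
Qed.

Lemma smooth2S U U' f f1 f2 : U' `<=` U -> smooth2 U f f1 f2 -> smooth2 U' f f1 f2.
Proof. by move=> UU h x /UU /h. Qed.

Lemma smooth2_cst U c : smooth2 U (cst c) (fun _ => cst 0) (fun _ _ => cst 0).
Proof.
move=> x _; split => [|v|v w|a v w|a v v' w].
- exact: cst_continuous.
- by split; [exact: cst_continuous|exact: is_derive_cst].
- by split; [exact: cst_continuous|exact: is_derive_cst].
- by rewrite /= mulr0 addr0.
- by rewrite /= mulr0 addr0.
Qed.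

Lemma smooth2_linear U (l : V -> R) :
  (forall a v w, l (a *: v + w) = a * l v + l w) -> continuous l ->
  smooth2 U l (fun v => cst (l v)) (fun _ _ => cst 0).
Proof.
move=> ll lc x _; split => [|v|v w|a v w|a v v' w].
- exact: lc.
- split; first exact: cst_continuous.
  apply: is_derive_unpath.
  have -> : (fun s : R => l (s *: v + x)) = (cst (l v) * id + cst (l x))%R.
    by apply/funext => s; rewrite ll mulrC.
  by apply: is_derive_eq; rewrite /= /cst /GRing.scale /=; ring.
- by split; [exact: cst_continuous|exact: is_derive_cst].
- by rewrite /= ll.
- by rewrite /= mulr0 addr0.
Qed.

Lemma smooth2D U f f1 f2 g g1 g2 :
  smooth2 U f f1 f2 -> smooth2 U g g1 g2 ->
  smooth2 U (f \+ g) (fun v => f1 v \+ g1 v) (fun v w => f2 v w \+ g2 v w).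
Proof.
move=> hf hg x Ux; have [fc fd1 fd2 fl1 fl2] := hf x Ux.
have [gc gd1 gd2 gl1 gl2] := hg x Ux.
split => [|v|v w|a v w|a v v' w].
- exact: continuousD.
- split; first by apply: continuousD; [exact: (fd1 v).1|exact: (gd1 v).1].
  by have [_ ?] := fd1 v; have [_ ?] := gd1 v; apply: is_deriveD.
- split; first by apply: continuousD; [exact: (fd2 v w).1|exact: (gd2 v w).1].
  by have [_ ?] := fd2 v w; have [_ ?] := gd2 v w; apply: is_deriveD.
- by rewrite /= fl1 gl1; ring.
- by rewrite /= (fl2 a v v' w).1 (gl2 a v v' w).1 (fl2 a v v' w).2 (gl2 a v v' w).2; split; ring.
Qed.

Lemma smooth2M U f f1 f2 g g1 g2 :
  smooth2 U f f1 f2 -> smooth2 U g g1 g2 ->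
  smooth2 U (f \* g) (fun v => (f \* g1 v) \+ (g \* f1 v))
    (fun v w => ((f \* g2 v w) \+ (g1 v \* f1 w)) \+
                ((g \* f2 v w) \+ (f1 v \* g1 w))).
Proof.
move=> hf hg x Ux; have [fc fd1 fd2 fl1 fl2] := hf x Ux.
have [gc gd1 gd2 gl1 gl2] := hg x Ux.
split => [|v|v w|a v w|a v v' w].
- exact: continuousM.
- have [? ?] := fd1 v; have [? ?] := gd1 v; split.
    by apply: continuousD; apply: continuousM.
  exact: (@is_deriveM _ _ f g).
- have [? ?] := fd1 v; have [? ?] := gd1 v.
  have [? ?] := fd2 v w; have [? ?] := gd2 v w.
  have [? ?] := fd1 w; have [? ?] := gd1 w.
  split.
    by apply: continuousD; apply: continuousD; apply: continuousM.
  by apply: is_deriveD.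
- by rewrite /= fl1 gl1; ring.
- rewrite /= (fl2 a v v' w).1 (gl2 a v v' w).1 (fl2 a v v' w).2 (gl2 a v v' w).2.
  by rewrite fl1 gl1; split; ring.
Qed.

Lemma smooth2_comp U f f1 f2 (F F1 F2 : R -> R) :
  smooth2 U f f1 f2 ->
  (forall x, U x -> [/\ is_derive (f x) 1 F (F1 (f x)),
     is_derive (f x) 1 F1 (F2 (f x)) & {for f x, continuous F2}]) ->
  smooth2 U (F \o f) (fun v => (F1 \o f) \* f1 v)
    (fun v w => ((F2 \o f) \* (f1 v \* f1 w)) \+ ((F1 \o f) \* f2 v w)).
Proof.
move=> hf hF x Ux; have [fc fd1 fd2 fl1 fl2] := hf x Ux.
have [d1 d2 c2] := hF x Ux.
have c0 := is_derive_continuous1 _ _ _ d1.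
have c1 := is_derive_continuous1 _ _ _ d2.
have cc (G : R -> R) : {for f x, continuous G} -> {for x, continuous (G \o f)}.
  by move=> ?; exact: (@continuous_comp _ _ _ f G).
split => [|v|v w|a v w|a v v' w].
- exact: cc.
- have [? ?] := fd1 v; split; last exact: is_derive_comp1.
  by apply: continuousM; [exact: cc|].
- have [? ?] := fd1 v; have [? ?] := fd1 w; have [? dvw] := fd2 v w; split.
    by apply: continuousD; apply: continuousM; [exact: cc|exact: continuousM|exact: cc|].
  have h := is_derive_comp1 f F1 x w _ _ (fd1 w).2 d2.
  apply: is_derive_eq (is_deriveM h dvw) _.
  by rewrite /= /GRing.scale /=; ring.
- by rewrite /= fl1; ring.
- rewrite /= (fl2 a v v' w).1 (fl2 a v v' w).2 fl1.
  by split; ring.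
Qed.

Lemma smooth2_sum U (I : Type) (r : seq I) (f : I -> V -> R) f1 f2 :
  (forall i, smooth2 U (f i) (f1 i) (f2 i)) ->
  smooth2 U (fun x => \sum_(i <- r) f i x) (fun v x => \sum_(i <- r) f1 i v x)
     (fun v w x => \sum_(i <- r) f2 i v w x).
Proof.
move=> h; elim: r => [|i r IH].
  have := smooth2_cst U 0; congr smooth2.
  - by apply/funext => x; rewrite big_nil.
  - by apply/funext => v; apply/funext => x; rewrite big_nil.
  - by apply/funext => v; apply/funext => w; apply/funext => x; rewrite big_nil.
have := smooth2D _ _ _ _ _ _ _ (h i) IH; congr smooth2.
- by apply/funext => x; rewrite big_cons.
- by apply/funext => v; apply/funext => x; rewrite big_cons.
- by apply/funext => v; apply/funext => w; apply/funext => x; rewrite big_cons.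
Qed.

End Smooth2.

(** * Linearity in the direction, symmetry of second derivatives, Taylor's formula *)

Section Smooth2Theory.
Context {R : realType} {V : normedModType R}.
Implicit Types (U : set V) (x v w z : V).

Lemma is_derive_dirZ (f : V -> R) x v (a : R) df :
  is_derive x v f df -> is_derive x (a *: v) f (a * df).
Proof.
move=> h; apply: is_derive_unpath.
have -> : (fun s : R => f (s *: (a *: v) + x)) =
    (fun s : R => f (s *: v + x)) \o (fun s => a * s).
  by apply/funext => s /=; rewrite scalerA mulrC.
have h0 : is_derive (a * 0) 1 (fun s : R => f (s *: v + x)) df.
  by apply: is_derive_path; rewrite mulr0 scale0r add0r.
have h1 : is_derive (0 : R) 1 (fun s => a * s) (a : R).
  have -> : (fun s => a * s) = (cst a * id)%R :> (R -> R) by [].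
  by apply: is_derive_eq; rewrite /= /cst /GRing.scale /=; ring.
by have := @is_derive1_comp _ (fun s : R => f (s *: v + x)) (fun s => a * s) 0 _ _ h0 h1; rewrite mulrC.
Qed.

Lemma mvt01 (k dk : R -> R) :
  (forall s : R, 0 <= s <= 1 -> is_derive s 1 k (dk s)) ->
  exists2 s : R, 0 < s < 1 & k 1 - k 0 = dk s.
Proof.
move=> d; have [||s] := @MVT R k dk 0 1 ltr01.
- by move=> s; rewrite in_itv /= => /andP[? ?]; apply: d; lra.
- by apply: derivable_within_continuous => s; rewrite in_itv /= => /d [].
- by rewrite in_itv /= => s01; rewrite subr0 mulr1 => e; exists s.
Qed.

Lemma mvt_dir (f df : V -> R) x v :
  (forall s : R, 0 <= s <= 1 -> is_derive (s *: v + x) v f (df (s *: v + x))) ->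
  exists2 s : R, 0 < s < 1 & f (v + x) - f x = df (s *: v + x).
Proof.
move=> h; have [s s01] := mvt01 (fun s => f (s *: v + x)) _
  (fun s s01 => is_derive_path _ _ _ _ _ (h s s01)).
by rewrite scale1r scale0r add0r; exists s.
Qed.

Lemma continuous_normP (F : V -> R) x : {for x, continuous F} ->
  forall e : R, 0 < e ->
  exists2 r, 0 < r & forall z, `|z| < r -> `|F (z + x) - F x| < e.
Proof.
move=> /cvgrPdist_lt cF e e0; have /nbhs_normP [r /= r0 hr] := cF _ e0.
exists r => // z zr; rewrite distrC; apply: hr => /=.
by rewrite opprD addrA addrAC subrr sub0r normrN.
Qed.

Lemma open_normP U x : open U -> U x ->
  exists2 r : R, 0 < r & forall z, `|z| < r -> U (z + x).
Proof.
move=> oU Ux; have /nbhs_normP [r /= r0 hr] := open_nbhs_nbhs (conj oU Ux).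
exists r => // z zr; apply: hr => /=.
by rewrite opprD addrA addrAC subrr sub0r normrN.
Qed.

Lemma eqr_approx (a b c : R) :
  (forall e : R, 0 < e -> `|a - b| <= c * e) -> a = b.
Proof.
move=> h; apply/eqP; rewrite -subr_eq0 -normr_eq0 eq_le normr_ge0 andbT leNgt.
apply/negP => ab; pose e := `|a - b| / (2 * (`|c| + 1)).
have c0 : 0 < `|c| + 1 by apply: ltr_wpDl.
have e0 : 0 < e by rewrite divr_gt0 // mulr_gt0.
have := h _ e0; rewrite leNgt => /negP; apply.
apply: (@le_lt_trans _ _ (`|c| * e)); first by rewrite ler_wpM2r ?ler_norm // ltW.
apply: (@lt_le_trans _ _ ((`|c| + 1) * e)); first by rewrite ltr_pM2r // ltrDl.
have -> : (`|c| + 1) * e = `|a - b| / 2 by rewrite /e; field; rewrite gt_eqF.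
by have := normr_ge0 (a - b); lra.
Qed.

Lemma ler_dist3 (a b c A B e : R) : `|A - a| < e -> `|B - b| < e ->
  `|A + B - c| < e -> `|c - (a + b)| <= 3 * e.
Proof.
by rewrite !ltr_norml ler_norml => /andP[? ?] /andP[? ?] /andP[? ?]; apply/andP; split; lra.
Qed.

Lemma ler_dist2 (a b A e : R) : `|A - a| < e -> `|A - b| < e -> `|a - b| <= 2 * e.
Proof.
by rewrite !ltr_norml ler_norml => /andP[? ?] /andP[? ?]; apply/andP; split; lra.
Qed.

Lemma itv01W (s : R) : 0 < s < 1 -> 0 <= s <= 1.
Proof. by move=> /andP[/ltW -> /ltW ->]. Qed.

Definition C1 U (g : V -> R) := forall x, U x -> forall v, derivable g x v /\
  {for x, continuous ('D_v g)}.

Lemma derive_dirZ U (g : V -> R) x v (a : R) : C1 U g -> U x ->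
  'D_(a *: v) g x = a * 'D_v g x.
Proof.
move=> hg Ux; have [d _] := hg x Ux v.
have := is_derive_dirZ g x v a _ (DeriveDef d (erefl _)).
by move=> h; rewrite derive_val.
Qed.

Lemma small_scale (m r : R) : 0 < r -> 0 <= m ->
  exists2 s : R, 0 < s & s * m < r.
Proof.
move=> r0 m0; exists (r / (m + 1)); first by apply: divr_gt0 => //; lra.
rewrite mulrAC ltr_pdivrMr; last by lra.
by rewrite mulrDr; lra.
Qed.

(** Only continuous directional derivatives are given. The increment of [g] along [s (v + w)] is
    computed by the mean value theorem once in a single step and once in two steps; the intermediate
    points tend to [x] with [s], and continuity at [x] identifies the limits. *)
Lemma derive_dirD U (g : V -> R) x v w : open U -> C1 U g -> U x ->
  'D_(v + w) g x = 'D_v g x + 'D_w g x.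
Proof.
move=> oU hg Ux; apply: (@eqr_approx _ _ 3) => e e0.
have [r0 r00 hr0] := open_normP U x oU Ux.
have [r1 r10 hr1] := continuous_normP _ _ (hg x Ux v).2 e e0.
have [r2 r20 hr2] := continuous_normP _ _ (hg x Ux w).2 e e0.
have [r3 r30 hr3] := continuous_normP _ _ (hg x Ux (v + w)).2 e e0.
pose r := Num.min (Num.min r0 r1) (Num.min r2 r3).
have rp : 0 < r by rewrite !lt_min r00 r10 r20 r30.
have [s s0 sr] := small_scale (`|v| + `|w|) r rp (addr_ge0 (normr_ge0 _) (normr_ge0 _)).
have bnd (a b : R) : 0 <= a <= 1 -> 0 <= b <= 1 -> `|a *: (s *: v) + b *: (s *: w)| < r.
  move=> a01 b01; apply: le_lt_trans sr; apply: le_trans (ler_normD _ _) _.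
  rewrite !normrZ (gtr0_norm s0) mulrDr lerD //.
    rewrite -[leRHS]mul1r ler_wpM2r //; last by rewrite ger0_norm; lra.
    by rewrite mulr_ge0 // ltW.
  rewrite -[leRHS]mul1r ler_wpM2r //; last by rewrite ger0_norm; lra.
  by rewrite mulr_ge0 // ltW.
have small z : `|z| < r -> [/\ `|z| < r0, `|z| < r1, `|z| < r2 & `|z| < r3].
  by rewrite !lt_min => /andP[/andP[-> ->] /andP[-> ->]].
have dd u (z : V) : U z -> is_derive z (s *: u) g (s * 'D_u g z).
  by move=> Uz; apply: is_derive_dirZ; apply: DeriveDef (hg z Uz u).1 _.
have s00 : s != 0 by rewrite gt_eqF.
have one : 0 <= (1 : R) <= 1 by lra.
have zer : 0 <= (0 : R) <= 1 by lra.
have [|a a01 ea] := mvt_dir g (fun z => s * 'D_v g z) (s *: w + x) (s *: v).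
  move=> t t01; apply: dd; rewrite addrA; apply: hr0.
  by have [] := small _ (bnd _ _ t01 one); rewrite scale1r.
have [|b b01 eb] := mvt_dir g (fun z => s * 'D_w g z) x (s *: w).
  move=> t t01; apply: dd; apply: hr0.
  by have [] := small _ (bnd _ _ zer t01); rewrite scale0r add0r.
have [|c c01 ec] := mvt_dir g (fun z => s * 'D_(v + w) g z) x (s *: (v + w)).
  move=> t t01; apply: dd; apply: hr0.
  by have [] := small _ (bnd _ _ t01 t01); rewrite -!scalerDr.
have E : 'D_(v + w) g (c *: (s *: (v + w)) + x) =
  'D_v g (a *: (s *: v) + (s *: w + x)) + 'D_w g (b *: (s *: w) + x).
  apply: (mulfI s00); rewrite mulrDr -ec -ea -eb scalerDr !addrA; ring.
have [_ _ _ k3] := small _ (bnd c c (itv01W _ c01) (itv01W _ c01)).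
have [_ k1 _ _] := small _ (bnd a 1 (itv01W _ a01) one).
have [_ _ k2 _] := small _ (bnd 0 b zer (itv01W _ b01)).
have h1 := hr1 _ k1; rewrite scale1r -addrA in h1.
have h2 := hr2 _ k2; rewrite scale0r add0r in h2.
have h3 := hr3 _ k3; rewrite -scalerDr -(scalerDr s) E in h3.
exact: ler_dist3 h1 h2 h3.
Qed.

(** Schwarz's argument: the second difference of [f] over the parallelogram spanned by [s v] and
    [s w] is [s^2] times a value of either mixed derivative near [x]. *)
Lemma smooth2_sym U (f : V -> R) f1 f2 x v w : open U -> smooth2 U f f1 f2 ->
  U x -> f2 v w x = f2 w v x.
Proof.
move=> oU hf Ux; apply: (@eqr_approx _ _ 2) => e e0.
have [_ _ h2 _ _] := hf x Ux.
have [r0 r00 hr0] := open_normP U x oU Ux.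
have [r1 r10 hr1] := continuous_normP _ _ (h2 v w).1 e e0.
have [r2 r20 hr2] := continuous_normP _ _ (h2 w v).1 e e0.
pose r := Num.min (Num.min r0 r1) r2.
have rp : 0 < r by rewrite !lt_min r00 r10 r20.
have [s s0 sr] := small_scale (`|v| + `|w|) r rp (addr_ge0 (normr_ge0 _) (normr_ge0 _)).
have bnd (a b : R) : 0 <= a <= 1 -> 0 <= b <= 1 -> `|a *: (s *: v) + b *: (s *: w)| < r.
  move=> a01 b01; apply: le_lt_trans sr; apply: le_trans (ler_normD _ _) _.
  rewrite !normrZ (gtr0_norm s0) mulrDr lerD //.
    rewrite -[leRHS]mul1r ler_wpM2r //; last by rewrite ger0_norm; lra.
    by rewrite mulr_ge0 // ltW.
  rewrite -[leRHS]mul1r ler_wpM2r //; last by rewrite ger0_norm; lra.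
  by rewrite mulr_ge0 // ltW.
have small z : `|z| < r -> [/\ `|z| < r0, `|z| < r1 & `|z| < r2].
  by rewrite !lt_min => /andP[/andP[-> ->] ->].
have one : 0 <= (1 : R) <= 1 by lra.
have zer : 0 <= (0 : R) <= 1 by lra.
have key (v' w' : V) : (forall a b : R, 0 <= a <= 1 -> 0 <= b <= 1 ->
      U (a *: (s *: v') + b *: (s *: w') + x)) ->
    exists a b : R, [/\ 0 <= a <= 1, 0 <= b <= 1 &
      f (s *: v' + s *: w' + x) - f (s *: w' + x) - (f (s *: v' + x) - f x) =
      s * (s * f2 v' w' (a *: (s *: v') + b *: (s *: w') + x))].
  move=> Uab.
  have d (t : R) : 0 <= t <= 1 -> is_derive t 1
      ((fun t : R => f (t *: (s *: v') + (s *: w' + x))) -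
       (fun t : R => f (t *: (s *: v') + x)))
      (s * f1 v' (t *: (s *: v') + (s *: w' + x)) - s * f1 v' (t *: (s *: v') + x)).
    move=> t01; apply: is_deriveB; apply: is_derive_path; apply: is_derive_dirZ.
      have [_ k _ _ _] := hf _ (Uab t 1 t01 one).
      by have [_] := k v'; rewrite scale1r addrA.
    have [_ k _ _ _] := hf _ (Uab t 0 t01 zer).
    by have [_] := k v'; rewrite scale0r addr0.
  have [a a01 ea] := mvt01 _ _ d.
  have [|b b01 eb] := mvt_dir (f1 v') (fun z => s * f2 v' w' z)
      (a *: (s *: v') + x) (s *: w').
    move=> t t01; apply: is_derive_dirZ; rewrite addrCA addrA.
    by have [_ _ k _ _] := hf _ (Uab a t (itv01W _ a01) t01); exact: (k v' w').2.
  exists a, b; split; [exact: itv01W|exact: itv01W|].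
  have -> : a *: (s *: v') + b *: (s *: w') + x =
            b *: (s *: w') + (a *: (s *: v') + x) by rewrite addrCA addrA.
  rewrite -eb mulrBr -[s *: v' + s *: w' + x]addrA (addrCA (s *: w')) -ea !fctE /=.
  by rewrite !scale1r !scale0r !add0r; ring.
have [|a [b [a01 b01 e1]]] := key v w.
  by move=> a b a01 b01; apply: hr0; have [] := small _ (bnd _ _ a01 b01).
have [|c [d [c01 d01 e2]]] := key w v.
  move=> c d c01 d01; apply: hr0; rewrite addrC.
  by have [] := small _ (bnd _ _ d01 c01).
have ss : s * s != 0 by rewrite mulf_neq0 // gt_eqF.
have E : f2 v w (a *: (s *: v) + b *: (s *: w) + x) =
         f2 w v (c *: (s *: w) + d *: (s *: v) + x).
  apply: (mulfI ss); rewrite -!mulrA -e1 -e2 [s *: w + s *: v]addrC; ring.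
have [_ k1 _] := small _ (bnd _ _ a01 b01).
have [_ _ k2] := small _ (bnd _ _ d01 c01).
have := hr2 _ k2; have := hr1 _ k1; rewrite E (addrC (d *: _)).
exact: ler_dist2.
Qed.

Lemma taylor2 U (f : V -> R) f1 f2 x v : smooth2 U f f1 f2 ->
  (forall s : R, 0 <= s <= 1 -> U (s *: v + x)) ->
  exists2 s : R, 0 < s < 1 & f (v + x) = f x + f1 v x + f2 v v (s *: v + x) / 2.
Proof.
move=> hf Us.
pose k s := f (s *: v + x); pose k1 s := f1 v (s *: v + x).
pose k2 s := f2 v v (s *: v + x).
have d0 (s : R) : 0 <= s <= 1 -> is_derive s 1 k (k1 s).
  by move=> /Us Ux; apply: is_derive_path; have [_ h _ _ _] := hf _ Ux; exact: (h v).2.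
have d1 (s : R) : 0 <= s <= 1 -> is_derive s 1 k1 (k2 s).
  by move=> /Us Ux; apply: is_derive_path; have [_ _ h _ _] := hf _ Ux; exact: (h v v).2.
pose c := k 1 - k 0 - k1 0.
pose o (s : R) := 1 - s.
have do' (s : R) : is_derive s 1 o (-1).
  have -> : o = (cst 1 - id)%R by [].
  by apply: is_derive_eq; rewrite sub0r.
(* By the choice of [c], [m 0 = m 1], while the derivative of [m] is [(1 - s) (k2 - 2 c)]; a zero of
   it in the open interval is the Lagrange form of the remainder. *)
pose m := (k + k1 * o + (cst c) * (o * o))%R.
have dm (s : R) : 0 <= s <= 1 ->
    is_derive s 1 m (k1 s + (k1 s *: (-1 : R) + o s *: k2 s) +
       (c *: (o s *: (-1 : R) + o s *: (-1 : R)) + (o * o)%R s *: (0 : R))).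
  move=> s01; have := d0 _ s01; have := d1 _ s01 => h1 h0.
  have h2 : is_derive s 1 (k + k1 * o)%R (k1 s + (k1 s *: (-1 : R) + o s *: k2 s)).
    exact: (is_deriveD h0 (is_deriveM h1 (do' s))).
  exact: (is_deriveD h2 (is_deriveM (is_derive_cst c s 1) (is_deriveM (do' s) (do' s)))).
have [s s01 es] := mvt01 _ _ dm.
exists s => //.
have os0 : o s != 0 by rewrite /o subr_eq0 gt_eqF //; case/andP: s01.
have : c - k2 s / 2 = 0.
  apply: (mulfI os0); rewrite mulr0.
  move: es; rewrite /m !fctE /= /GRing.scale /= /c /o !subrr !subr0 => es.
  have : (1 - s) * k2 s - 2 * (1 - s) * (k 1 - k 0 - k1 0) = 0 by lra.
  by lra.
rewrite /c /k /k1 /k2 scale1r scale0r add0r; lra.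
Qed.

End Smooth2Theory.

(** * Necessary conditions at a minimum, and the link with the predicate [C2_on] *)

Section ExtremumC2.
Context {R : realType} {V : normedModType R}.
Implicit Types (U : set V) (x v w z : V).

Lemma smooth2_f1Z U (f : V -> R) f1 f2 x v (a : R) : smooth2 U f f1 f2 -> U x ->
  f1 (a *: v) x = a * f1 v x.
Proof.
move=> hf Ux; have [_ _ _ l _] := hf x Ux.
have h0 : f1 0 x = 0 by have := l 1 0 0; rewrite scale1r addr0; lra.
by rewrite -[a *: v]addr0 l h0 addr0.
Qed.

Lemma smooth2_f2Z U (f : V -> R) f1 f2 x v w (a b : R) : smooth2 U f f1 f2 -> U x ->
  f2 (a *: v) (b *: w) x = a * b * f2 v w x.
Proof.
move=> hf Ux; have [_ _ _ _ l] := hf x Ux.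
have h0 z : f2 0 z x = 0 by have := (l 1 0 0 z).1; rewrite scale1r addr0; lra.
have h1 z : f2 z 0 x = 0 by have := (l 1 0 0 z).2; rewrite scale1r addr0; lra.
by rewrite -[a *: v]addr0 (l _ _ _ _).1 h0 addr0 -[b *: w]addr0 (l _ _ _ _).2 h1 addr0 mulrA.
Qed.

(** For every [e > 0], Taylor's formula gives [0 <= s f1 + s^2 (f2 + e) / 2] for small [s] of both
    signs. Dividing by [s] shows [f1 = 0]; if [f2 < 0], the choice [e = - f2 / 2] is
    contradictory. *)
Lemma smooth2_min U (f : V -> R) f1 f2 x v : open U -> smooth2 U f f1 f2 -> U x ->
  (\forall y \near x, f x <= f y) -> f1 v x = 0 /\ 0 <= f2 v v x.
Proof.
move=> oU hf Ux /nbhs_normP [r0 /= r00 hr0].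
have [r1 r10 hr1] := open_normP U x oU Ux.
have [_ _ h2 _ _] := hf x Ux.
have key (e : R) : 0 < e -> exists2 d : R, 0 < d & forall s : R, `|s| <= d ->
    0 <= s * f1 v x + s * s * (f2 v v x + e) / 2.
  move=> e0; have [r2 r20 hr2] := continuous_normP _ _ (h2 v v).1 e e0.
  pose r := Num.min (Num.min r0 r1) r2.
  have rp : 0 < r by rewrite !lt_min r00 r10 r20.
  have [d d0 dr] := small_scale `|v| r rp (normr_ge0 _).
  exists d => // s sd.
  have sm (t : R) : 0 <= t <= 1 -> `|t *: (s *: v)| < r.
    move=> /andP[t0 t1]; apply: le_lt_trans dr; rewrite !normrZ (ger0_norm t0) mulrA.
    rewrite ler_wpM2r // -[d]mul1r; apply: ler_pM => //.
  have [|t /andP[t0 t1] E] := taylor2 U f f1 f2 x (s *: v) hf.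
    by move=> t t01; apply: hr1; have := sm t t01; rewrite !lt_min => /andP[/andP[_ ->] _].
  have st := sm t ltac:(lra).
  have Ut : U (t *: (s *: v) + x).
    by apply: hr1; move: st; rewrite !lt_min => /andP[/andP[_ ->] _].
  move: E; rewrite (smooth2_f1Z U f f1 f2) // (smooth2_f2Z U f f1 f2) // => E.
  have : f x <= f (s *: v + x).
    apply: hr0 => /=; rewrite opprD addrA addrAC subrr sub0r normrN.
    by have := sm 1 ltac:(lra); rewrite scale1r !lt_min => /andP[/andP[-> _] _].
  rewrite E -addrA lerDl => /le_trans; apply; rewrite lerD2l ler_pM2r ?invr_gt0 //.
  rewrite ler_wpM2l -?expr2 ?sqr_ge0 //.
  have := hr2 (t *: (s *: v)); move: st; rewrite !lt_min => /andP[_ ->] /(_ isT).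
  by rewrite ltr_norml => /andP[_ ?]; lra.
have E0 : f1 v x = 0.
  apply: (@eqr_approx _ _ _ 1) => e e0; rewrite subr0 mul1r.
  have [d d0 hd] := key 1 ltr01.
  have [s s0 se] := small_scale (`|f2 v v x + 1|) (Num.min d e) ltac:(by rewrite lt_min d0) (normr_ge0 _).
  pose t := Num.min s d.
  have t0 : 0 < t by rewrite lt_min s0.
  have td : t <= d by rewrite ge_min lexx orbT.
  have k1 := hd t ltac:(by rewrite gtr0_norm).
  have k2 := hd (- t) ltac:(by rewrite normrN gtr0_norm).
  have b : t * (f2 v v x + 1) <= e.
    apply: (@le_trans _ _ (s * `|f2 v v x + 1|)).
      apply: (@le_trans _ _ (t * `|f2 v v x + 1|)); first by rewrite ler_pM2l // ler_norm.
      by rewrite ler_wpM2r // ge_min lexx.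
    by apply: ltW; apply: lt_le_trans se _; rewrite ge_min lexx orbT.
  have e1 : t * (f1 v x + t * (f2 v v x + 1) / 2) >= 0 by lra.
  have e2 : t * (- f1 v x + t * (f2 v v x + 1) / 2) >= 0 by lra.
  rewrite pmulr_rge0 // in e1; rewrite pmulr_rge0 // in e2.
  by rewrite ler_norml; apply/andP; split; lra.
split=> //; rewrite leNgt; apply/negP => lt0.
have [d d0 hd] := key (- f2 v v x / 2) ltac:(lra).
have := hd d; rewrite E0 mulr0 add0r gtr0_norm // => /(_ (lexx _)).
have dd : 0 < d * d by rewrite mulr_gt0.
by rewrite leNgt => /negP; apply; rewrite -mulrA pmulr_rlt0 //; lra.
Qed.

Lemma smooth2_derive U (f : V -> R) f1 f2 x : open U -> smooth2 U f f1 f2 -> U x ->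
  (forall v, 'D_v f x = f1 v x) /\ (forall v w, 'D_w ('D_v f) x = f2 v w x).
Proof.
move=> oU hf Ux.
have e1 y : U y -> forall v, 'D_v f y = f1 v y.
  by move=> Uy v; have [_ h _ _ _] := hf y Uy; case: (h v) => _ d; rewrite derive_val.
split=> [v|v w]; first exact: e1.
have -> : 'D_w ('D_v f) x = 'D_w (f1 v) x.
  by apply: near_eq_derive; apply: filterS (open_nbhs_nbhs (conj oU Ux)) => y Uy; exact: e1.
by have [_ _ h _ _] := hf x Ux; case: (h v w) => _ d; rewrite derive_val.
Qed.

Lemma derive2_dir_linear U (phi : V -> R) x v v' w (a : R) : open U -> C1 U phi ->
  (forall v, C1 U ('D_v phi)) -> U x ->
  'D_w ('D_(a *: v + v') phi) x = a * 'D_w ('D_v phi) x + 'D_w ('D_v' phi) x.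
Proof.
move=> oU h1 h2 Ux.
have dv := DeriveDef (h2 v x Ux w).1 (erefl _).
have dv' := DeriveDef (h2 v' x Ux w).1 (erefl _).
have d := is_deriveD (is_deriveM (is_derive_cst a x w) dv) dv'.
have -> : 'D_w ('D_(a *: v + v') phi) x = 'D_w (cst a * 'D_v phi + 'D_v' phi)%R x.
  apply: near_eq_derive; apply: filterS (open_nbhs_nbhs (conj oU Ux)) => y Uy.
  by rewrite (derive_dirD U) // (derive_dirZ U).
by case: d => _ ->; rewrite /GRing.scale /= mulr0 addr0.
Qed.

Lemma smooth2_derivable2 U (f : V -> R) f1 f2 x v w : open U -> smooth2 U f f1 f2 ->
  U x -> derivable ('D_v f) x w.
Proof.
move=> oU hf Ux; have [_ _ /(_ v w) [_ d] _ _] := hf x Ux.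
apply: near_eq_derivable (@ex_derive _ _ _ _ _ _ _ d).
apply: filterS (open_nbhs_nbhs (conj oU Ux)) => y Uy.
by have [-> _] := smooth2_derive U f f1 f2 y oU hf Uy.
Qed.

End ExtremumC2.

Section C2onX.
Context {R : realType} {n : nat}.
Notation X := ('rV[R]_n * R)%type.

(** The definition of class C2 speaks of each direction separately; linearity in the directions is
    what [derive_dirD] and [derive_dirZ] supply. *)
Lemma C2_on_smooth2 (U : set X) (phi : X -> R) : open U -> C2_on U phi ->
  smooth2 U phi (fun v => 'D_v phi) (fun v w => 'D_w ('D_v phi)).
Proof.
move=> oU [c1 c2].
have h1 : C1 U phi by move=> x /c1 [_].
have h2 v : C1 U ('D_v phi) by move=> x /(c2 v) [_].
move=> x Ux; split.
- exact: (c1 x Ux).1.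
- by move=> v; have [d c] := h1 x Ux v; split.
- by move=> v w; have [d c] := h2 v x Ux w; split.
- by move=> a v w; rewrite (derive_dirD U _ _ _ _ oU h1 Ux) (derive_dirZ U _ _ _ _ h1 Ux).
- move=> a v v' w; split.
    exact: (derive2_dir_linear U).
  by rewrite (derive_dirD U _ _ _ _ oU (h2 w) Ux) (derive_dirZ U _ _ _ _ (h2 w) Ux).
Qed.

Lemma smooth2_C2_on (U : set X) (f : X -> R) f1 f2 : open U -> smooth2 U f f1 f2 ->
  C2_on U f.
Proof.
move=> oU hf.
have near_eq (g h : X -> R) x : U x -> {for x, continuous h} ->
    (forall y, U y -> g y = h y) -> {for x, continuous g}.
  move=> Ux hc e; rewrite /prop_for/continuous_at e //.
  apply: cvg_trans hc; apply: near_eq_cvg.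
  by apply: filterS (open_nbhs_nbhs (conj oU Ux)) => y /e.
split.
  move=> x Ux; have [c h1 _ _ _] := hf x Ux; split=> // v.
  have [c1 d] := h1 v; split; first exact: ex_derive.
  apply: near_eq c1 _ => // y Uy.
  by have [-> _] := smooth2_derive U f f1 f2 y oU hf Uy.
move=> v x Ux; have [c h1 h2 _ _] := hf x Ux.
split; first by apply: near_eq (h1 v).1 _ => // y Uy; have [-> _] := smooth2_derive U f f1 f2 y oU hf Uy.
move=> w; have [c2 d2] := h2 v w; split.
  exact: (smooth2_derivable2 U f f1 f2).
by apply: near_eq c2 _ => // y Uy; have [_ ->] := smooth2_derive U f f1 f2 y oU hf Uy.
Qed.

End C2onX.

(** * The Euclidean scalar product and quadratic forms *)

Section Dotv.
Context {R : realType} {n : nat}.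
Implicit Types (x y z : 'rV[R]_n) (a : R).

Lemma dotvC x y : dotv x y = dotv y x.
Proof. by apply: eq_bigr => i _; rewrite mulrC. Qed.

Lemma dotvDl x y z : dotv (x + y) z = dotv x z + dotv y z.
Proof. by rewrite -big_split; apply: eq_bigr => i _; rewrite mxE mulrDl. Qed.

Lemma dotvZl a x y : dotv (a *: x) y = a * dotv x y.
Proof. by rewrite /dotv mulr_sumr; apply: eq_bigr => i _; rewrite mxE mulrA. Qed.

Lemma dotvDr x y z : dotv x (y + z) = dotv x y + dotv x z.
Proof. by rewrite dotvC dotvDl !(dotvC x). Qed.

Lemma dotvZr a x y : dotv x (a *: y) = a * dotv x y.
Proof. by rewrite dotvC dotvZl dotvC. Qed.

Lemma dotvNl x y : dotv (- x) y = - dotv x y.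
Proof. by rewrite -scaleN1r dotvZl mulN1r. Qed.

Lemma dotvNr x y : dotv x (- y) = - dotv x y.
Proof. by rewrite dotvC dotvNl dotvC. Qed.

Lemma dotv0l x : dotv 0 x = 0.
Proof. by rewrite -(scale0r x) dotvZl mul0r. Qed.

Lemma dotv0r x : dotv x 0 = 0.
Proof. by rewrite dotvC dotv0l. Qed.

Lemma dotv_ge0 x : 0 <= dotv x x.
Proof. by apply: sumr_ge0 => i _; rewrite -expr2 sqr_ge0. Qed.

Lemma sqr_coord_le_dotv x i : x 0 i ^+ 2 <= dotv x x.
Proof.
rewrite /dotv (bigD1 i) //= -expr2 lerDl.
by apply: sumr_ge0 => j _; rewrite -expr2 sqr_ge0.
Qed.

Lemma dotv_eq0 x : (dotv x x == 0) = (x == 0).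
Proof.
apply/eqP/eqP => [h|->]; last exact: dotv0l.
apply/rowP => i; rewrite mxE; apply/eqP.
by rewrite -sqrf_eq0 eq_le sqr_ge0 andbT -h sqr_coord_le_dotv.
Qed.

Lemma dotv_gt0 x : (0 < dotv x x) = (x != 0).
Proof. by rewrite lt_def dotv_ge0 andbT dotv_eq0. Qed.

Lemma dotv_sqr_le x y : dotv x y ^+ 2 <= dotv x x * dotv y y.
Proof.
have [->|y0] := eqVneq y 0; first by rewrite !dotv0r expr0n mulr0.
have yy : 0 < dotv y y by rewrite dotv_gt0.
have := dotv_ge0 (dotv y y *: x - dotv x y *: y).
rewrite !(dotvDl, dotvDr, dotvNl, dotvNr, dotvZl, dotvZr) (dotvC y x) => h.
have : 0 <= dotv y y * (dotv x x * dotv y y - dotv x y ^+ 2) by lra.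
by rewrite pmulr_rge0 // subr_ge0.
Qed.

Lemma enorm_ge0 x : 0 <= enorm x.
Proof. exact: sqrtr_ge0. Qed.

Lemma enorm_sqr x : enorm x ^+ 2 = dotv x x.
Proof. by rewrite sqr_sqrtr // dotv_ge0. Qed.

Lemma dotv_enorm_le x y : `|dotv x y| <= enorm x * enorm y.
Proof.
rewrite -(@ler_pXn2r _ 2) ?nnegrE ?mulr_ge0 ?enorm_ge0 //.
by rewrite -normrX ger0_norm ?sqr_ge0 // exprMn !enorm_sqr dotv_sqr_le.
Qed.

Lemma ler_enormD x y : enorm (x + y) <= enorm x + enorm y.
Proof.
rewrite -(@ler_pXn2r _ 2) ?nnegrE ?addr_ge0 ?enorm_ge0 //.
rewrite sqrrD !enorm_sqr dotvDl !dotvDr (dotvC y x).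
have := dotv_enorm_le x y; rewrite ler_norml => /andP[_ ?]; lra.
Qed.

Lemma enormZ a x : enorm (a *: x) = `|a| * enorm x.
Proof. by rewrite /enorm dotvZl dotvZr mulrA -expr2 sqrtrM ?sqr_ge0 // sqrtr_sqr. Qed.

Lemma enormN x : enorm (- x) = enorm x.
Proof. by rewrite -scaleN1r enormZ normrN1 mul1r. Qed.

Lemma row_dotE x (B : 'M[R]_n) y :
  dotv (x *m B) y = \sum_i \sum_j x 0 i * y 0 j * B i j.
Proof.
rewrite /dotv exchange_big /=; apply: eq_bigr => j _.
by rewrite mxE mulr_suml; apply: eq_bigr => i _; rewrite mulrAC.
Qed.

(* Sum over [i, j] the values of the form at [q_j e_i - q_i e_j]. *)
Lemma psd_form_le_trace (B : 'M[R]_n) (q : 'rV[R]_n) :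
  (forall z, 0 <= dotv (z *m B) z) -> dotv (q *m B) q <= dotv q q * \tr B.
Proof.
move=> psd.
have bE i j : dotv (delta_mx 0 i *m B) (delta_mx 0 j : 'rV_n) = B i j.
  rewrite -rowE /dotv (bigD1 j) //= !mxE !eqxx mulr1 big1 ?addr0 // => k kj.
  by rewrite !mxE (negbTE kj) andbF mulr0.
have h i j : 0 <= (q 0 j * q 0 j) * B i i - (q 0 i * q 0 j) * B i j
     - ((q 0 j * q 0 i) * B j i - (q 0 i * q 0 i) * B j j).
  have := psd (q 0 j *: delta_mx 0 i - q 0 i *: delta_mx 0 j).
  rewrite mulmxBl -!scalemxAl !(dotvDl, dotvDr, dotvNl, dotvNr, dotvZl, dotvZr) !bE; lra.
have S1 : \sum_i \sum_j (q 0 j * q 0 j) * B i i = dotv q q * \tr B.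
  rewrite /mxtrace big_distrr /=; apply: eq_bigr => i _.
  by rewrite /dotv mulr_suml.
have S2 : \sum_i \sum_j (q 0 i * q 0 i) * B j j = dotv q q * \tr B.
  by rewrite exchange_big.
have S3 : \sum_i \sum_j (q 0 i * q 0 j) * B i j = dotv (q *m B) q by rewrite row_dotE.
have S4 : \sum_i \sum_j (q 0 j * q 0 i) * B j i = dotv (q *m B) q by rewrite exchange_big.
have : 0 <= \sum_i \sum_j ((q 0 j * q 0 j) * B i i - (q 0 i * q 0 j) * B i j
     - ((q 0 j * q 0 i) * B j i - (q 0 i * q 0 i) * B j j)).
  by apply: sumr_ge0 => i _; apply: sumr_ge0 => j _; exact: h.
under eq_bigr do rewrite !sumrB.
rewrite !sumrB S1 S2 S3 S4; lra.
Qed.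

End Dotv.

(** * Monotonicity of the operator in the Hessian *)

Section SymmetricEigenvalue.
Import complex.

(** Let [x + i y] be a complex eigenvector with eigenvalue [a]. Symmetry gives
    [<x A, y> = <y A, x>], that is, [Im a (|x|^2 + |y|^2) = 0]; so [a] is real and a nonzero one of
    [x], [y] is a real eigenvector. This ensures that the infimum or supremum in [eig_ext] is over a
    nonempty set. *)
Lemma symmetric_eigenvalue (R : realType) n (A : 'M[R]_n) : (0 < n)%N ->
  (forall i j, A i j = A j i) -> exists a, eigenvalue A a.
Proof.
move=> n0 sA.
have [a /eigenvalueP [v vA v0]] := @spectral.eigenvalue_closed (complex.complex R)
   n (map_mx (complex.real_complex R) A) n0.
pose x := \row_i complex.Re (v 0 i); pose y := \row_i complex.Im (v 0 i).
have vE j : v 0 j = complex.Complex (x 0 j) (y 0 j) by rewrite !mxE; case: (v 0 j).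
have xA : x *m A = complex.Re a *: x - complex.Im a *: y.
  apply/rowP => j; have := congr1 (fun w : 'rV_n => complex.Re (w 0 j)) vA.
  rewrite !mxE vE !mxE raddf_sum; case: a {vA} => a1 a2 /= <-.
  by apply: eq_bigr => k _; rewrite !mxE; case: (v 0 k) => * /=; rewrite mulr0 subr0.
have yA : y *m A = complex.Re a *: y + complex.Im a *: x.
  apply/rowP => j; have := congr1 (fun w : 'rV_n => complex.Im (w 0 j)) vA.
  rewrite !mxE vE !mxE raddf_sum; case: a {vA xA} => a1 a2 /= <-.
  by apply: eq_bigr => k _; rewrite !mxE; case: (v 0 k) => * /=; rewrite mulr0 add0r.
have S : dotv (x *m A) y = dotv (y *m A) x.
  rewrite !row_dotE exchange_big; apply: eq_bigr => i _; apply: eq_bigr => j _.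
  by rewrite sA; ring.
have nz : 0 < dotv x x + dotv y y.
  rewrite lt_def addr_ge0 ?dotv_ge0 // andbT; apply: contra v0.
  rewrite paddr_eq0 ?dotv_ge0 // !dotv_eq0 => /andP[/eqP x0 /eqP y0].
  by apply/eqP/rowP => j; rewrite vE x0 y0 !mxE.
have Ia0 : complex.Im a = 0.
  move: S; rewrite xA yA !(dotvDl, dotvDr, dotvNl, dotvNr, dotvZl, dotvZr) (dotvC y x) => S.
  apply/eqP; rewrite -(mulIr_eq0 _ (mulIf (lt0r_neq0 nz))); apply/eqP; lra.
have [x0|x0] := eqVneq x 0.
  exists (complex.Re a); apply/eigenvalueP; exists y; first by rewrite yA Ia0 scale0r addr0.
  by move: nz; rewrite x0 dotv0l add0r dotv_gt0.
by exists (complex.Re a); apply/eigenvalueP; exists x => //; rewrite xA Ia0 scale0r subr0.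
Qed.

End SymmetricEigenvalue.

Section OperatorMonotone.
Context {R : realType} {n : nat}.
Implicit Types (A B : 'M[R]_n) (p b : R) (q z : 'rV[R]_n).

(** With [S] the form of [A - B] at [q] divided by [|q|^2], the difference of the two sides is
    [(tr (A - B) - S) + (p - 1) S], and both terms are nonnegative. *)
Lemma plapl_form_le p A B q : 1 < p -> q != 0 ->
  (forall z, 0 <= dotv (z *m (A - B)) z) ->
  \tr B + (p - 2) * (dotv q q)^-1 * dotv (q *m B) q <=
  \tr A + (p - 2) * (dotv q q)^-1 * dotv (q *m A) q.
Proof.
move=> p1 q_neq0 psd; have q0 : 0 < dotv q q by rewrite dotv_gt0.
have := psd_form_le_trace _ q psd; have := psd q.
rewrite mulmxBr dotvDl dotvNl linearB /=.
set a := dotv (q *m A) q; set b := dotv (q *m B) q => S0 ST.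
have qi : 0 < (dotv q q)^-1 by rewrite invr_gt0.
have S0' : 0 <= (dotv q q)^-1 * (a - b) by rewrite mulr_ge0 // ltW.
have ST' : (dotv q q)^-1 * (a - b) <= \tr A - \tr B by rewrite mulrC ler_pdivrMr // mulrC.
have : 0 <= (p - 1) * ((dotv q q)^-1 * (a - b)) by rewrite mulr_ge0 //; lra.
lra.
Qed.

(** An eigenvalue [a] of [A <= b I] satisfies [a <= b] and, by the trace inequality for [b I - A] at
    its eigenvector, [tr A <= (n - 1) b + a]. The same two bounds show that the eigenvalues form a
    bounded set, so neither [inf] nor [sup] takes its default value. *)
Lemma eig_ext_form_le p b A : (0 < n)%N -> 1 < p -> (forall i j, A i j = A j i) ->
  (forall z, 0 <= dotv (z *m (b%:M - A)) z) ->
  \tr A + (p - 2) * eig_ext p A <= (n%:R + p - 2) * b.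
Proof.
move=> n0 p1 sA psd.
have psdb z : dotv (z *m A) z <= b * dotv z z.
  by have := psd z; rewrite mulmxBr mul_mx_scalar dotvDl dotvNl dotvZl subr_ge0.
have eigb a : eigenvalue A a -> a <= b /\ \tr A <= n%:R * b - b + a.
  move=> /eigenvalueP [v va v0]; have vv : 0 < dotv v v by rewrite dotv_gt0.
  split; first by have := psdb v; rewrite va dotvZl ler_pM2r.
  have := psd_form_le_trace _ v psd.
  rewrite mulmxBr mul_mx_scalar va dotvDl dotvNl !dotvZl linearB /= mxtrace_scalar.
  rewrite -mulrBl mulrC ler_pM2l // -mulr_natl; lra.
have [l El] := symmetric_eigenvalue R n A n0 sA.
have [lb tl] := eigb l El.
rewrite /eig_ext; case: ifPn => [p2|].
  have il : inf [set a | eigenvalue A a] <= l.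
    apply: ge_inf => //; exists (\tr A - n%:R * b + b) => a /= /eigb [_]; lra.
  have : 0 <= (p - 2) * (b - inf [set a | eigenvalue A a]) by rewrite mulr_ge0 //; lra.
  by move: (inf _) il => s sl; lra.
rewrite -ltNge => p2.
have ls : l <= sup [set a | eigenvalue A a].
  by apply: ub_le_sup => //; exists b => a /= /eigb [].
have : 0 <= (2 - p) * (sup [set a | eigenvalue A a] - l) by rewrite mulr_ge0 //; lra.
have : 0 <= (p - 1) * (b - l) by rewrite mulr_ge0 //; lra.
by move: (sup _) ls => s sl; lra.
Qed.

End OperatorMonotone.

(** * Gradient, Hessian and time derivative in terms of directional derivatives *)

Section Jets.
Context {R : realType} {n : nat}.
Notation X := ('rV[R]_n * R)%type.
Implicit Types (U : set X) (xi : X) (z : 'rV[R]_n).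

Lemma linear_dir_x (l : X -> R) :
  (forall a v w, l (a *: v + w) = a * l v + l w) ->
  forall z, l (z, 0) = \sum_i z 0 i * l (dir_x i).
Proof.
move=> ll z.
have l0 : l 0 = 0 by have := ll 1 0 0; rewrite scale1r addr0; lra.
have ls (r : seq 'I_n) : l (\sum_(i <- r) z 0 i *: dir_x i) =
    \sum_(i <- r) z 0 i * l (dir_x i).
  by elim: r => [|i r IH]; rewrite ?big_nil // !big_cons ll IH.
rewrite -ls; congr l; apply: injective_projections.
  rewrite (big_morph (fun v : X => v.1) (id1 := 0) (op1 := +%R)) //=.
  exact: row_sum_delta.
rewrite (big_morph (fun v : X => v.2) (id1 := 0) (op1 := +%R)) //=.
by rewrite big1 // => i _; rewrite /GRing.scale /= mulr0.
Qed.

Lemma linear_dir (l : X -> R) :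
  (forall a v w, l (a *: v + w) = a * l v + l w) ->
  forall v, l v = l (v.1, 0) + v.2 * l dir_t.
Proof.
move=> ll [z t]; rewrite addrC -ll; congr l.
apply: injective_projections => /=; first by rewrite scaler0 add0r.
by rewrite addr0 [_ *: _]mulr1.
Qed.

Section OneFunction.
Variables (U : set X) (f : X -> R) (f1 : X -> X -> R) (f2 : X -> X -> X -> R).
Hypotheses (oU : open U) (hf : smooth2 U f f1 f2).
Variable xi : X.
Hypothesis Uxi : U xi.

Lemma smooth2_dt : dt f xi = f1 dir_t xi.
Proof. by rewrite /dt; have [-> _] := smooth2_derive U f f1 f2 xi oU hf Uxi. Qed.

Lemma smooth2_grad z : f1 (z, 0) xi = dotv z (grad f xi).
Proof.
have [_ _ _ l _] := hf _ Uxi; rewrite (@linear_dir_x (f1^~ xi)) //.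
apply: eq_bigr => i _; rewrite mxE.
by have [-> _] := smooth2_derive U f f1 f2 xi oU hf Uxi.
Qed.

Lemma smooth2_hess z z' : f2 (z, 0) (z', 0) xi = dotv (z' *m hess f xi) z.
Proof.
have [_ _ _ _ l] := hf _ Uxi.
rewrite (@linear_dir_x (fun v => f2 v (z', 0) xi)); last by move=> a v w; exact: (l _ _ _ _).1.
apply: eq_bigr => j _; rewrite mulrC; congr (_ * _).
rewrite (@linear_dir_x (fun v => f2 (dir_x j) v xi)); last by move=> a v w; exact: (l _ _ _ _).2.
rewrite mxE; apply: eq_bigr => i _; rewrite mxE.
by have [_ ->] := smooth2_derive U f f1 f2 xi oU hf Uxi.
Qed.

Lemma smooth2_hess_sym i j : hess f xi i j = hess f xi j i.
Proof.
have [_ e] := smooth2_derive U f f1 f2 xi oU hf Uxi.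
have H k l : hess f xi k l = f2 (dir_x l) (dir_x k) xi by rewrite mxE; exact: e.
rewrite !H; exact: smooth2_sym oU hf Uxi.
Qed.

End OneFunction.

Lemma smooth2Z U (f : X -> R) f1 f2 (c : R) : smooth2 U f f1 f2 ->
  smooth2 U (fun x => c * f x) (fun v x => c * f1 v x) (fun v w x => c * f2 v w x).
Proof.
move=> hf; have := smooth2M _ _ _ _ _ _ _ (smooth2_cst U c) hf; congr smooth2.
  by apply/funext => v; apply/funext => x /=; rewrite /cst /=; ring.
by apply/funext => v; apply/funext => w; apply/funext => x /=; rewrite /cst /=; ring.
Qed.

Lemma lsc_dense_finite_continuous U (h : X -> R) : open U ->
  (forall xi, U xi -> {for xi, continuous h}) -> lsc_dense_finite U (EFin \o h).
Proof.
move=> oU hc; split=> //.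
- move=> x a; have [Ux|Ux] := pselect (U x).
    rewrite /= lte_fin => ax; exists [set y | a < h y] => //.
    have ix : U° (x : X) by exact: open_nbhs_nbhs.
    rewrite -(nbhs_subspace_interior ix).
    by move: (hc x Ux) => /cvgr_gt /(_ _ ax).
  (* Outside [U] the subspace topology is discrete, so a singleton is a neighbourhood. *)
  move=> ax; exists [set x] => [|y -> //].
  have : globally [set (x : X)] [set (x : X)] by move=> y ->.
  by rewrite (@nbhs_subspace_out _ U x Ux).
- by move=> x Ux; apply: subset_closure.
Qed.

End Jets.

(** * Classical solutions are viscosity solutions *)

Section Viscosity.
Context {R : realType} {n : nat}.
Notation X := ('rV[R]_n * R)%type.
Implicit Types (U : set X) (xi : X) (z : 'rV[R]_n).

(** At a critical point the Hessian is required to be scalar: smallest and largest eigenvalue then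
    agree, and [h] and [- h] satisfy the same condition. Gaussians have this form at their
    centre. *)
Definition classical_solution (p : R) U (h : X -> R) :=
  exists h1 h2, smooth2 U h h1 h2 /\ forall xi, U xi ->
    (grad h xi != 0 -> dt h xi = normalized_plapl p h xi) /\
    (grad h xi = 0 ->
       exists2 b, hess h xi = b%:M & dt h xi = (n%:R + p - 2) * b).

Lemma grad_hessZ U (h : X -> R) h1 h2 c xi : open U -> smooth2 U h h1 h2 -> U xi ->
  [/\ dt (fun x => c * h x) xi = c * dt h xi,
      grad (fun x => c * h x) xi = c *: grad h xi
    & hess (fun x => c * h x) xi = c *: hess h xi].
Proof.
move=> oU hh Uxi; have hc := smooth2Z U h h1 h2 c hh.
have [e1 e2] := smooth2_derive U _ _ _ xi oU hh Uxi.
have [d1 d2] := smooth2_derive U _ _ _ xi oU hc Uxi.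
split; first by rewrite /dt d1 e1.
  by apply/rowP => i; rewrite !mxE d1 e1.
by apply/matrixP => i j; rewrite !mxE d2 e2.
Qed.

Lemma smooth2_eq_grad U (h phi : X -> R) h1 h2 f1 f2 xi : open U ->
  smooth2 U h h1 h2 -> smooth2 U phi f1 f2 -> U xi ->
  (forall v, h1 v xi = f1 v xi) -> grad h xi = grad phi xi.
Proof.
move=> oU hs fs Uxi e; apply/rowP => i; rewrite !mxE.
have [-> _] := smooth2_derive U h h1 h2 xi oU hs Uxi.
by have [-> _] := smooth2_derive U phi f1 f2 xi oU fs Uxi.
Qed.

#[local] Opaque hess grad dt.

Lemma classical_solutionN (p : R) U (h : X -> R) : open U ->
  classical_solution p U h -> classical_solution p U (fun x => - 1 * h x).
Proof.
move=> oU [h1 [h2 [hs he]]].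
do 2!eexists; split; first exact: (smooth2Z U h h1 h2 (-1) hs).
move=> xi Uxi; have [-> g H] := grad_hessZ U h h1 h2 (-1) xi oU hs Uxi.
have [e1 e2] := he xi Uxi; rewrite /normalized_plapl /lapl g H !scaleN1r; split.
  rewrite oppr_eq0 => /e1 ->; rewrite /normalized_plapl /lapl mulmxN mulNmx opprK.
  by rewrite linearN /= dotvNr !enorm_sqr dotvNl dotvNr opprK; ring.
move=> /eqP; rewrite oppr_eq0 => /eqP /e2 [b -> ->]; exists (- b).
  by rewrite raddfN.
by ring.
Qed.

(** At the touching point [h - phi] has a minimum: the gradients and time derivatives agree and the
    Hessians are ordered, so monotonicity of the operator applies. At a critical point the Hessian
    of [phi] lies below the scalar matrix [b I]. *)
Lemma classical_supersolution (p : R) U (h : X -> R) : (0 < n)%N -> 1 < p ->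
  open U -> classical_solution p U h -> viscosity_supersolution p U (EFin \o h).
Proof.
move=> n0 p1 oU [h1 [h2 [hs he]]]; split.
  by apply: lsc_dense_finite_continuous => // xi Uxi; have [] := hs xi Uxi.
move=> xi phi Uxi C2phi [tch] above.
have [f1 [f2 fs]] : exists f1 f2, smooth2 U phi f1 f2.
  by do 2!eexists; exact: C2_on_smooth2.
have ds := smooth2D _ _ _ _ _ _ _ hs (smooth2Z _ _ _ _ (-1) fs).
have mn : \forall y \near xi, (h \+ (fun x => -1 * phi x)) xi <= (h \+ (fun x => -1 * phi x)) y.
  apply: filterS (open_nbhs_nbhs (conj oU Uxi)) => y Uy /=.
  have [->|yxi] := eqVneq y xi; first by [].
  have := above y Uy yxi; rewrite /= lte_fin tch; lra.
have ext v : h1 v xi = f1 v xi /\ f2 v v xi <= h2 v v xi.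
  have [] := smooth2_min _ _ _ _ xi v oU ds Uxi mn => /=; lra.
have edt : dt h xi = dt phi xi.
  by rewrite (smooth2_dt U h h1 h2 oU hs xi Uxi) (ext dir_t).1 (smooth2_dt U phi f1 f2 oU fs xi Uxi).
have egrad : grad h xi = grad phi xi.
  by apply: (smooth2_eq_grad U h phi h1 h2 f1 f2) => // v; exact: (ext v).1.
have psd z : 0 <= dotv (z *m (hess h xi - hess phi xi)) z.
  rewrite mulmxBr dotvDl dotvNl subr_ge0.
  have := (ext (z, 0)).2.
  by rewrite (smooth2_hess U h h1 h2 oU hs xi Uxi) (smooth2_hess U phi f1 f2 oU fs xi Uxi).
have [e1 e2] := he xi Uxi; split=> [g0|g0].
  rewrite -edt e1 ?egrad // subr_ge0 /normalized_plapl /lapl egrad enorm_sqr.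
  exact: plapl_form_le.
have [|b Hb tb] := e2; first by rewrite egrad.
rewrite -edt tb -addrA -opprD subr_ge0 /lapl; apply: eig_ext_form_le => //.
  move=> i j; exact: (smooth2_hess_sym U phi f1 f2 oU fs xi Uxi).
by move=> z; rewrite -Hb.
Qed.

Lemma classical_viscosity_solution (p : R) U (h : X -> R) : (0 < n)%N -> 1 < p ->
  open U -> classical_solution p U h -> viscosity_solution p U (EFin \o h).
Proof.
move=> n0 p1 oU hs; split; first exact: classical_supersolution.
have := classical_supersolution p U _ n0 p1 oU (classical_solutionN p U h oU hs).
by congr viscosity_supersolution; apply/funext => x /=; rewrite mulN1r.
Qed.

End Viscosity.

(** * An upper Taylor bound with separate errors in space and time *)

Section TaylorX.
Context {R : realType} {n : nat}.
Notation X := ('rV[R]_n * R)%type.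
Implicit Types (U : set X) (xi : X) (z : 'rV[R]_n).

Lemma amgm_bound (a b d e : R) : `|d| <= e -> a * b * d <= e * (a ^+ 2 + b ^+ 2) / 2.
Proof.
move=> de; have e0 : 0 <= e by apply: le_trans de.
apply: le_trans (ler_norm _) _; rewrite normrM.
apply: (@le_trans _ _ (`|a * b| * e)); first by rewrite ler_wpM2l.
rewrite mulrC -mulrA ler_wpM2l // ler_norml; apply/andP; split.
  by have := sqr_ge0 (a + b); rewrite sqrrD; lra.
by have := sqr_ge0 (a - b); rewrite sqrrB; lra.
Qed.

Lemma near_forall_ord (P : 'I_n -> X -> Prop) xi :
  (forall i, \forall y \near xi, P i y) -> \forall y \near xi, forall i, P i y.
Proof. exact: (@filter_forall _ _ P (nbhs xi) (nbhs_filter xi)). Qed.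

Lemma sum_sqr z : \sum_i z 0 i ^+ 2 = dotv z z.
Proof. by apply: eq_bigr => i _; rewrite expr2. Qed.

(** The error in space has to be small, because it will be paid for by strictness, whereas any
    finite [M] will do in time. Mixed terms [dt l(dx)] are therefore split by Young's inequality
    with small weight on [|dx|^2]; continuity of the second derivatives makes the remainder small
    against [|dx|^2 + dt^2]. *)
Lemma taylor_jet U (f : X -> R) f1 f2 xi (e : R) : open U -> smooth2 U f f1 f2 ->
  U xi -> 0 < e -> exists M : R, \forall y \near xi,
    f y <= f xi + f1 (y.1 - xi.1, 0) xi + (y.2 - xi.2) * f1 dir_t xi
           + f2 (y.1 - xi.1, 0) (y.1 - xi.1, 0) xi / 2
           + e * dotv (y.1 - xi.1) (y.1 - xi.1) + M * (y.2 - xi.2) ^+ 2.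
Proof.
move=> oU hf Ux e0.
have [_ _ c2 l1 l2] := hf xi Ux.
(* Twice the spatial error is at most [(n + 1) e' |dx|^2] from the variation of the second
   derivatives plus [e' |dx|^2] from the mixed terms. *)
pose e' := e / (n%:R + 2).
have n2 : 0 < n%:R + 2 :> R by apply: ltr_wpDl.
have e'0 : 0 < e' by rewrite divr_gt0.
pose close v w := fun y : X => `|f2 v w y - f2 v w xi| < e'.
have nc v w : \forall y \near xi, close v w y.
  move: (c2 v w).1 => /cvgrPdist_lt /(_ _ e'0); apply: filterS => y.
  by rewrite /close distrC.
have nU := open_nbhs_nbhs (conj oU Ux).
have nij : \forall y \near xi, forall i j : 'I_n, close (dir_x i) (dir_x j) y.
  by apply: near_forall_ord => i; apply: near_forall_ord => j; exact: nc.
have nit : \forall y \near xi, forall i : 'I_n, close (dir_x i) dir_t y.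
  by apply: near_forall_ord => i; exact: nc.
have nti : \forall y \near xi, forall i : 'I_n, close dir_t (dir_x i) y.
  by apply: near_forall_ord => i; exact: nc.
have ntt := nc dir_t dir_t.
have N : \forall y \near xi, U y /\ ((forall i j, close (dir_x i) (dir_x j) y) /\
    ((forall i, close (dir_x i) dir_t y) /\
     ((forall i, close dir_t (dir_x i) y) /\ close dir_t dir_t y))).
  by do 4!apply: filterI => //.
pose l z := f2 (z, 0) dir_t xi + f2 dir_t (z, 0) xi.
pose g : 'rV[R]_n := \row_i l (delta_mx 0 i).
have lE z : l z = dotv z g.
  rewrite /l (@linear_dir_x _ _ (fun v => f2 v dir_t xi)); last by move=> a v w; exact: (l2 _ _ _ _).1.
  rewrite (@linear_dir_x _ _ (fun v => f2 dir_t v xi)); last by move=> a v w; exact: (l2 _ _ _ _).2.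
  by rewrite -big_split /=; apply: eq_bigr => i _; rewrite mxE -mulrDr.
pose G := dotv g g.
have G0 : 0 <= G := dotv_ge0 g.
pose m := f2 dir_t dir_t xi.
exists (e' * (n%:R + 1) / 2 + m / 2 + (G + 1) / (4 * e')).
move: N => /nbhs_normP [r /= r0 hr].
apply/nbhs_normP; exists r => //= y yr.
pose v : X := y - xi; have vE : y = v + xi by rewrite /v subrK.
have seg (s : R) : 0 <= s <= 1 -> `|xi - (s *: v + xi)| < r.
  move=> /andP[s0 s1]; rewrite opprD addrA addrAC subrr sub0r normrN normrZ ger0_norm //.
  apply: le_lt_trans yr; rewrite distrC -/v -[leRHS]mul1r ler_wpM2r //.
have [|s s01 E] := taylor2 U f f1 f2 xi v hf.
  by move=> s s01; have [] := hr _ (seg s s01).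
have sm := seg s ltac:(lra).
move: E sm; move: (s *: v + xi) => z E sm.
have [Uz [zij [zit [zti ztt]]]] := hr _ sm.
pose dx := y.1 - xi.1; pose dt := y.2 - xi.2.
have bil y' : U y' -> f2 v v y' = \sum_i \sum_j dx 0 i * dx 0 j * f2 (dir_x i) (dir_x j) y'
    + \sum_i dx 0 i * dt * f2 (dir_x i) dir_t y'
    + \sum_i dx 0 i * dt * f2 dir_t (dir_x i) y' + dt * dt * f2 dir_t dir_t y'.
  move=> Uy'; have [_ _ _ _ k2] := hf y' Uy'.
  have ex w : f2 v w y' = \sum_i dx 0 i * f2 (dir_x i) w y' + dt * f2 dir_t w y'.
    rewrite (@linear_dir _ _ (fun v => f2 v w y')); last by move=> a ? ?; exact: (k2 _ _ _ _).1.
    by rewrite (@linear_dir_x _ _ (fun v => f2 v w y')) // => a ? ?; exact: (k2 _ _ _ _).1.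
  have ex' w : f2 w v y' = \sum_i dx 0 i * f2 w (dir_x i) y' + dt * f2 w dir_t y'.
    rewrite (@linear_dir _ _ (fun v => f2 w v y')); last by move=> a ? ?; exact: (k2 _ _ _ _).2.
    by rewrite (@linear_dir_x _ _ (fun v => f2 w v y')) // => a ? ?; exact: (k2 _ _ _ _).2.
  rewrite ex ex' mulrDr addrA.
  under eq_bigr do rewrite ex' mulrDr mulrA.
  rewrite big_split /= mulr_sumr; congr (_ + _ + _ + _).
  - apply: eq_bigr => i _; rewrite mulr_sumr; apply: eq_bigr => j _; ring.
  - by apply: eq_bigr => i _; ring.
  - by ring.
have D : f2 v v z - f2 v v xi <= e' * (n%:R + 1) * (dotv dx dx + dt ^+ 2).
  rewrite !bil //.
  have -> : forall a b c d a' b' c' d' : R, a + b + c + d - (a' + b' + c' + d') =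
    (a - a') + (b - b') + (c - c') + (d - d') by move=> *; ring.
  have S1 : \sum_i \sum_j dx 0 i * dx 0 j * f2 (dir_x i) (dir_x j) z -
    \sum_i \sum_j dx 0 i * dx 0 j * f2 (dir_x i) (dir_x j) xi <= e' * n%:R * dotv dx dx.
    rewrite -sumrB.
    apply: (@le_trans _ _ (\sum_(i < n) \sum_(j < n) e' * (dx 0 i ^+ 2 + dx 0 j ^+ 2) / 2)).
      apply: ler_sum => i _; rewrite -sumrB; apply: ler_sum => j _.
      by rewrite -mulrBr; apply: amgm_bound; apply: ltW; exact: zij.
    have -> : \sum_(i < n) \sum_(j < n) e' * (dx 0 i ^+ 2 + dx 0 j ^+ 2) / 2 =
      e' / 2 * (\sum_(i < n) \sum_(j < n) dx 0 i ^+ 2 + \sum_(i < n) \sum_(j < n) dx 0 j ^+ 2).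
      rewrite -big_split mulr_sumr; apply: eq_bigr => i _.
      by rewrite -big_split mulr_sumr; apply: eq_bigr => j _ /=; ring.
    rewrite [X in X + _]exchange_big /= sum_sqr sumr_const card_ord -mulr_natr.
    by rewrite le_eqVlt; apply/orP; left; apply/eqP; field.
  have S2 (F : X -> X -> X -> R) : (forall i, `|F (dir_x i) dir_t z - F (dir_x i) dir_t xi| < e') ->
    \sum_i dx 0 i * dt * F (dir_x i) dir_t z - \sum_i dx 0 i * dt * F (dir_x i) dir_t xi
      <= e' / 2 * (dotv dx dx + n%:R * dt ^+ 2).
    move=> F'; rewrite -sumrB.
    apply: (@le_trans _ _ (\sum_(i < n) e' * (dx 0 i ^+ 2 + dt ^+ 2) / 2)).
      apply: ler_sum => i _.
      by rewrite -mulrBr; apply: amgm_bound; apply: ltW; exact: F'.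
    rewrite -sum_sqr -mulr_suml -mulr_sumr big_split /= sumr_const card_ord -mulr_natr.
    by rewrite le_eqVlt; apply/orP; left; apply/eqP; field.
  have S3 := S2 f2 zit.
  have S4 := S2 (fun v w => f2 w v) zti.
  have S5 : dt * dt * f2 dir_t dir_t z - dt * dt * f2 dir_t dir_t xi <= e' * dt ^+ 2.
    rewrite -mulrBr; apply: le_trans (amgm_bound _ _ _ _ (ltW ztt)) _; lra.
  have := sqr_ge0 dt; have := dotv_ge0 dx.
  rewrite /= in S4.
  set a := dotv _ _ in S1 S3 S4 *; set b := dt ^+ 2 in S3 S4 S5 *; set k : R := n%:R in S1 S3 S4 *.
  lra.
have B : f2 v v xi = f2 (dx, 0) (dx, 0) xi + dt * l dx + dt ^+ 2 * m.
  have k1 w : f2 v w xi = f2 (dx, 0) w xi + dt * f2 dir_t w xi.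
    by rewrite (@linear_dir _ _ (fun v => f2 v w xi)) // => a ? ?; exact: (l2 _ _ _ _).1.
  have k2 w : f2 w v xi = f2 w (dx, 0) xi + dt * f2 w dir_t xi.
    by rewrite (@linear_dir _ _ (fun v => f2 w v xi)) // => a ? ?; exact: (l2 _ _ _ _).2.
  by rewrite k1 !k2 /l /m; ring.
have C : dt * l dx <= e' * dotv dx dx + (G + 1) / (4 * e') * dt ^+ 2 * 2.
  rewrite lE.
  have := dotv_sqr_le dx g; rewrite -/G; set d := dotv dx g; set a := dotv dx dx => dG.
  have G1 : 0 < G + 1 by lra.
  have a0 : 0 <= a := dotv_ge0 dx.
  have h1 : e' / (G + 1) * d ^+ 2 <= e' * a.
    rewrite -mulrA ler_pM2l // mulrC ler_pdivrMr //; nra.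
  have h2 : dt * d <= e' / (G + 1) * d ^+ 2 + (G + 1) / (4 * e') * dt ^+ 2.
    have := sqr_ge0 (2 * e' * d - (G + 1) * dt).
    have -> : (2 * e' * d - (G + 1) * dt) ^+ 2 = 4 * e' * (G + 1) *
      (e' / (G + 1) * d ^+ 2 + (G + 1) / (4 * e') * dt ^+ 2 - dt * d).
      by field; rewrite !gt_eqF.
    by rewrite pmulr_rge0 ?subr_ge0 // !mulr_gt0.
  have : 0 <= (G + 1) / (4 * e') * dt ^+ 2.
    by rewrite mulr_ge0 ?sqr_ge0 // divr_ge0 // ?mulr_ge0 // ltW.
  lra.
have L1 : f1 v xi = f1 (dx, 0) xi + dt * f1 dir_t xi.
  by rewrite (@linear_dir _ _ (fun v => f1 v xi)).
have e'E : e' * (n%:R + 2) = e by rewrite /e'; field; rewrite gt_eqF.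
rewrite {1}vE E L1 -/dx -/dt.
have -> : f2 v v z = f2 v v xi + (f2 v v z - f2 v v xi) by ring.
rewrite -e'E; have := dotv_ge0 dx; have := sqr_ge0 dt; nra.
Qed.

End TaylorX.

(** * Composition with inverse, logarithm and exponential *)

Section Smooth2Comp.
Context {R : realType} {V : normedModType R}.
Implicit Types (U : set V).

Lemma is_derive_inv (x : R) : x != 0 -> is_derive x 1 (fun x : R => x^-1) (- (x ^- 2)).
Proof.
move=> x0; have := @is_deriveV R id x 1 1 x0 (is_derive_id _ _).
by rewrite /GRing.scale /= mulr1.
Qed.

Lemma is_derive_inv2 (x : R) : x != 0 ->
  is_derive x 1 (fun x : R => - (x ^- 2)) (2 * x ^- 3).
Proof.
move=> x0.
have h : is_derive x 1 (- ((fun x : R => x^-1) * (fun x : R => x^-1))) (2 * x ^- 3).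
  apply: is_derive_eq (is_deriveN (is_deriveM (is_derive_inv x x0) (is_derive_inv x x0))) _.
  by rewrite /GRing.scale /=; field.
by congr is_derive : h; apply/funext => y; rewrite !fctE expr2 invfM.
Qed.

Lemma continuous_expV (x : R) k : x != 0 -> {for x, continuous (fun x : R => x ^- k)}.
Proof. by move=> x0; apply: cvgV; [rewrite expf_neq0|exact: exprn_continuous]. Qed.

Lemma smooth2_inv U (f : V -> R) f1 f2 : smooth2 U f f1 f2 ->
  (forall xi, U xi -> f xi != 0) ->
  smooth2 U (fun xi => (f xi)^-1) (fun v xi => - (f xi) ^- 2 * f1 v xi)
   (fun v w xi => 2 * (f xi) ^- 3 * (f1 v xi * f1 w xi) + - (f xi) ^- 2 * f2 v w xi).
Proof.
move=> hf f0; apply: (smooth2_comp U f f1 f2 (fun x => x^-1) (fun x => - x ^- 2) (fun x => 2 * x ^- 3) hf).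
move=> xi /f0 fx0; split; [exact: is_derive_inv|exact: is_derive_inv2|].
by apply: continuousM; [exact: cst_continuous|exact: continuous_expV].
Qed.

Lemma smooth2_ln U (f : V -> R) f1 f2 : smooth2 U f f1 f2 ->
  (forall xi, U xi -> 0 < f xi) ->
  smooth2 U (fun xi => ln (f xi)) (fun v xi => (f xi)^-1 * f1 v xi)
   (fun v w xi => - (f xi) ^- 2 * (f1 v xi * f1 w xi) + (f xi)^-1 * f2 v w xi).
Proof.
move=> hf f0; apply: (smooth2_comp U f f1 f2 (@ln R) (fun x => x^-1) (fun x => - x ^- 2) hf).
move=> xi /f0 fx0; have fn0 : f xi != 0 by rewrite gt_eqF.
split; [exact: is_derive1_ln|exact: is_derive_inv|].
by apply: continuousN; exact: continuous_expV.
Qed.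

Lemma smooth2_exp U (f : V -> R) f1 f2 : smooth2 U f f1 f2 ->
  smooth2 U (fun xi => expR (f xi)) (fun v xi => expR (f xi) * f1 v xi)
   (fun v w xi => expR (f xi) * (f1 v xi * f1 w xi) + expR (f xi) * f2 v w xi).
Proof.
move=> hf; apply: (smooth2_comp U f f1 f2 expR expR expR hf) => xi _.
by split; try exact: is_derive_expR; exact: continuous_expR.
Qed.

End Smooth2Comp.

(** * Hessians that are scalar up to a rank-one term along the gradient, and coordinate functions *)

Section RankOneJet.
Context {R : realType} {n : nat}.
Notation X := ('rV[R]_n * R)%type.
Implicit Types (U : set X) (xi : X) (x y z q : 'rV[R]_n).

Lemma dotv_inj x y : (forall z, dotv z x = dotv z y) -> x = y.
Proof.
move=> h; apply/eqP; rewrite -subr_eq0 -dotv_eq0.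
by rewrite dotvDr dotvNr h subrr.
Qed.

Lemma dotv_delta (i : 'I_n) x : dotv (delta_mx 0 i) x = x 0 i.
Proof.
rewrite /dotv (bigD1 i) //= !mxE !eqxx mul1r big1 ?addr0 // => j ji.
by rewrite mxE (negbTE ji) andbF mul0r.
Qed.

Lemma form_delta (A : 'M[R]_n) (i j : 'I_n) :
  dotv (delta_mx 0 i *m A) (delta_mx 0 j) = A i j.
Proof. by rewrite dotvC dotv_delta -rowE mxE. Qed.

Definition rank_one_form (A : 'M[R]_n) (b k : R) q :=
  forall z z', dotv (z' *m A) z = b * dotv z z' + k * dotv z q * dotv z' q.

Lemma rank_one_trace A b k q : rank_one_form A b k q ->
  \tr A = n%:R * b + k * dotv q q.
Proof.
move=> hA; rewrite /mxtrace.
under eq_bigr => i _ do rewrite -form_delta hA !dotv_delta mxE !eqxx mulr1.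
rewrite big_split /= sumr_const card_ord -[b *+ n]mulr_natl; congr (_ + _).
by rewrite mulr_sumr; apply: eq_bigr => i _; rewrite mulrA.
Qed.

Lemma rank_one_plapl A b k q p : rank_one_form A b k q -> q != 0 ->
  \tr A + (p - 2) * (enorm q ^+ 2)^-1 * dotv (q *m A) q =
  (n%:R + p - 2) * b + (p - 1) * k * dotv q q.
Proof.
move=> hA q0; rewrite enorm_sqr (rank_one_trace _ _ _ _ hA) hA; field.
by rewrite dotv_eq0.
Qed.

Lemma rank_one_scalar A b k : rank_one_form A b k 0 -> A = b%:M.
Proof.
move=> hA; apply/matrixP => i j; rewrite -form_delta hA !dotv0r !mulr0 addr0.
by rewrite dotvC dotv_delta !mxE eqxx /= mulr_natr.
Qed.

End RankOneJet.

Section Coordinates.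
Context {R : realType} {n : nat}.
Notation X := ('rV[R]_n * R)%type.
Implicit Types (U : set X) (xi : X) (x y z q : 'rV[R]_n).

Lemma continuous_coord (i : 'I_n) : continuous (fun xi : X => xi.1 0 i).
Proof.
move=> xi; apply: (@continuous_comp _ _ _ (fun xi : X => xi.1) (fun x : 'rV[R]_n => x 0 i)).
  exact: cvg_fst.
exact: coord_continuous.
Qed.

Lemma smooth2_coord U (i : 'I_n) : smooth2 U (fun xi => xi.1 0 i)
  (fun v => cst (v.1 0 i)) (fun _ _ => cst 0).
Proof.
apply: smooth2_linear; last exact: continuous_coord.
by move=> a v w; rewrite /= !mxE.
Qed.

Lemma smooth2_time U (s : R) : smooth2 U (fun xi => xi.2 - s)
  (fun v => cst v.2) (fun _ _ => cst 0).
Proof.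
have h : smooth2 U (fun xi : X => xi.2) (fun v => cst v.2) (fun _ _ => cst 0).
  apply: smooth2_linear; last by move=> xi; exact: cvg_snd.
  by move=> a v w.
have := smooth2D _ _ _ _ _ _ _ h (smooth2_cst U (- s)); congr smooth2.
  by apply/funext => v; apply/funext => xi /=; rewrite /cst addr0.
by apply/funext => v; apply/funext => w; apply/funext => xi /=; rewrite /cst addr0.
Qed.

Lemma smooth2_dotv U q y : smooth2 U (fun xi => dotv q (xi.1 - y))
  (fun v => cst (dotv q v.1)) (fun _ _ => cst 0).
Proof.
have h i : smooth2 U (fun xi => q 0 i * (xi.1 0 i - y 0 i))
    (fun v => cst (q 0 i * v.1 0 i)) (fun _ _ => cst 0).
  have := smooth2Z _ _ _ _ (q 0 i)
    (smooth2D _ _ _ _ _ _ _ (smooth2_coord U i) (smooth2_cst U (- y 0 i))).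
  congr smooth2.
    by apply/funext => v; apply/funext => xi /=; rewrite /cst addr0.
  by apply/funext => v; apply/funext => w; apply/funext => xi /=; rewrite /cst addr0 mulr0.
have := smooth2_sum U _ (index_enum _) _ _ _ h; congr smooth2.
- by apply/funext => xi; rewrite /dotv; apply: eq_bigr => i _; rewrite !mxE.
- by apply/funext => v; apply/funext => w; apply/funext => xi; rewrite big1.
Qed.

Lemma smooth2_sqdist U y : smooth2 U (fun xi => dotv (xi.1 - y) (xi.1 - y))
  (fun v xi => 2 * dotv v.1 (xi.1 - y)) (fun v w => cst (2 * dotv v.1 w.1)).
Proof.
have h i : smooth2 U (fun xi => (xi.1 0 i - y 0 i) * (xi.1 0 i - y 0 i))
    (fun v xi => 2 * (v.1 0 i * (xi.1 0 i - y 0 i)))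
    (fun v w => cst (2 * (v.1 0 i * w.1 0 i))).
  have k := smooth2D _ _ _ _ _ _ _ (smooth2_coord U i) (smooth2_cst U (- y 0 i)).
  have := smooth2M _ _ _ _ _ _ _ k k; congr smooth2.
    by apply/funext => v; apply/funext => xi /=; rewrite /cst; ring.
  by apply/funext => v; apply/funext => w; apply/funext => xi /=; rewrite /cst; ring.
have := smooth2_sum U _ (index_enum _) _ _ _ h; congr smooth2.
- by apply/funext => xi; rewrite /dotv; apply: eq_bigr => i _; rewrite !mxE.
- apply/funext => v; apply/funext => xi; rewrite /dotv mulr_sumr.
  by apply: eq_bigr => i _; rewrite !mxE.
- apply/funext => v; apply/funext => w; apply/funext => xi; rewrite /dotv mulr_sumr.
  by apply: eq_bigr.
Qed.

End Coordinates.

(** * Gaussian solutions *)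

Section Gaussian.
Context {R : realType} {n : nat}.
Notation X := ('rV[R]_n * R)%type.
Implicit Types (U : set X) (xi : X) (x y z q : 'rV[R]_n) (p s : R).

(* Up to a multiple, [expR (gauss_exp p s y)] is the heat kernel in the
   fictitious dimension [(n + p - 2) / (p - 1)], with diffusivity [p - 1]. *)
Definition gauss_exp p s y : X -> R := fun xi =>
  - ((n%:R + p - 2) / (2 * (p - 1))) * ln (xi.2 - s) +
  - (4 * (p - 1))^-1 * (dotv (xi.1 - y) (xi.1 - y) * (xi.2 - s)^-1).

Definition after s : set X := [set xi | s < xi.2].

Lemma open_after s : open (after s).
Proof.
rewrite /after; apply: (@open_comp _ _ (fun xi : X => xi.2) [set t | s < t]).
  by move=> xi _; exact: cvg_snd.
exact: open_gt.
Qed.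

Lemma smooth2_gauss_exp p s y : 1 < p -> exists G1 G2,
  smooth2 (after s) (gauss_exp p s y) G1 G2 /\ forall xi, after s xi ->
  [/\ forall z, G1 (z, 0) xi = - (dotv z (xi.1 - y) / (2 * (p - 1) * (xi.2 - s))),
      G1 dir_t xi = - ((n%:R + p - 2) / (2 * (p - 1) * (xi.2 - s))) +
         dotv (xi.1 - y) (xi.1 - y) / (4 * (p - 1) * (xi.2 - s) ^+ 2)
    & forall z z', G2 (z, 0) (z', 0) xi = - (dotv z z' / (2 * (p - 1) * (xi.2 - s)))].
Proof.
move=> p1.
have pos xi : after s xi -> 0 < xi.2 - s by rewrite subr_gt0.
have nz xi : after s xi -> xi.2 - s != 0 by move=> /pos; rewrite lt0r => /andP[].
have ht := smooth2_time (after s) s.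
have hl := smooth2_ln _ _ _ _ ht pos.
have hi := smooth2_inv _ _ _ _ ht nz.
have hq := smooth2M _ _ _ _ _ _ _ (smooth2_sqdist (after s) y) hi.
have hG := smooth2D _ _ _ _ _ _ _
  (smooth2Z _ _ _ _ (- ((n%:R + p - 2) / (2 * (p - 1)))) hl)
  (smooth2Z _ _ _ _ (- (4 * (p - 1))^-1) hq).
do 2!eexists; split; first exact: hG.
move=> xi /nz t0; have p0 : p - 1 != 0 by rewrite subr_eq0 gt_eqF.
split=> [z||z z'] /=; rewrite /cst ?dotv0l; field; exact/andP.
Qed.

Definition gauss p s y (H c : R) : X -> R := fun xi => H * expR (gauss_exp p s y xi) + c.

Lemma smooth2_gauss p s y (H c : R) : 1 < p -> 0 < H -> exists h1 h2,
  smooth2 (after s) (gauss p s y H c) h1 h2 /\ forall xi, after s xi ->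
  let E := H * expR (gauss_exp p s y xi) in
  let b := - (E / (2 * (p - 1) * (xi.2 - s))) in let q := b *: (xi.1 - y) in
  [/\ forall z, h1 (z, 0) xi = dotv z q,
      h1 dir_t xi = (n%:R + p - 2) * b + (p - 1) * E^-1 * dotv q q
    & forall z z', h2 (z, 0) (z', 0) xi =
        b * dotv z z' + E^-1 * dotv z q * dotv z' q].
Proof.
move=> p1 H0; have [G1 [G2 [sG hG]]] := smooth2_gauss_exp p s y p1.
have sh := smooth2D _ _ _ _ _ _ _ (smooth2Z _ _ _ _ H (smooth2_exp _ _ _ _ sG))
  (smooth2_cst (after s) c).
do 2!eexists; split; first exact: sh.
move=> xi sxi; have [g1 gt g2] := hG xi sxi.
have p0 : p - 1 != 0 by rewrite subr_eq0 gt_eqF.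
have t0 : xi.2 - s != 0 by rewrite subr_eq0 gt_eqF.
have E0 : expR (gauss_exp p s y xi) != 0 by rewrite gt_eqF // expR_gt0.
have H00 : H != 0 by rewrite gt_eqF.
split=> [z||z z'] /=; rewrite /cst ?g1 ?gt ?g2 ?dotvZr ?dotvZl; field;
  by rewrite ?p0 ?t0 ?E0 ?H00.
Qed.

(** The Hessian is [b I + E^-1 q^T q] with [q] the gradient, so the operator is explicit, and the
    Hessian is scalar where [q = 0]. *)
Lemma gauss_classical_solution p s y (H c : R) U : 1 < p -> 0 < H ->
  open U -> U `<=` after s -> classical_solution p U (gauss p s y H c).
Proof.
move=> p1 H0 oU sU; have [h1 [h2 [sh hh]]] := smooth2_gauss p s y H c p1 H0.
exists h1, h2; split; first exact: smooth2S sU sh.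
move=> xi /sU sxi; have [e1 et e2] := hh xi sxi.
have oA := open_after s.
set E := H * _ in e1 et e2; set b := - _ in e1 et e2; set q := b *: _ in e1 et e2.
have gE : grad (gauss p s y H c) xi = q.
  by apply: dotv_inj => z; rewrite -e1 (smooth2_grad _ _ _ _ oA sh xi sxi).
have hE : rank_one_form (hess (gauss p s y H c) xi) b E^-1 q.
  by move=> z z'; rewrite -e2 (smooth2_hess _ _ _ _ oA sh xi sxi).
rewrite gE (smooth2_dt _ _ _ _ oA sh xi sxi) et; split=> q0.
  by rewrite /normalized_plapl /lapl gE (rank_one_plapl _ _ _ _ _ hE q0).
exists b; last by rewrite q0 dotv0l mulr0 addr0.
by move: hE; rewrite q0; exact: rank_one_scalar.
Qed.

End Gaussian.

(** * Topology of space-time boxes *)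

Section Boxes.
Context {R : realType} {n : nat}.
Notation X := ('rV[R]_n * R)%type.
Implicit Types (a b x : 'rV[R]_n) (t : R) (xi : X).

Lemma open_space_box a b : open (space_box a b).
Proof.
rewrite openE => x abx; apply: (@filter_forall _ _
  (fun i (y : 'rV[R]_n) => a 0 i < y 0 i < b 0 i) (nbhs x) (nbhs_filter x)) => i.
have /andP[ai bi] := abx i.
have c : {for x, continuous (fun y : 'rV[R]_n => y 0 i)} by exact: coord_continuous.
have h1 : nbhs x [set y : 'rV[R]_n | a 0 i < y 0 i] by move/cvgr_gt : c; apply.
have h2 : nbhs x [set y : 'rV[R]_n | y 0 i < b 0 i] by move/cvgr_lt : c; apply.
by apply: filterS2 h1 h2 => y /= -> ->.
Qed.

Lemma open_box a b t1 t2 : open (box a b t1 t2).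
Proof.
have -> : box a b t1 t2 = (fst @^-1` space_box a b) `&`
    ((snd @^-1` [set t | t1 < t]) `&` (snd @^-1` [set t | t < t2])) :> set X.
  by apply/seteqP; split => xi /= [h1]; [case/andP|case=> h2 h3; split=> //; apply/andP].
apply: openI; last apply: openI; apply: open_comp.
- by move=> xi _; exact: cvg_fst.
- exact: open_space_box.
- by move=> xi _; exact: cvg_snd.
- exact: open_gt.
- by move=> xi _; exact: cvg_snd.
- exact: open_lt.
Qed.

Lemma closed_ge_coord a (i : 'I_n) : closed [set x : 'rV[R]_n | a 0 i <= x 0 i].
Proof.
by apply: (@closed_comp _ _ (fun x : 'rV[R]_n => x 0 i) [set t | a 0 i <= t]);
  [move=> x _; exact: coord_continuous|exact: closed_ge].
Qed.

Lemma closed_le_coord b (i : 'I_n) : closed [set x : 'rV[R]_n | x 0 i <= b 0 i].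
Proof.
by apply: (@closed_comp _ _ (fun x : 'rV[R]_n => x 0 i) [set t | t <= b 0 i]);
  [move=> x _; exact: coord_continuous|exact: closed_le].
Qed.

Lemma closure_space_box a b x : closure (space_box a b) x ->
  forall i, a 0 i <= x 0 i <= b 0 i.
Proof.
move=> cx i; apply/andP; split.
  apply: (closed_ge_coord a i) => B /cx [y [aby By]]; exists y; split=> //=.
  by have /andP[/ltW] := aby i.
apply: (closed_le_coord b i) => B /cx [y [aby By]]; exists y; split=> //=.
by have /andP[_ /ltW] := aby i.
Qed.

Lemma boundary_space_box a b x : boundary (space_box a b) x ->
  (forall i, a 0 i <= x 0 i <= b 0 i) /\ exists i, x 0 i = a 0 i \/ x 0 i = b 0 i.
Proof.
move=> [/closure_space_box cx]; have /interior_id -> := open_space_box a b.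
move=> nx; split=> //; apply: contrapT => ne; apply: nx => i.
have /andP[ai bi] := cx i; rewrite !lt_neqAle ai bi !andbT.
by apply/andP; split; apply/eqP => e; apply: ne; exists i; [left|right].
Qed.

Definition cbox a b t1 t2 : set X :=
  [set xi : X | (forall i, a 0 i <= xi.1 0 i <= b 0 i) /\ t1 <= xi.2 <= t2].

Lemma compact_cbox a b t1 t2 : compact (cbox a b t1 t2).
Proof.
have c1 : compact [set x : 'rV[R]_n | forall i, `[a 0 i, b 0 i]%classic (x 0 i)].
  apply: (@rV_compact _ _ (fun i => `[a 0 i, b 0 i]%classic)) => i.
  exact: segment_compact.
exact: (compact_setX c1 (@segment_compact R t1 t2)).
Qed.

Lemma closed_cbox a b t1 t2 : closed (cbox a b t1 t2).
Proof. by apply: compact_closed (compact_cbox _ _ _ _); exact: norm_hausdorff. Qed.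

Lemma closure_box_cbox a b t1 t2 : closure (box a b t1 t2) `<=` cbox a b t1 t2.
Proof.
have /closure_id -> := closed_cbox a b t1 t2.
apply: closure_subset => xi [/= h1 /andP[h2 h3]]; split; last by rewrite !ltW.
by move=> i; have /andP[h4 h5] := h1 i; rewrite !ltW.
Qed.

Lemma compact_closure_box a b t1 t2 : compact (closure (box a b t1 t2)).
Proof.
apply: subclosed_compact (compact_cbox a b t1 t2) (@closure_box_cbox _ _ _ _).
exact: closed_closure.
Qed.

Lemma parabolic_boundary_cbox a b t1 t2 xi : t1 < t2 ->
  parabolic_boundary a b t1 t2 xi -> cbox a b t1 t2 xi /\
  (xi.2 = t1 \/ exists i, xi.1 0 i = a 0 i \/ xi.1 0 i = b 0 i).
Proof.
move=> t12 [[/= sb e]|[/= /boundary_space_box [h1 h2] h3]]; split.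
- by split=> [i|]; [have /andP[] := sb i => /ltW -> /ltW ->|rewrite e lexx ltW].
- by left.
- by split.
- by right.
Qed.

Lemma nbhs_cbox (P : X -> Prop) xi : (\forall y \near xi, P y) ->
  exists2 r : R, 0 < r & forall y : X,
    (forall i, `|y.1 0 i - xi.1 0 i| < r) -> `|y.2 - xi.2| < r -> P y.
Proof.
move=> /nbhs_ballP [r /= r0 hr]; exists r => // y h1 h2; apply: hr; split => /=.
  split=> // i j; rewrite ord1 /ball /= distrC; exact: h1.
by rewrite /ball /= distrC.
Qed.

End Boxes.

(** * Superparabolic functions are not touched from below by strict subsolutions *)

Section StrictSuperjet.
Context {R : realType} {n : nat}.
Notation X := ('rV[R]_n * R)%type.
Implicit Types (Theta : set X) (W : X -> R) (xi y : X) (q : 'rV[R]_n) (p : R).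

(** The coefficient [N] absorbs curvature in time, which the equation does not see. *)
Definition jet_poly xi (b : R) q (beta k N : R) y : R :=
  let dx := y.1 - xi.1 in let dt := y.2 - xi.2 in
  b * dt + dotv q dx + beta / 2 * dotv dx dx - k / 2 * dotv q dx ^+ 2 + N * dt ^+ 2.

(* [W] is touched from above at [xi] by a quadratic polynomial which is a
   strict supersolution there, with Hessian [beta I - k q^T q]. *)
Definition strict_superjet p W xi := exists (b : R) (q : 'rV[R]_n) (beta k N : R),
  [/\ 0 < beta, 0 < k, (n%:R + p - 2) * beta - (p - 1) * k * dotv q q < b &
      \forall y \near xi, W y <= W xi + jet_poly xi b q beta k N y].

(** The Gaussian has at [xi] the gradient [- q] and Hessian [- B I + k q^T q], slightly below that
    of [c - jet_poly], and a time derivative exceeding [- b] by [mu > 0]. So it stays below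
    [c - jet_poly] away from [xi] in space and at slightly earlier times. *)
Lemma gauss_touching p xi (c b beta k N : R) q : (0 < n)%N -> 1 < p ->
  0 < beta -> 0 < k -> (n%:R + p - 2) * beta - (p - 1) * k * dotv q q < b ->
  exists (s : R) (h : X -> R) (mu eps K : R),
  [/\ [/\ after s xi, h xi = c, 0 < mu, 0 < eps & 0 < K],
      forall e, classical_solution p (after s) (fun y => h y + e) &
      \forall y \near xi, h y <= c - jet_poly xi b q beta k N y +
        (mu * (y.2 - xi.2) - eps * dotv (y.1 - xi.1) (y.1 - xi.1) +
         K * (y.2 - xi.2) ^+ 2)].
Proof.
move=> n0 p1 beta0 k0 slack.
have np : 0 < n%:R + p - 2 :> R.
  have : 1 <= n%:R :> R by rewrite ler1n.
  lra.
pose bh := b + (p - 1) * k * dotv q q.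
(* Midway between [beta] and the coefficient for which the strict inequality becomes an equality. *)
pose B := (beta + bh / (n%:R + p - 2)) / 2.
have bh1 : (n%:R + p - 2) * beta < bh by rewrite /bh; lra.
have bB : beta < bh / (n%:R + p - 2) by rewrite ltr_pdivlMr // mulrC.
have betaB : beta < B by rewrite /B; lra.
have B0 : 0 < B by lra.
have slackB : (n%:R + p - 2) * B - (p - 1) * k * dotv q q < b.
  have : B < bh / (n%:R + p - 2) by rewrite /B; lra.
  rewrite ltr_pdivlMr // => h; rewrite mulrC; rewrite /bh in h; lra.
have p10 : 0 < p - 1 by lra.
(* The scalar part of the Hessian is [E / (2 (p - 1) tau)], which is [B] for the height [E = 1 / k];
   the centre [y0] then makes the gradient [- q]. *)
pose tau := (2 * (p - 1) * k * B)^-1.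
have tau0 : 0 < tau by rewrite invr_gt0; do 3!apply: mulr_gt0 => //.
pose s := xi.2 - tau; pose y0 := xi.1 - B^-1 *: q.
pose H := k^-1 * expR (- gauss_exp p s y0 xi).
have H0 : 0 < H by rewrite mulr_gt0 ?expR_gt0 ?invr_gt0.
have HE : H * expR (gauss_exp p s y0 xi) = k^-1.
  by rewrite /H -mulrA -expRD addNr expR0 mulr1.
pose h := gauss p s y0 H (c - k^-1).
have h00 : h xi = c by rewrite /h /gauss HE; ring.
have [h1 [h2 [sh jh]]] := smooth2_gauss p s y0 H (c - k^-1) p1 H0.
have sxi : after s xi by rewrite /after /= /s; lra.
have oA : open (after s : set X) by exact: open_after.
have [j1 jt j2] := jh xi sxi.
have bE : - (k^-1 / (2 * (p - 1) * (xi.2 - s))) = - B.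
  have -> : xi.2 - s = tau by rewrite /s; ring.
  by rewrite /tau; field; rewrite !gt_eqF.
have qE : (- B) *: (xi.1 - y0) = - q.
  rewrite /y0 opprB addrC subrK scalerA mulNr mulfV ?gt_eqF // scaleN1r //.
rewrite HE bE qE invrK in j1 jt j2.
(* Half of the gap [(B - beta) / 2] pays for the Taylor error, the other half remains as
   [- eps |dx|^2]. *)
pose eps := (B - beta) / 4.
have eps0 : 0 < eps by rewrite /eps; lra.
have [M tay] := taylor_jet (after s) h h1 h2 xi eps oA sh sxi eps0.
pose mu := b - ((n%:R + p - 2) * B - (p - 1) * k * dotv q q).
have mu0 : 0 < mu by rewrite /mu; lra.
pose K := `|M + N| + 1.
have K0 : 0 < K by rewrite /K ltr_wpDl.
exists s, h, mu, eps, K; split=> // [e|].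
  have -> : (fun y => h y + e) = gauss p s y0 H (c - k^-1 + e).
    by apply/funext => y; rewrite /h /gauss; ring.
  exact: gauss_classical_solution.
apply: filterS tay => y.
rewrite h00 j1 jt j2 /jet_poly !(dotvNr, dotvNl) /mu /eps /=.
set dx := y.1 - xi.1; set dt := y.2 - xi.2; rewrite (dotvC dx q).
have : (M + N) * dt ^+ 2 <= (K - 1) * dt ^+ 2.
  by rewrite ler_wpM2r ?sqr_ge0 // /K addrK ler_norm.
have := sqr_ge0 dt; have := dotv_ge0 dx; clear.
by move: (dotv dx dx) (dotv q dx) (dotv q q) (dt ^+ 2) => A D Q T; lra.
Qed.

Lemma ltr_dist_itv (x y d e r : R) : d < r -> e < r -> x - d <= y <= x + e -> `|y - x| < r.
Proof. by move=> dr er /andP[? ?]; rewrite ltr_norml; apply/andP; split; lra. Qed.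

(* The Gaussian, raised a little, pokes above [u] at [xi] although it is below
   [u] on the parabolic boundary of a small box ending just after [xi]. *)
Lemma superparabolic_no_touching p Theta (u : X -> \bar R) xi (c b beta k N : R) q :
  (0 < n)%N -> 1 < p -> open Theta -> superparabolic p Theta u -> Theta xi ->
  u xi = c%:E -> 0 < beta -> 0 < k ->
  (n%:R + p - 2) * beta - (p - 1) * k * dotv q q < b ->
  ~ \forall y \near xi, ((c - jet_poly xi b q beta k N y)%:E <= u y)%E.
Proof.
move=> n0 p1 oT [_ spu] Txi uxi beta0 k0 slack above.
have [s [h [mu [eps [K [[sxi hxi mu0 eps0 K0] cls hle]]]]]] :=
  gauss_touching p xi c b beta k N q n0 p1 beta0 k0 slack.
have oA : open (after s : set X) by exact: open_after.
pose err y := mu * (y.2 - xi.2) - eps * dotv (y.1 - xi.1) (y.1 - xi.1) +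
         K * (y.2 - xi.2) ^+ 2.
have near1 : \forall y \near xi, [/\ Theta y, after s y & ((h y - err y)%:E <= u y)%E].
  have nT : \forall y \near xi, Theta y by exact: open_nbhs_nbhs.
  have nA : \forall y \near xi, after s y by exact: open_nbhs_nbhs.
  near=> y; split; [by near: y|by near: y|].
  have a1 : ((c - jet_poly xi b q beta k N y)%:E <= u y)%E by near: y.
  apply: le_trans a1; rewrite lee_fin lerBlDr; near: y; exact: hle.
have [r r0 hr] := nbhs_cbox _ _ near1.
(* The error must be at most [- eta] on the parabolic boundary. At the bottom the linear term in
   time wins for [s1 <= mu / (2 K)]; on the sides [eps d^2] wins for [t <= s2] with [s2] small
   against it. The Gaussian can then be raised by [eta]. *)
have [d [s1 [s2 [eta [[d0 dr s10 s1r s20] s2r eta0 bot lat]]]]] : exists d s1 s2 eta : R,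
    [/\ [/\ 0 < d, d < r, 0 < s1, s1 < r & 0 < s2], s2 < r, 0 < eta,
      forall D, 0 <= D -> eta <= eps * D - (mu * (- s1) + K * (- s1) ^+ 2) &
      forall D t, d ^+ 2 <= D -> - s1 <= t <= s2 -> eta <= eps * D - (mu * t + K * t ^+ 2)].
  clear - r0 mu0 eps0 K0; pose d := r / 2; have d0 : 0 < d by rewrite /d; lra.
  have d20 : 0 < d ^+ 2 by rewrite exprn_gt0.
  pose A := eps * d ^+ 2; have A0 : 0 < A by rewrite mulr_gt0.
  pose s1 := Num.min d (mu / (2 * K)).
  have s10 : 0 < s1 by rewrite lt_min d0 divr_gt0 // mulr_gt0.
  have muK : 0 < 2 * (mu + K) by lra.
  pose s2 := Num.min (Num.min d 1) (A / (2 * (mu + K))).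
  have s20 : 0 < s2 by rewrite !lt_min d0 ltr01 divr_gt0.
  have s1m : K * s1 <= mu / 2.
    have : s1 <= mu / (2 * K) by rewrite ge_min lexx orbT.
    by rewrite ler_pdivlMr ?mulr_gt0 //; lra.
  have s21 : s2 <= 1 by rewrite !ge_min lexx orbT.
  have s2m : (mu + K) * s2 <= A / 2.
    have : s2 <= A / (2 * (mu + K)) by rewrite !ge_min lexx !orbT.
    by rewrite ler_pdivlMr //; lra.
  have m1 : 0 < mu * s1 by rewrite mulr_gt0.
  pose eta := Num.min (mu * s1 / 2) (A / 2).
  have eta1 : eta <= mu * s1 / 2 by rewrite ge_min lexx.
  have eta2 : eta <= A / 2 by rewrite ge_min lexx orbT.
  have eta0 : 0 < eta by rewrite lt_min !divr_gt0.
  have s1d : s1 <= d by rewrite ge_min lexx.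
  have s2d : s2 <= d by rewrite !ge_min lexx.
  exists d, s1, s2, eta; split=> //.
  - by rewrite /d in s1d s2d d0 *; split=> //; lra.
  - by rewrite /d in s2d; lra.
  - move=> D D0; have : 0 <= eps * D by rewrite mulr_ge0 // ltW.
    have : K * s1 * s1 <= mu / 2 * s1 by rewrite ler_pM2r.
    by rewrite sqrrN expr2; lra.
  - move=> D t dD /andP[t1 t2].
    have AD : A <= eps * D by rewrite ler_pM2l.
    have [t0|t0] := leP t 0.
      have : 0 <= mu / 2 * - t by rewrite mulr_ge0 //; lra.
      have : K * - t * - t <= mu / 2 * - t.
        rewrite ler_wpM2r //; first lra.
        by apply: le_trans s1m; rewrite ler_pM2l //; lra.
      by rewrite expr2; lra.
    have : mu * t <= mu * s2 by rewrite ler_pM2l.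
    have : K * t ^+ 2 <= K * s2.
      rewrite ler_pM2l // expr2; apply: (@le_trans _ _ (t * 1)); last by rewrite mulr1.
      by rewrite ler_pM2l //; lra.
    by lra.
pose ba := xi.1 - const_mx d; pose bb := xi.1 + const_mx d.
pose B := box ba bb (xi.2 - s1) (xi.2 + s2).
have good y : cbox ba bb (xi.2 - s1) (xi.2 + s2) y ->
    [/\ Theta y, after s y & ((h y - err y)%:E <= u y)%E].
  move=> [cy t12]; apply: hr => [i|].
    by have := cy i; rewrite !mxE; exact: ltr_dist_itv.
  exact: ltr_dist_itv t12.
have sub : closure B `<=` after s by move=> y /closure_box_cbox /good [].
have oB : open B by exact: open_box.
pose g y := h y + eta.
have vis : viscosity_solution p B (EFin \o g).
  apply: classical_viscosity_solution => //.
  have [h1 [h2 [sm cs]]] := cls eta; exists h1, h2; split.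
    by apply: smooth2S sm => y /subset_closure /sub.
  by move=> y /subset_closure /sub; exact: cs.
have cont : {within closure B, continuous g}.
  apply: continuous_in_subspaceT => y; rewrite inE => /sub sy.
  by have [h1 [h2 [sm _]]] := cls eta; have [] := sm y sy.
have t12 : xi.2 - s1 < xi.2 + s2 by rewrite ltrD2l (lt_trans _ s20) ?oppr_lt0.
have bnd y : parabolic_boundary ba bb (xi.2 - s1) (xi.2 + s2) y -> ((g y)%:E <= u y)%E.
  move=> /(parabolic_boundary_cbox _ _ _ _ _ t12) [cy py].
  have [_ _] := good y cy; apply: le_trans; rewrite lee_fin /g /err.
  suff : eta <= eps * dotv (y.1 - xi.1) (y.1 - xi.1) -
      (mu * (y.2 - xi.2) + K * (y.2 - xi.2) ^+ 2) by lra.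
  case: py => [->|[i yi]].
    by have -> : xi.2 - s1 - xi.2 = - s1 by [ring]; apply: bot; exact: dotv_ge0.
  have [_ /andP[t1 t2]] := cy; apply: lat; last by rewrite lerBrDl t1 lerBlDl t2.
  apply: le_trans (sqr_coord_le_dotv _ i); rewrite !mxE.
  case: yi => ->; rewrite !mxE le_eqVlt; apply/orP; left; apply/eqP; ring.
have bxi : B xi.
  split=> [i|] /=; first by rewrite !mxE gtrDl oppr_lt0 ltrDl d0.
  by rewrite gtrDl oppr_lt0 ltrDl s10.
have := spu ba bb (xi.2 - s1) (xi.2 + s2) _ t12 (compact_closure_box _ _ _ _) _ g cont vis bnd xi bxi.
rewrite uxi lee_fin /g hxi; suff : ~ c + eta <= c.
  move=> k1 k2; apply: k1; apply: k2; first by move=> i; rewrite !mxE ltrD2l (lt_trans _ d0) ?oppr_lt0.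
  by move=> y /closure_box_cbox /good [].
by apply/negP; rewrite -ltNge ltrDl.
Unshelve. all: by end_near. Qed.

End StrictSuperjet.

(** * Strict supersolutions are superparabolic *)

Section SuperparabolicBarrier.
Context {R : realType} {n : nat}.
Notation X := ('rV[R]_n * R)%type.
Implicit Types (Theta : set X) (W : X -> R) (xi y : X) (q : 'rV[R]_n) (p : R).

Lemma eig_ext_scalar p (b : R) : (0 < n)%N -> eig_ext p (b%:M : 'M[R]_n) = b.
Proof.
move=> n0; rewrite /eig_ext; have -> : [set a | eigenvalue (b%:M : 'M[R]_n) a] = [set b].
  apply/seteqP; split=> a /=.
    move=> /eigenvalueP [v]; rewrite mul_mx_scalar => /eqP.
    rewrite -subr_eq0 -scalerBl scaler_eq0 subr_eq0 => /orP[/eqP //|/eqP -> /eqP //].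
  move=> ->; apply/eigenvalueP; exists (delta_mx 0 (Ordinal n0)); first exact: mul_mx_scalar.
  by rewrite -dotv_gt0 dotv_delta !mxE !eqxx ltr01.
by rewrite inf1 sup1 if_same.
Qed.

(** The term in [M] is positive away from [xi] but affects neither the first derivatives nor the
    spatial Hessian at [xi]. *)
Lemma smooth2_test_poly xi (c b beta k N M : R) q : exists f1 f2,
  [/\ smooth2 [set: X] (fun y => c + jet_poly xi b q beta k N y +
        M * ((y.2 - xi.2) ^+ 2 + dotv (y.1 - xi.1) (y.1 - xi.1) ^+ 2)) f1 f2,
      f1 dir_t xi = b, forall z, f1 (z, 0) xi = dotv z q &
      forall z z', f2 (z, 0) (z', 0) xi = beta * dotv z z' - k * dotv z q * dotv z' q].
Proof.
have hT := smooth2_time [set: X] xi.2.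
have hL := smooth2_dotv [set: X] q xi.1.
have hS := smooth2_sqdist [set: X] xi.1.
have hTT := smooth2M _ _ _ _ _ _ _ hT hT.
have hSS := smooth2M _ _ _ _ _ _ _ hS hS.
have hLL := smooth2M _ _ _ _ _ _ _ hL hL.
have h1 := smooth2D _ _ _ _ _ _ _ (smooth2Z _ _ _ _ b hT) hL.
have h2 := smooth2D _ _ _ _ _ _ _ h1 (smooth2Z _ _ _ _ (beta / 2) hS).
have h3 := smooth2D _ _ _ _ _ _ _ h2 (smooth2Z _ _ _ _ (- (k / 2)) hLL).
have h4 := smooth2D _ _ _ _ _ _ _ h3 (smooth2Z _ _ _ _ (N + M) hTT).
have h5 := smooth2D _ _ _ _ _ _ _ h4 (smooth2Z _ _ _ _ M hSS).
have h6 := smooth2D _ _ _ _ _ _ _ h5 (smooth2_cst _ c).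
do 2!eexists; split.
- move: h6; congr smooth2; apply/funext => y /=; rewrite /jet_poly /cst /=; ring.
- by rewrite /= /cst !(subrr, dotv0l, dotv0r); ring.
- by move=> z; rewrite /= /cst !(subrr, dotv0l, dotv0r) (dotvC z q); ring.
- by move=> z z'; rewrite /= /cst !(subrr, dotv0l, dotv0r) (dotvC z q) (dotvC z' q); field.
Qed.

(** Test functions must touch strictly and in the whole of [B], while the contact assumed here is
    local and not strict. Adding the term in [M] repairs both, thanks to the bound [C]; the
    resulting function has the same jet and contradicts the definition. *)
Lemma subsolution_no_touching p (B : set X) (h : X -> R) xi (b beta k N C : R) q :
  (0 < n)%N -> open B -> B xi -> viscosity_subsolution p B (EFin \o h) ->
  (n%:R + p - 2) * beta - (p - 1) * k * dotv q q < b ->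
  (forall y, B y -> h y - (h xi + jet_poly xi b q beta k N y) <= C) ->
  ~ \forall y \near xi, h y <= h xi + jet_poly xi b q beta k N y.
Proof.
move=> n0 oB Bxi [_ sub] slack bnd /nbhs_cbox [r r0 hr].
pose D y := (y.2 - xi.2) ^+ 2 + dotv (y.1 - xi.1) (y.1 - xi.1) ^+ 2.
pose m := Num.min (r ^+ 2) ((r ^+ 2) ^+ 2).
have m0 : 0 < m by rewrite lt_min !exprn_gt0.
(* Outside the cube of radius [r] around [xi] the added term is at least [M m], which exceeds
   [C]. *)
pose M := `|C| / m + 1.
have M0 : 0 < M by rewrite /M ltr_wpDl // divr_ge0 // ltW.
have CM : C < M * m.
  rewrite /M mulrDl divfK ?gt_eqF // mul1r; apply: le_lt_trans (ler_norm C) _.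
  by rewrite ltrDl.
have [f1 [f2 [sf ft fx fxx]]] := smooth2_test_poly xi (h xi) b beta k N M q.
set phi := (fun y : X => _) in sf.
have sN : smooth2 B (fun y => - 1 * phi y) (fun v y => - 1 * f1 v y)
    (fun v w y => - 1 * f2 v w y) by apply: smooth2Z; apply: smooth2S sf.
have phixi : phi xi = h xi.
  by rewrite /phi /jet_poly !(subrr, dotv0l, dotv0r); ring.
have D_gt0 y : y != xi -> 0 < D y.
  move=> yxi; rewrite lt_def addr_ge0 ?sqr_ge0 // andbT; apply: contra yxi.
  rewrite paddr_eq0 ?sqr_ge0 // !sqrf_eq0 dotv_eq0 !subr_eq0 => /andP[/eqP e2 /eqP e1].
  by apply/eqP; apply: injective_projections.
have lt_phi y : B y -> y != xi -> h y < phi y.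
  move=> By yxi; have Dy := D_gt0 y yxi.
  have [nr|] := pselect ((forall i, `|y.1 0 i - xi.1 0 i| < r) /\ `|y.2 - xi.2| < r).
    apply: (le_lt_trans (hr y nr.1 nr.2)).
    by rewrite /phi -addrA ltrD2l ltrDl mulr_gt0.
  move=> far; have mD : m <= D y.
    have [ge_r|lt_r] := leP r `|y.2 - xi.2|.
      apply: (@le_trans _ _ (r ^+ 2)); first by rewrite ge_min lexx.
      apply: (@le_trans _ _ ((y.2 - xi.2) ^+ 2)); last by rewrite /D lerDl sqr_ge0.
      by rewrite -[leRHS]real_normK ?num_real // ler_sqr ?nnegrE // ltW.
    have [i ir] : exists i, r <= `|y.1 0 i - xi.1 0 i|.
      by apply: contrapT => ne; apply: far; split=> // i; rewrite ltNge; apply/negP => ?; apply: ne; exists i.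
    apply: (@le_trans _ _ ((r ^+ 2) ^+ 2)); first by rewrite ge_min lexx orbT.
    apply: (@le_trans _ _ (dotv (y.1 - xi.1) (y.1 - xi.1) ^+ 2)); last by rewrite /D lerDr sqr_ge0.
    rewrite ler_sqr ?nnegrE ?sqr_ge0 ?dotv_ge0 //.
    apply: le_trans (sqr_coord_le_dotv _ i); rewrite !mxE.
    by rewrite -[leRHS]real_normK ?num_real // ler_sqr ?nnegrE // ltW.
  have : M * m <= M * D y by rewrite ler_pM2l.
  by have := bnd y By; rewrite /phi -/(D y); lra.
have C2 : C2_on B (fun y => - 1 * phi y) by exact: smooth2_C2_on sN.
have [||g0 g1] := sub xi _ Bxi C2.
- by rewrite /= phixi mulN1r.
- by move=> y By yxi; rewrite /= lte_fin mulN1r ltrN2; exact: lt_phi.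
have gE : grad (fun y => - 1 * phi y) xi = - q.
  by apply: dotv_inj => z; rewrite -(smooth2_grad _ _ _ _ oB sN xi Bxi) fx dotvNr mulN1r.
have hE : rank_one_form (hess (fun y => - 1 * phi y) xi) (- beta) k (- q).
  move=> z z'; rewrite -(smooth2_hess _ _ _ _ oB sN xi Bxi) fxx !dotvNr; ring.
have tE : dt (fun y => - 1 * phi y) xi = - b.
  by rewrite (smooth2_dt _ _ _ _ oB sN xi Bxi) ft mulN1r.
have [q0|q0] := eqVneq q 0.
  move: (g1); rewrite gE q0 oppr0 => /(_ erefl).
  have hM : hess (fun y => - 1 * phi y) xi = (- beta)%:M.
    by apply: rank_one_scalar; move: hE; rewrite q0 oppr0; exact.
  rewrite tE /lapl hM eig_ext_scalar // mxtrace_scalar -mulr_natl.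
  by move: slack; rewrite q0 dotv0l; lra.
move: (g0); rewrite gE oppr_eq0 => /(_ q0).
rewrite tE /normalized_plapl /lapl gE (rank_one_plapl _ _ _ _ _ hE) ?oppr_eq0 //.
by rewrite dotvNl dotvNr opprK; lra.
Qed.

(** The penalization is not of class C2 at [s = 0], but it has a quadratic upper bound at every
    point, which is enough for a paraboloid touching from above. *)
Lemma sqr_max0_le (t s : R) :
  Num.max 0 t ^+ 2 <= Num.max 0 s ^+ 2 + 2 * Num.max 0 s * (t - s) + (t - s) ^+ 2.
Proof.
have -> : Num.max 0 s ^+ 2 + 2 * Num.max 0 s * (t - s) + (t - s) ^+ 2 =
  (Num.max 0 s + (t - s)) ^+ 2 by ring.
have [t0|t0] := leP t 0; first by rewrite expr0n sqr_ge0.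
rewrite ler_sqr ?nnegrE; have [s0|s0] := leP s 0; lra.
Qed.

Lemma closure_box_fst (a b : 'rV[R]_n) (t1 t2 : R) y :
  closure (box a b t1 t2) y -> closure (space_box a b) y.1.
Proof.
move=> cy B By; have [|z [[/= bz _] Bz]] := cy (fst @^-1` B).
  have c : (fst : X -> 'rV[R]_n) @ y --> y.1 by exact: cvg_fst.
  exact: c B By.
by exists z.1.
Qed.

Lemma closure_box_cases (a b : 'rV[R]_n) (t1 t2 : R) y :
  closure (box a b t1 t2) y -> y.2 < t2 ->
  box a b t1 t2 y \/ parabolic_boundary a b t1 t2 y.
Proof.
move=> cy yt2; have cx := closure_box_fst _ _ _ _ _ cy.
have [_ /andP[t1y _]] := closure_box_cbox _ _ _ _ _ cy.
have [bx|nbx] := pselect (space_box a b y.1).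
  have [t1y'|] := ltP t1 y.2; first by left; split=> //=; rewrite t1y'.
  by move=> yt1; right; left; split=> //=; apply/eqP; rewrite eq_le yt1.
right; right; split=> /=; last by rewrite t1y ltW.
by split=> //; have /interior_id -> := open_space_box a b.
Qed.

(** At an interior maximum of [h - W] the paraboloid above [W], shifted, also lies above [h], which
    no viscosity subsolution allows. The delicate case is a maximum at the final time, on which the
    parabolic boundary gives no information. *)
Lemma strict_superjet_superparabolic p Theta W : (0 < n)%N -> open Theta ->
  (forall xi, Theta xi -> {for xi, continuous W} /\ strict_superjet p W xi) ->
  superparabolic p Theta (EFin \o W).
Proof.
move=> n0 oT hW; split.
  by apply: lsc_dense_finite_continuous => // xi /hW [].
move=> a b t1 t2 ab t12 cK sKT h hc [_ hsub] hbd xi1 Bxi1.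
rewrite lee_fin leNgt; apply/negP => Whxi1.
set K := closure (box a b t1 t2) in cK sKT hc *.
have BK : box a b t1 t2 `<=` K by exact: subset_closure.
have oB := open_box a b t1 t2.
have Wc : {within K, continuous W}.
  by apply: continuous_in_subspaceT => y; rewrite inE => /sKT /hW [].
have hWc : {within K, continuous (h \- W)}.
  by move=> y; apply: continuousB; [exact: hc|exact: Wc].
have [ym _ hym] : exists2 y, y \in K & forall t, t \in K -> (h \- W) t <= (h \- W) y.
  by apply: compact_EVT_max => //; exists xi1; exact: BK.
pose S := h ym - W ym.
(* A penalization after the time of [xi1] keeps the maximum point of
   [h - W] away from the final time of the box. *)
pose tau := xi1.2; have [_ /andP[t1tau taut2]] := Bxi1; rewrite -/tau in t1tau taut2.
pose t' := (tau + t2) / 2.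
(* At time [t'] the penalization equals [|S| + 1], more than the maximum [S] of [h - W], while at
   [xi1] it vanishes; so the penalized maximum is attained before [t']. *)
pose A := (`|S| + 1) / (t' - tau) ^+ 2.
have tt' : 0 < t' - tau by rewrite /t'; lra.
have A0 : 0 < A by rewrite divr_gt0 ?exprn_gt0 // ltr_wpDl.
pose pen (y : X) := A * Num.max 0 (y.2 - tau) ^+ 2.
have pen_c : continuous pen.
  move=> y; have c1 : {for y, continuous (fun y : X => Num.max 0 (y.2 - tau))}.
    apply: (@continuous_max _ X (cst 0) (fun y : X => y.2 - tau)).
      exact: cst_continuous.
    by have [] := smooth2_time [set: X] tau y I.
  have c2 : {for y, continuous (fun y : X => Num.max 0 (y.2 - tau) ^+ 2)}.
    exact: (@continuous_comp _ _ _ (fun y : X => Num.max 0 (y.2 - tau))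
      (fun t : R => t ^+ 2) _ c1 (@exprn_continuous _ _ _)).
  exact: (@continuousM R X (cst A) (fun y : X => Num.max 0 (y.2 - tau) ^+ 2) y
    (@cst_continuous _ _ _ _) c2).
pose K' := K `&` [set y | y.2 <= t'].
have cK' : compact K'.
  apply: subclosed_compact cK _; last by move=> y [].
  apply: closedI; first exact: closed_closure.
  apply: (@closed_comp _ _ (fun y : X => y.2) [set t | t <= t']).
    by move=> y _; exact: cvg_snd.
  exact: closed_le.
pose f y := h y - W y - pen y.
have [xi0 xi0K fmax] : exists2 y, y \in K' & forall t, t \in K' -> f t <= f y.
  apply: compact_EVT_max => //.
    by exists xi1; split; [exact: BK|rewrite /= /t'; lra].
  have -> : f = (h \- W) \- pen by [].
  have hWc' : {within K', continuous (h \- W)}.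
    by apply: continuous_subspaceW hWc => z [].
  have pc' : {within K', continuous pen} by apply: continuous_subspaceT; exact: pen_c.
  by move=> y; apply: continuousB; [exact: hWc'|exact: pc'].
have f1 : 0 < f xi1 by rewrite /f /pen subrr maxxx expr0n mulr0 subr0 subr_gt0.
move: xi0K; rewrite inE => -[Kxi0 xi0t'].
have f0 : 0 < f xi0.
  apply: lt_le_trans f1 (fmax _ _); rewrite inE; split; [exact: BK|rewrite /= /t'; lra].
have xi0t : xi0.2 < t'.
  rewrite lt_neqAle xi0t' andbT; apply/eqP => e.
  have := hym xi0; rewrite inE => /(_ Kxi0) /=; rewrite -/S => le_S.
  move: f0; rewrite /f /pen e max_r; last by lra.
  by rewrite /A divfK ?gt_eqF ?exprn_gt0 //; have := ler_norm S; lra.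
have xi0t2 : xi0.2 < t2 by rewrite /t' in xi0t; lra.
have Bxi0 : box a b t1 t2 xi0.
  have [//|/hbd] := closure_box_cases _ _ _ _ _ Kxi0 xi0t2.
  rewrite lee_fin => hW0; move: f0; rewrite /f.
  have : 0 <= pen xi0 by rewrite /pen mulr_ge0 ?sqr_ge0 // ltW.
  lra.
have [_ [c [q [beta [k [N [beta0 k0 slack Wle]]]]]]] := hW xi0 (sKT _ Kxi0).
pose m := Num.max 0 (xi0.2 - tau).
have m0 : 0 <= m by rewrite le_max lexx.
(* The penalization adds [2 A m >= 0] to the slope in time, which only increases the strictness, and
   [A] to the curvature in time. *)
pose c' := c + 2 * A * m; pose N' := N + A.
have slack' : (n%:R + p - 2) * beta - (p - 1) * k * dotv q q < c'.
  by apply: (lt_le_trans slack); rewrite /c' lerDl; do 2!apply: mulr_ge0 => //; exact: ltW.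
have [f1' [f2' [sf _ _ _]]] := smooth2_test_poly xi0 (h xi0) c' beta k N' 0 q.
have pc : continuous (fun y => h xi0 + jet_poly xi0 c' q beta k N' y).
  have e : (fun y => h xi0 + jet_poly xi0 c' q beta k N' y) = (fun y =>
      h xi0 + jet_poly xi0 c' q beta k N' y +
      0 * ((y.2 - xi0.2) ^+ 2 + dotv (y.1 - xi0.1) (y.1 - xi0.1) ^+ 2)).
    by apply/funext => z; rewrite mul0r addr0.
  by rewrite e => y; have [] := sf y I.
have [yC _ hyC] : exists2 y, y \in K & forall t, t \in K ->
    h t - (h xi0 + jet_poly xi0 c' q beta k N' t) <=
    h y - (h xi0 + jet_poly xi0 c' q beta k N' y).
  apply: (compact_EVT_max (f := fun t => h t - (h xi0 + jet_poly xi0 c' q beta k N' t))) => //.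
    by exists xi1; exact: BK.
  have -> : (fun t => h t - (h xi0 + jet_poly xi0 c' q beta k N' t)) =
    h \- (fun t => h xi0 + jet_poly xi0 c' q beta k N' t) by [].
  have pc' := @continuous_subspaceT _ _ K _ pc.
  by move=> y; apply: continuousB; [exact: hc|exact: pc'].
apply: (subsolution_no_touching p _ h xi0 c' beta k N' _ q n0 oB Bxi0 hsub slack'
  (fun y By => hyC y (mem_set (BK y By)))).
have nB : \forall y \near xi0, box a b t1 t2 y by exact: open_nbhs_nbhs.
have nt : \forall y \near xi0, y.2 < t'.
  have : {for xi0, continuous (snd : X -> R)} by exact: cvg_snd.
  by move/cvgr_lt; apply.
near=> y.
have By : box a b t1 t2 y by near: y.
have yt : y.2 < t' by near: y.
have Wy : W y <= W xi0 + jet_poly xi0 c q beta k N y by near: y.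
have := fmax y; rewrite inE => /(_ (conj (BK y By) (ltW yt))).
have := sqr_max0_le (y.2 - tau) (xi0.2 - tau); rewrite -/m.
have -> : y.2 - tau - (xi0.2 - tau) = y.2 - xi0.2 by ring.
rewrite -(ler_pM2l A0) /f /pen -/m.
move: Wy; rewrite /c' /N' /jet_poly /=.
clear; set M := Num.max _ _; move: (M ^+ 2) => M2; lra.
Unshelve. all: by end_near. Qed.

End SuperparabolicBarrier.

(** * Operations on local barriers; real powers *)

Section LocalBarrier.
Context {R : realType} {n : nat}.
Notation X := ('rV[R]_n * R)%type.
Implicit Types (U : set X) (W : X -> R) (xi y : X) (q z : 'rV[R]_n) (p : R).

Definition local_barrier p W xi := {for xi, continuous W} /\ strict_superjet p W xi.

Lemma strict_superjet_le p W W' xi : strict_superjet p W xi -> W' xi = W xi ->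
  (\forall y \near xi, W' y <= W y) -> strict_superjet p W' xi.
Proof.
move=> [b [q [beta [k [N [b0 k0 slack le_W]]]]]] e le_W'.
exists b, q, beta, k, N; split=> //; rewrite e.
by apply: filterS2 le_W' le_W => y; exact: le_trans.
Qed.

Lemma local_barrier_near p W W' xi : local_barrier p W xi ->
  (\forall y \near xi, W' y = W y) -> local_barrier p W' xi.
Proof.
move=> [c s] e; have exi : W' xi = W xi by exact: nbhs_singleton e.
split; last by apply: strict_superjet_le s _ _ => //; apply: filterS e => y ->.
rewrite /prop_for /continuous_at exi; apply: cvg_trans c; apply: near_eq_cvg.
by apply: filterS e => y ->.
Qed.

Lemma local_barrier_min p W W' xi : local_barrier p W xi -> local_barrier p W' xi ->
  local_barrier p (fun y => Num.min (W y) (W' y)) xi.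
Proof.
move=> [c s] [c' s']; split; first exact: (@continuous_min _ _ W W').
have [le_W|lt_W] := leP (W xi) (W' xi).
  apply: strict_superjet_le s _ _; first by rewrite min_l.
  by near=> y; rewrite ge_min lexx.
apply: strict_superjet_le s' _ _; first by rewrite min_r // ltW.
by near=> y; rewrite ge_min lexx orbT.
Unshelve. all: by end_near. Qed.

Lemma local_barrier_affine p W xi (K c : R) : 0 < K -> local_barrier p W xi ->
  local_barrier p (fun y => K * W y + c) xi.
Proof.
move=> K0 [Wc [b [q [beta [k [N [b0 k0 slack le_W]]]]]]]; split.
  apply: (@continuousD _ _ _ (fun y => K * W y) (cst c)); last exact: cst_continuous.
  by apply: (@continuousM _ _ (cst K) W) => //; exact: cst_continuous.
have Kn0 : K != 0 by rewrite gt_eqF.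
(* Here [k] is divided by [K], because [q^T q] is multiplied by [K^2]. *)
exists (K * b), (K *: q), (K * beta), (k / K), (K * N); split.
- exact: mulr_gt0.
- exact: divr_gt0.
- rewrite -(ltr_pM2l K0) in slack; rewrite dotvZl dotvZr.
  have -> : (p - 1) * (k / K) * (K * (K * dotv q q)) = K * ((p - 1) * k * dotv q q).
    by field.
  lra.
apply: filterS le_W => y; rewrite -(ler_pM2l K0) /jet_poly dotvZl exprMn.
have -> : k / K / 2 * (K ^+ 2 * dotv q (y.1 - xi.1) ^+ 2) =
  K * (k / 2 * dotv q (y.1 - xi.1) ^+ 2) by field.
lra.
Qed.

(** The Taylor error [e |dx|^2] is absorbed by raising [beta] to [beta + 2 e], which costs half of
    the slack [d]. *)
Lemma smooth2_local_barrier p U (f : X -> R) f1 f2 xi (b beta k : R) q :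
  0 < n%:R + p - 2 ->
  open U -> smooth2 U f f1 f2 -> U xi -> f1 dir_t xi = b ->
  (forall z, f1 (z, 0) xi = dotv q z) ->
  (forall z, f2 (z, 0) (z, 0) xi = beta * dotv z z - k * dotv q z ^+ 2) ->
  0 < beta -> 0 < k -> (n%:R + p - 2) * beta - (p - 1) * k * dotv q q < b ->
  local_barrier p f xi.
Proof.
move=> np oU hf Uxi ft fx fxx beta0 k0 slack.
split; first by have [] := hf xi Uxi.
pose d := b - ((n%:R + p - 2) * beta - (p - 1) * k * dotv q q).
have d0 : 0 < d by rewrite subr_gt0.
pose e := d / (4 * (n%:R + p - 2)).
have e0 : 0 < e by rewrite divr_gt0 // mulr_gt0.
have [M tay] := taylor_jet U f f1 f2 xi e oU hf Uxi e0.
exists b, q, (beta + 2 * e), k, M; split=> //; first by lra.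
  have : (n%:R + p - 2) * (2 * e) = d / 2 by rewrite /e; field; rewrite gt_eqF.
  by rewrite /d; lra.
by apply: filterS tay => y; rewrite ft fx fxx /jet_poly; lra.
Qed.

End LocalBarrier.

Section Powers.
Context {R : realType} {V : normedModType R}.

Lemma smooth2_powR (U : set V) (f : V -> R) f1 f2 (a : R) : smooth2 U f f1 f2 ->
  (forall x, U x -> 0 < f x) ->
  smooth2 U (fun x => f x `^ a) (fun v x => a * f x `^ (a - 1) * f1 v x)
   (fun v w x => a * ((a - 1) * f x `^ (a - 1 - 1)) * (f1 v x * f1 w x) +
                 a * f x `^ (a - 1) * f2 v w x).
Proof.
move=> hf f0.
apply: (smooth2_comp U f f1 f2 (@powR R ^~ a) (fun x => a * x `^ (a - 1))
  (fun x => a * ((a - 1) * x `^ (a - 1 - 1))) hf).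
have d (b y : R) (c : R) : 0 < y ->
    is_derive y 1 (fun x => c * x `^ b) (c * (b * y `^ (b - 1))).
  move=> y0; have h := is_derive1_powR b y0.
  have -> : (fun x : R => c * x `^ b) = (cst c * (@powR R ^~ b))%R by [].
  apply: is_derive_eq (is_deriveM (is_derive_cst c y 1) h) _.
  by rewrite /GRing.scale /= mulr0 addr0.
move=> x /f0 fx0; split; [exact: is_derive1_powR|exact: d|].
have c1 := is_derive_continuous1 _ _ _ (d (a - 1 - 1) (f x) (a * (a - 1)) fx0).
have -> : (fun x : R => a * ((a - 1) * x `^ (a - 1 - 1))) =
  (fun x => a * (a - 1) * x `^ (a - 1 - 1)) by apply/funext => y; rewrite mulrA.
exact: c1.
Qed.

End Powers.

(** * The two pieces of the barrier *)

Section Pieces.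
Context {R : realType} {n : nat}.
Notation X := ('rV[R]_n * R)%type.
Implicit Types (U : set X) (W : X -> R) (xi y : X) (q z xhat : 'rV[R]_n) (p s : R).

(** For [s = 0] and [A = M^2] the sign compares [|x|] with [M sqrt (- t)]; a large shift [s] makes
    the function positive on a bounded set. *)
Definition parab (A s : R) y := dotv y.1 y.1 + A * (y.2 + s).

Lemma smooth2_parab U A s : smooth2 U (parab A s)
  (fun v y => 2 * dotv v.1 y.1 + A * v.2) (fun v w => cst (2 * dotv v.1 w.1)).
Proof.
have := smooth2D _ _ _ _ _ _ _ (smooth2_sqdist U 0) (smooth2Z _ _ _ _ A (smooth2_time U (- s))).
congr smooth2.
- by apply/funext => y; rewrite /= subr0 opprK.
- by apply/funext => v; apply/funext => y; rewrite /= subr0.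
- by apply/funext => v; apply/funext => w; apply/funext => y; rewrite /= /cst mulr0 addr0.
Qed.

Lemma continuous_parab A s : continuous (parab A s).
Proof. by move=> y; have [] := smooth2_parab [set: X] A s y I. Qed.

Lemma open_parab_gt0 A s : open [set y | 0 < parab A s y].
Proof.
by apply: (@open_comp _ _ (parab A s) [set t | 0 < t]); [move=> y _; exact: continuous_parab|exact: open_gt].
Qed.

Lemma open_parab_lt0 A s : open [set y | parab A s y < 0].
Proof.
by apply: (@open_comp _ _ (parab A s) [set t | t < 0]); [move=> y _; exact: continuous_parab|exact: open_lt].
Qed.

Definition outer A s (g : R) y := parab A s y `^ g.

(** With [c = g P^(g - 1)] the slope in time is [c A] and the scalar part of the Hessian is [2 c],
    so [A > 2 (n + p - 2)] suffices. The concavity of the power yields a Hessian term [- k q^T q]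
    with [k > 0]. *)
Lemma outer_local_barrier p A s (g : R) xi : 1 < p -> 0 < n%:R + p - 2 ->
  0 < g < 1 -> 2 * (n%:R + p - 2) < A -> 0 < parab A s xi ->
  local_barrier p (outer A s g) xi.
Proof.
move=> p1 np /andP[g0 g1] An P0.
pose U := [set y | 0 < parab A s y].
have hf := smooth2_powR U _ _ _ g (smooth2_parab U A s) (fun _ => id).
set P := parab A s xi in P0.
pose c := g * P `^ (g - 1).
have pw a : 0 < P `^ a by exact: powR_gt0.
have c0 : 0 < c by rewrite mulr_gt0.
pose k := (1 - g) / g * P `^ (g - 1 - 1) / (P `^ (g - 1)) ^+ 2.
have k0 : 0 < k by rewrite divr_gt0 ?exprn_gt0 // mulr_gt0 // divr_gt0 //; lra.
apply: (smooth2_local_barrier p U _ _ _ xi (c * A) (2 * c) k ((2 * c) *: xi.1) np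
  (open_parab_gt0 A s) hf P0).
- by rewrite /= dotv0l mulr1 mulr0 add0r.
- by move=> z; rewrite /= mulr0 addr0 dotvZl (dotvC z) -/P /c; ring.
- move=> z; rewrite /= /cst mulr0 addr0 dotvZl (dotvC z xi.1) -/P /k /c.
  have := pw (g - 1); move: (P `^ (g - 1)) (P `^ (g - 1 - 1)) => a b a0.
  by field; rewrite !gt_eqF.
- exact: mulr_gt0.
- exact: k0.
- have h1 : 0 <= (p - 1) * k * dotv ((2 * c) *: xi.1) ((2 * c) *: xi.1).
    by apply: mulr_ge0 (dotv_ge0 _); apply: mulr_ge0; [lra|exact: ltW].
  have h2 : c * (2 * (n%:R + p - 2)) < c * A by rewrite ltr_pM2l.
  lra.
Qed.

(** This is [|x - sqrt s xhat|^2 / s] with [s = - t], expanded into products of functions whose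
    derivatives are at hand. *)
Definition rescaled_sqdist xhat y := dotv y.1 y.1 * (- y.2)^-1
  - 2 * (dotv xhat y.1 * (- y.2) `^ (- 2^-1)) + dotv xhat xhat.

Definition inner xhat (k B g : R) y :=
  (- y.2) `^ g * (B - expR (- k * rescaled_sqdist xhat y)).

Definition past : set X := [set y | y.2 < 0].

Lemma open_past : open past.
Proof.
apply: (@open_comp _ _ (fun y : X => y.2) [set t | t < 0]); last exact: open_lt.
by move=> y _; exact: cvg_snd.
Qed.

Lemma sqr_powR_Nhalf (s : R) : 0 < s -> (s `^ (- 2^-1)) ^+ 2 = s^-1.
Proof.
move=> s0; rewrite expr2 -powRD; last by apply/implyP => _; rewrite gt_eqF.
have -> : - 2^-1 + - 2^-1 = -1 :> R by field.
by rewrite powR_inv1 // ltW.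
Qed.

Lemma rescaled_sqdistE xhat y : past y ->
  rescaled_sqdist xhat y =
  dotv (y.1 - Num.sqrt (- y.2) *: xhat) (y.1 - Num.sqrt (- y.2) *: xhat) / (- y.2).
Proof.
rewrite /past /= => y0; have s0 : 0 < - y.2 by lra.
rewrite /rescaled_sqdist; set t := (- y.2) `^ (- 2^-1).
have t0 : 0 < t by exact: powR_gt0.
have t2 : - y.2 = (t ^+ 2)^-1 by rewrite /t sqr_powR_Nhalf // invrK.
have -> : Num.sqrt (- y.2) = t^-1.
  by rewrite t2 -exprVn sqrtr_sqr gtr0_norm // invr_gt0.
rewrite !(dotvDl, dotvDr, dotvNl, dotvNr, dotvZl, dotvZr) (dotvC y.1 xhat) t2.
by field; rewrite gt_eqF.
Qed.

Lemma smooth2_inner xhat (k B g : R) : exists f1 f2,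
  smooth2 past (inner xhat k B g) f1 f2 /\ forall xi, past xi ->
  let s := - xi.2 in let G := s `^ g in
  let E := expR (- k * rescaled_sqdist xhat xi) in
  let D := xi.1 - Num.sqrt s *: xhat in
  [/\ f1 dir_t xi = - (g * (G / s)) * (B - E) + k * G * E / s ^+ 2 * dotv D xi.1,
      forall z, f1 (z, 0) xi = dotv ((2 * k * G * E / s) *: D) z
    & forall z, f2 (z, 0) (z, 0) xi = (2 * k * G * E / s) * dotv z z -
        (4 * k ^+ 2 * G * E / s ^+ 2) * dotv D z ^+ 2].
Proof.
have hs := smooth2Z _ _ _ _ (-1) (smooth2_time past 0).
have s0 y : past y -> 0 < -1 * (y.2 - 0) by rewrite /past /=; lra.
have sn0 y : past y -> -1 * (y.2 - 0) != 0 by move=> /s0; rewrite lt0r => /andP[].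
have hi := smooth2_inv _ _ _ _ hs sn0.
have hh := smooth2_powR _ _ _ _ (- 2^-1) hs s0.
have hg := smooth2_powR _ _ _ _ g hs s0.
have h1 := smooth2M _ _ _ _ _ _ _ (smooth2_sqdist past 0) hi.
have h2 := smooth2Z _ _ _ _ (-2) (smooth2M _ _ _ _ _ _ _ (smooth2_dotv past xhat 0) hh).
have h3 := smooth2D _ _ _ _ _ _ _ (smooth2D _ _ _ _ _ _ _ h1 h2) (smooth2_cst past (dotv xhat xhat)).
have h4 := smooth2_exp _ _ _ _ (smooth2Z _ _ _ _ (- k) h3).
have h5 := smooth2M _ _ _ _ _ _ _ hg (smooth2D _ _ _ _ _ _ _ (smooth2_cst past B) (smooth2Z _ _ _ _ (-1) h4)).
have sE (y : X) : -1 * (y.2 - 0) = - y.2 by rewrite subr0 mulN1r.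
have rE (y : X) : dotv (y.1 - 0) (y.1 - 0) / (-1 * (y.2 - 0)) +
    -2 * (dotv xhat (y.1 - 0) * (-1 * (y.2 - 0)) `^ (- 2^-1)) + dotv xhat xhat =
    rescaled_sqdist xhat y.
  by rewrite /rescaled_sqdist sE subr0; ring.
do 2!eexists; split.
  move: h5; congr smooth2; apply/funext => y.
  by rewrite /inner /= /cst /= rE sE mulN1r.
move=> xi pxi s G E D.
have s00 : 0 < s by rewrite /s; move: pxi; rewrite /past /=; lra.
rewrite /= /cst /= !rE !sE -/s -/E -/G !subr0.
(* In terms of [t = s^(-1/2)] both [s] and [sqrt s] are rational, so [field] applies. *)
set t := s `^ (- 2^-1).
have t0 : 0 < t by exact: powR_gt0.
have st : s = (t ^+ 2)^-1 by rewrite /t sqr_powR_Nhalf // invrK.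
have pB a : s `^ (a - 1) = s `^ a / s.
  by rewrite powRD; [rewrite powR_inv1 // ltW|apply/implyP => _; rewrite gt_eqF].
have sq : Num.sqrt s = t^-1.
  by rewrite st -exprVn sqrtr_sqr gtr0_norm // invr_gt0.
rewrite /D sq !pB -/G -/t !(dotv0l, dotv0r).
move: G E t t0 st {pB sq D} => G E t t0 st.
have tn0 : t != 0 by rewrite gt_eqF.
have x1 : dotv (xi.1 - t^-1 *: xhat) xi.1 = dotv xi.1 xi.1 - t^-1 * dotv xhat xi.1.
  by rewrite dotvDl dotvNl dotvZl.
split=> [|z|z].
- by rewrite x1 st; field.
- by rewrite dotvZl dotvDl dotvNl dotvZl (dotvC z) st; field.
- by rewrite dotvDl dotvNl dotvZl (dotvC z xi.1) st; field.
Qed.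

(** The hypothesis is a sufficient form of the strict inequality, divided by [s^(g - 1)]. The motion
    of the centre enters through [D . x = |D|^2 + sqrt s D . xhat], which is at least
    [- s |xhat|^2 / 4] by completing the square. *)
Lemma inner_local_barrier p xhat (k B g : R) xi : 1 < p -> 0 < n%:R + p - 2 ->
  past xi -> 0 < k ->
  let E := expR (- k * rescaled_sqdist xhat xi) in
  g * (B - E) + k * E * (dotv xhat xhat / 4) + 2 * k * E * (n%:R + p - 2) <
    4 * (p - 1) * k ^+ 2 * E * rescaled_sqdist xhat xi ->
  local_barrier p (inner xhat k B g) xi.
Proof.
move=> p1 np pxi k0 E slack.
have [f1 [f2 [sf hj]]] := smooth2_inner xhat k B g.
have [jt jx jxx] := hj xi pxi.
move: jt jx jxx; rewrite -/E; set s := - xi.2; set G := s `^ g.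
set D := xi.1 - _ => jt jx jxx.
have s0 : 0 < s by rewrite /s; move: pxi; rewrite /past /=; lra.
have G0 : 0 < G by exact: powR_gt0.
have E0 : 0 < E by exact: expR_gt0.
pose beta := 2 * k * G * E / s.
have beta0 : 0 < beta by rewrite divr_gt0 //; do 3!apply: mulr_gt0 => //.
have rD : rescaled_sqdist xhat xi = dotv D D / s by exact: rescaled_sqdistE.
have nz := (gt_eqF k0, gt_eqF s0, gt_eqF G0, gt_eqF E0).
apply: (smooth2_local_barrier p past _ _ _ xi _ beta ((G * E)^-1) (beta *: D) np
  open_past sf pxi jt jx _ beta0).
- by move=> z; rewrite jxx dotvZl /beta; field; rewrite !nz.
- by rewrite invr_gt0 mulr_gt0.
rewrite dotvZl dotvZr /beta.
have x1 : dotv D xi.1 = dotv D D + Num.sqrt s * dotv D xhat.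
  by rewrite {2}/D -dotvZr -dotvDr subrK.
clearbody D.
have low : - (s * dotv xhat xhat / 4) <= dotv D xi.1.
  have := dotv_ge0 (D + (Num.sqrt s / 2) *: xhat).
  rewrite x1 !(dotvDl, dotvDr, dotvZl, dotvZr) (dotvC xhat D).
  have : Num.sqrt s / 2 * (Num.sqrt s / 2 * dotv xhat xhat) = s * dotv xhat xhat / 4.
    by rewrite -{3}(sqr_sqrtr (ltW s0)); field.
  lra.
have low' : - (dotv xhat xhat / 4) <= dotv D xi.1 / s by rewrite ler_pdivlMr //; lra.
have GS : 0 < G / s by exact: divr_gt0.
move: slack; rewrite rD -(ltr_pM2l GS).
have : (G / s * (k * E)) * - (dotv xhat xhat / 4) <= (G / s * (k * E)) * (dotv D xi.1 / s).
  by rewrite ler_pM2l //; do 2!apply: mulr_gt0 => //.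
have -> : (p - 1) / (G * E) * (2 * k * G * E / s * (2 * k * G * E / s * dotv D D)) =
  G / s * (4 * (p - 1) * k ^+ 2 * E * (dotv D D / s)) by field; rewrite !nz.
have -> : k * G * E / s ^+ 2 * dotv D xi.1 = (G / s * (k * E)) * (dotv D xi.1 / s).
  by field; rewrite !nz.
have -> : 2 * k * G * E / s = G / s * (2 * k * E) by field; rewrite !nz.
move: (dotv D xi.1 / s) (G / s) => a b.
clear; lra.
Qed.

End Pieces.

(** * Choice of the constants *)

Section Constants.
Context {R : realType}.

(** The order of choice matters. First [k] is taken so large that [4 p1 k^2 r] beats the terms
    without [g]; then [B] is put midway between [1 + exp (- k L2)] and [1 + exp (- k L1)]; finally
    [g] is made small, both against the least value of the exponential up to [Lr] and so that [Q^g]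
    is close to 1. *)
Lemma barrier_constants (np p1 X2 r Lr L1 L2 Q gmax : R) :
  0 < np -> 0 < p1 -> 0 <= X2 -> 0 < r -> 0 <= L1 -> L1 < L2 -> 1 <= Q -> 0 < gmax ->
  exists k B g : R,
  [/\ [/\ 0 < k, 0 < g < 1, g <= gmax & 1 < B < 2],
      forall d, r <= d <= Lr ->
        g * (B - expR (- k * d)) + k * expR (- k * d) * (X2 / 4) +
          2 * k * expR (- k * d) * np < 4 * p1 * k ^+ 2 * expR (- k * d) * d,
      forall d, d <= L1 -> B - expR (- k * d) <= 1 &
      forall d, L2 <= d -> Q `^ g <= B - expR (- k * d)].
Proof.
move=> np0 p10 X20 r0 L10 L12 Q1 gmax0.
pose a := 4 * p1 * r; have a0 : 0 < a by do 2!apply: mulr_gt0 => //.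
pose m := X2 / 4 + 2 * np; have m0 : 0 < m by rewrite /m; lra.
pose k := (m + 1) / a + 1.
have k1 : 1 <= k by rewrite /k lerDr divr_ge0 //; lra.
have k0 : 0 < k by lra.
have ak : m + 1 <= a * k.
  by rewrite /k mulrDr mulr1 mulrCA mulfV ?gt_eqF // mulr1; lra.
pose e1 := expR (- k * L1); pose e2 := expR (- k * L2).
have e20 : 0 < e2 by exact: expR_gt0.
have e21 : e2 < e1 by rewrite ltr_expR !mulNr ltrN2 ltr_pM2l.
have e11 : e1 <= 1 by rewrite -[leRHS]expR0 ler_expR mulNr oppr_le0 mulr_ge0 // ltW.
pose B := 1 + (e1 + e2) / 2.
pose de := (e1 - e2) / 2; have de0 : 0 < de by rewrite /de; lra.
pose em := expR (- k * Lr); have em0 : 0 < em by exact: expR_gt0.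
(* The added 1 keeps the denominator positive when [Q = 1]. *)
pose lq := ln (1 + de) / (ln Q + 1).
have lnQ : 0 <= ln Q by exact: ln_ge0.
have lq0 : 0 < lq by rewrite divr_gt0 ?ln_gt0 //; lra.
pose g := Num.min (Num.min gmax 2^-1) (Num.min (em / 4) lq).
have g0 : 0 < g by rewrite !lt_min gmax0 invr_gt0 lq0 !divr_gt0 // ltr0n.
have g_max : g <= gmax by rewrite !ge_min lexx.
have g_half : g <= 2^-1 by rewrite !ge_min lexx orbT.
have g_em : g <= em / 4 by rewrite !ge_min lexx !orbT.
have g_lq : g <= lq by rewrite !ge_min lexx !orbT.
have half : 2^-1 < 1 :> R by rewrite invf_lt1 ?ltr1n ?ltr0n.
have B2 : B < 2 by rewrite /B; lra.
exists k, B, g; split.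
- split=> //; first by rewrite g0; lra.
  by rewrite B2 andbT /B; lra.
- move=> d /andP[rd dL].
  set E := expR (- k * d); have E0 : 0 < E by exact: expR_gt0.
  have emE : em <= E by rewrite ler_expR !mulNr lerN2 ler_pM2l.
  have h1 : g * (B - E) < E.
    have : g * (B - E) <= g * B by rewrite ler_pM2l //; lra.
    have : g * B < g * 2 by rewrite ltr_pM2l.
    lra.
  have h2 : k * (m + 1) <= 4 * p1 * k ^+ 2 * d.
    have h : k * (m + 1) <= k * (a * k) by rewrite ler_pM2l.
    apply: le_trans h _; have -> : k * (a * k) = 4 * p1 * k ^+ 2 * r by rewrite /a; ring.
    by rewrite ler_wpM2l // ltW //; do 2!apply: mulr_gt0 => //; rewrite exprn_gt0.
  have h3 : E * (k * (m + 1)) <= E * (4 * p1 * k ^+ 2 * d) by rewrite ler_pM2l.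
  have h4 : E * 1 <= E * k by rewrite ler_pM2l.
  by rewrite /m in h3; lra.
- move=> d dL1; have : e1 <= expR (- k * d) by rewrite ler_expR !mulNr lerN2 ler_pM2l.
  by rewrite /B; lra.
- move=> d dL2; have h : expR (- k * d) <= e2 by rewrite ler_expR !mulNr lerN2 ler_pM2l.
  have h' : Q `^ g <= 1 + de.
    have Q0 : 0 < Q by lra.
    rewrite /powR gt_eqF // -[leRHS]lnK ?posrE; last by lra.
    rewrite ler_expR; apply: (@le_trans _ _ (g * (ln Q + 1))); first by rewrite ler_pM2l // lerDl.
    apply: (@le_trans _ _ (lq * (ln Q + 1))); first by rewrite ler_wpM2r //; lra.
    by rewrite /lq divfK // gt_eqF //; lra.
  by rewrite /B /de in h' *; lra.
Qed.

End Constants.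

(** * Gluing the two pieces along self-similar regions *)

Section Glue.
Context {R : realType} {n : nat}.
Notation X := ('rV[R]_n * R)%type.
Implicit Types (xi y : X) (xhat : 'rV[R]_n).

Lemma sqrt_gt0_sqr (s : R) : 0 < s -> Num.sqrt s ^+ 2 = s.
Proof. by move=> s0; rewrite sqr_sqrtr // ltW. Qed.

Lemma rescaled_sqdist_le xhat y (M : R) : 0 <= M -> past y ->
  dotv y.1 y.1 <= M ^+ 2 * (- y.2) -> rescaled_sqdist xhat y <= (M + enorm xhat) ^+ 2.
Proof.
move=> M0 py yM; rewrite rescaled_sqdistE //.
have s0 : 0 < - y.2 by move: py; rewrite /past /=; lra.
rewrite ler_pdivrMr // -enorm_sqr -{2}(sqrt_gt0_sqr (- y.2)) // -exprMn.
have hx : enorm y.1 <= M * Num.sqrt (- y.2).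
  rewrite -(@ler_pXn2r _ 2) ?nnegrE ?mulr_ge0 ?enorm_ge0 ?sqrtr_ge0 //.
  by rewrite enorm_sqr exprMn sqrt_gt0_sqr.
rewrite ler_pXn2r ?nnegrE ?mulr_ge0 ?addr_ge0 ?enorm_ge0 ?sqrtr_ge0 //.
apply: le_trans (ler_enormD _ _) _.
rewrite enormN enormZ ger0_norm ?sqrtr_ge0 //; lra.
Qed.

Lemma rescaled_sqdist_ge xhat y (M : R) : enorm xhat <= M -> past y ->
  M ^+ 2 * (- y.2) <= dotv y.1 y.1 -> (M - enorm xhat) ^+ 2 <= rescaled_sqdist xhat y.
Proof.
move=> M0 py yM; rewrite rescaled_sqdistE //.
have s0 : 0 < - y.2 by move: py; rewrite /past /=; lra.
rewrite ler_pdivlMr // -enorm_sqr -{1}(sqrt_gt0_sqr (- y.2)) // -exprMn.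
have hM : 0 <= M by apply: le_trans M0; exact: enorm_ge0.
have hx : M * Num.sqrt (- y.2) <= enorm y.1.
  rewrite -(@ler_pXn2r _ 2) ?nnegrE ?mulr_ge0 ?enorm_ge0 ?sqrtr_ge0 //.
  by rewrite enorm_sqr exprMn sqrt_gt0_sqr.
rewrite ler_pXn2r ?nnegrE ?mulr_ge0 ?subr_ge0 ?enorm_ge0 ?sqrtr_ge0 //.
have := ler_enormD (y.1 - Num.sqrt (- y.2) *: xhat) (Num.sqrt (- y.2) *: xhat).
rewrite subrK enormZ ger0_norm ?sqrtr_ge0 //; lra.
Qed.

(** Comparable, up to a factor two, with the square of the parabolic distance [|x| + sqrt |t|]. *)
Definition sqgauge y := dotv y.1 y.1 + `|y.2|.

Lemma sqgauge_ge0 y : 0 <= sqgauge y.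
Proof. by rewrite addr_ge0 ?dotv_ge0. Qed.

Lemma sqgauge_gt0 y : (0 < sqgauge y) = (y != origin).
Proof.
rewrite lt_def sqgauge_ge0 andbT; congr (~~ _).
rewrite paddr_eq0 ?dotv_ge0 // dotv_eq0 normr_eq0.
by apply/andP/eqP => [[/eqP e1 /eqP e2]|->]; [exact: injective_projections|rewrite !eqxx].
Qed.

Lemma ler_sqgauge_past y (a : R) : y.2 <= - a -> 0 <= a -> a <= sqgauge y.
Proof.
move=> ya a0; have := dotv_ge0 y.1; rewrite /sqgauge ler0_norm; last by lra.
by lra.
Qed.

Lemma ler_powR_nneg (a x y : R) : 0 <= a -> 0 <= x -> x <= y -> x `^ a <= y `^ a.
Proof.
by move=> a0 x0 xy; apply: ge0_ler_powR => //; rewrite nnegrE // (le_trans x0).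
Qed.

(** Distinguishing regions, instead of taking the minimum everywhere, keeps [inner] away from times
    [t >= 0] other than the origin, where its powers of [- t] are not meaningful. *)
Definition selfsimilar xhat (k B g A L L0 : R) y : R :=
  if parab (L0 ^+ 2) 0 y <= 0 then inner xhat k B g y
  else if 0 <= parab (L ^+ 2) 0 y then outer A 0 g y
  else Num.min (inner xhat k B g y) (outer A 0 g y).

Lemma parab_past (M : R) y : parab M 0 y <= 0 -> 0 < M -> y != origin -> past y.
Proof.
rewrite /parab addr0 => h M0; apply: contraNP => /negP; rewrite -leNgt => y0.
have hy := dotv_ge0 y.1; have hM : 0 <= M * y.2 by rewrite mulr_ge0 // ltW.
have e1 : dotv y.1 y.1 = 0 by lra.
have : M * y.2 = 0 by lra.
move/eqP; rewrite mulf_eq0 gt_eqF //= => /eqP e2.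
by apply/eqP; apply: injective_projections => //; apply/eqP; rewrite -dotv_eq0 e1.
Qed.

Lemma parab_antimono (M M' : R) y : M <= M' -> past y -> parab M' 0 y <= parab M 0 y.
Proof.
rewrite /parab /past /= !addr0 => MM y0; rewrite lerD2l.
by rewrite ler_wnM2r // ltW.
Qed.

Lemma parab_anti_lt (M M' : R) y : M < M' -> past y -> parab M' 0 y < parab M 0 y.
Proof. by rewrite /parab /past /= !addr0 => MM y0; rewrite ltrD2l ltr_nM2r. Qed.

Lemma parab_gt0_mono (M M' : R) y : 0 < M -> M <= M' ->
  0 < parab M' 0 y -> 0 < parab M 0 y.
Proof.
move=> M0 MM h; have [py|] := pselect (past y).
  exact: lt_le_trans h (parab_antimono _ _ _ MM py).
rewrite /past /= => /negP; rewrite -leNgt => y0.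
move: h; rewrite /parab !addr0 => h; have hy := dotv_ge0 y.1.
have [e|yn0] := eqVneq y.2 0; first by move: h; rewrite e !mulr0.
have : 0 < M * y.2 by rewrite mulr_gt0 // lt_def yn0.
lra.
Qed.

Lemma parab_gt0_future (M : R) y : 0 < M -> y != origin -> ~ past y -> 0 < parab M 0 y.
Proof.
move=> M0 yo py; rewrite ltNge; apply/negP => h; apply: py.
exact: parab_past h M0 yo.
Qed.

(** For [|x| <= L sqrt (- t)] the gauge lies between [- t] and [(L^2 + 1) (- t)], and the factor
    after the power lies between [B - 1] and [2]. *)
Lemma inner_bounds xhat (k B g L : R) y : 0 < k -> 0 < g -> 1 < B < 2 -> past y ->
  parab (L ^+ 2) 0 y <= 0 ->
  (B - 1) * ((L ^+ 2 + 1)^-1) `^ g * sqgauge y `^ g <= inner xhat k B g y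
    <= 2 * sqgauge y `^ g.
Proof.
move=> k0 g0 /andP[B1 B2] py h; have y0 : y.2 < 0 by [].
have s0 : 0 < - y.2 by lra.
have q0 : 0 <= rescaled_sqdist xhat y.
  by rewrite rescaled_sqdistE // divr_ge0 ?dotv_ge0 // ltW.
have E1 : expR (- k * rescaled_sqdist xhat y) <= 1.
  by rewrite -[leRHS]expR0 ler_expR mulNr oppr_le0 mulr_ge0 // ltW.
have E0 := expR_gt0 (- k * rescaled_sqdist xhat y).
have N0 := sqgauge_ge0 y.
have LL1 : 0 < L ^+ 2 + 1 by rewrite ltr_wpDl ?sqr_ge0.
have iLL1 : 0 <= (L ^+ 2 + 1)^-1 by rewrite invr_ge0 ltW.
rewrite /inner -mulrA -powRM //.
have h1 : ((L ^+ 2 + 1)^-1 * sqgauge y) `^ g <= (- y.2) `^ g.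
  apply: ler_powR_nneg; [exact: ltW|exact: mulr_ge0|].
  rewrite mulrC ler_pdivrMr // /sqgauge ltr0_norm //.
  by move: h; rewrite /parab addr0; lra.
have h2 : (- y.2) `^ g <= sqgauge y `^ g.
  apply: ler_powR_nneg; [exact: ltW|exact: ltW|].
  by rewrite /sqgauge ltr0_norm // lerDr dotv_ge0.
have p0 := powR_ge0 (- y.2) g.
apply/andP; split.
  by rewrite mulrC; apply: ler_pM => //; [exact: powR_ge0|lra|lra].
by rewrite [leRHS]mulrC; apply: ler_pM => //; lra.
Qed.

(** The lower bound amounts to [|x|^2 >= (2 A + 1) (- t)], which the radius [A + 1] guarantees at
    negative times. *)
Lemma outer_bounds (A g : R) y : 1 < A -> 0 < g -> 0 < parab ((A + 1) ^+ 2) 0 y ->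
  2^-1 `^ g * sqgauge y `^ g <= outer A 0 g y <= A `^ g * sqgauge y `^ g.
Proof.
move=> A1 g0 h; have N0 := sqgauge_ge0 y; have hy := dotv_ge0 y.1.
have Ap : 0 < A by lra.
have LA : A <= (A + 1) ^+ 2.
  by rewrite sqrrD expr1n mulr1; have := sqr_ge0 A; lra.
have hA := parab_gt0_mono _ _ _ Ap LA h.
rewrite -!powRM ?invr_ge0 //; last exact: ltW.
apply/andP; split; apply: ler_powR_nneg; rewrite ?(ltW g0) //.
- by rewrite mulr_ge0 // invr_ge0.
- rewrite /sqgauge /parab addr0; have [y0|y0] := lerP 0 y.2.
    by have := ler_wpM2r y0 (ltW A1); rewrite mul1r ger0_norm //; lra.
  rewrite ltr0_norm //; have : (2 * A + 1) * - y.2 <= (A + 1) ^+ 2 * - y.2.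
    rewrite ler_pM2r; last by lra.
    by rewrite sqrrD expr1n mulr1; have := sqr_ge0 A; lra.
  by move: h; rewrite /parab addr0; lra.
- exact: ltW.
- rewrite /sqgauge /parab addr0; have := ler_wpM2r hy (ltW A1).
  have : A * y.2 <= A * `|y.2| by rewrite ler_pM2l // ler_norm.
  by lra.
Qed.

(* The radii [L0 < L0 + 1 < L - 1 < L] are measured in units of [sqrt (- t)]:
   [inner] is the smaller function between the first two of them, [outer]
   between the last two. *)
Lemma selfsimilar_barrier (p : R) xhat (r gmax : R) : (0 < n)%N -> 1 < p ->
  0 < r -> 0 < gmax -> exists (w : X -> R) (g c C : R),
  [/\ [/\ 0 < g, g <= gmax, 0 < c & 0 < C],
      forall xi, xi != origin -> (past xi -> r <= rescaled_sqdist xhat xi) ->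
        local_barrier p w xi &
      forall y, y != origin -> c * sqgauge y `^ g <= w y <= C * sqgauge y `^ g].
Proof.
move=> n0 p1 r0 gmax0.
have np : 0 < n%:R + p - 2 :> R.
  have : 1 <= n%:R :> R by rewrite ler1n.
  lra.
have x0 : 0 <= enorm xhat := enorm_ge0 xhat.
have [A [L [[A1 An Lx LL] [L0A L01 L0L L1]]]] : exists A L : R,
    [/\ 1 < A, 2 * (n%:R + p - 2) < A, enorm xhat < L - 1 &
        A + 2 + enorm xhat < L - 1 - enorm xhat] /\
    [/\ A + 1 <= (A + 1) ^+ 2, (A + 1) ^+ 2 < (A + 2) ^+ 2,
      (A + 2) ^+ 2 < (L - 1) ^+ 2 & (L - 1) ^+ 2 < L ^+ 2].
  (* [A] is large enough for [outer]. [L] is such that the rescaled distance to the curve is larger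
     at radius [L - 1] than at radius [A + 2], whatever the direction of [x]. *)
  pose A := 2 * (n%:R + p - 2) + 1; pose L := A + 2 * enorm xhat + 4.
  have A1 : 1 < A by rewrite /A; lra.
  have An : 2 * (n%:R + p - 2) < A by rewrite /A; lra.
  exists A, L; split; split; rewrite ?ltr_pXn2r ?nnegrE //; try by rewrite /L; lra.
  by rewrite expr2 -[leLHS]mulr1 ler_pM2l; lra.
have [||||||||k [B [g [[k0 /andP[g0 g1] gm B12] slack low high]]]] :=
  barrier_constants (n%:R + p - 2) (p - 1) (dotv xhat xhat) r ((L + enorm xhat) ^+ 2)
    ((A + 2 + enorm xhat) ^+ 2) ((L - 1 - enorm xhat) ^+ 2) (L ^+ 2 - A) gmax => //.
- by lra.
- exact: dotv_ge0.
- exact: sqr_ge0.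
- by rewrite ltr_pXn2r ?nnegrE //; lra.
- by lra.
have Ap : 0 < A by lra.
have L0p : 0 < (A + 1) ^+ 2 by rewrite exprn_gt0 //; lra.
have L0sq : (A + 1) ^+ 2 <= L ^+ 2 by apply: ltW; apply: lt_trans L1; exact: lt_trans L0L.
have A_L0 : A <= (A + 1) ^+ 2 by lra.
have A_L1 : A <= (L - 1) ^+ 2 by apply: le_trans A_L0 _; apply: ltW; exact: lt_trans L0L.
pose wi := inner xhat k B g; pose wo := outer A 0 g : X -> R.
pose w := selfsimilar xhat k B g A L (A + 1).
(* With [s = - t], the two pieces are compared through powers of [s]: [inner <= s^g <= outer]
   between the radii [A + 1] and [A + 2], and [outer <= ((L^2 - A) s)^g <= inner] between [L - 1]
   and [L]. This is the origin of the constant [Q = L^2 - A]. *)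
have wi_le y : past y -> parab ((A + 2) ^+ 2) 0 y <= 0 -> wi y <= (- y.2) `^ g.
  rewrite /parab addr0 => py h; rewrite /wi /inner -[leRHS]mulr1 ler_wpM2l ?powR_ge0 //.
  by apply: low; apply: rescaled_sqdist_le => //; [lra|rewrite mulrN; lra].
have wi_ge y : past y -> 0 <= parab ((L - 1) ^+ 2) 0 y ->
    (- y.2) `^ g * (L ^+ 2 - A) `^ g <= wi y.
  rewrite /parab addr0 => py h; rewrite /wi /inner ler_wpM2l ?powR_ge0 //.
  by apply: high; apply: rescaled_sqdist_ge => //; [exact: ltW|rewrite mulrN; lra].
have wo_ge y : past y -> 0 <= parab ((A + 1) ^+ 2) 0 y -> (- y.2) `^ g <= wo y.
  rewrite /parab addr0 /past /= => py h; apply: ler_powR_nneg; [exact: ltW|lra|].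
  have : (A + 1) * - y.2 <= (A + 1) ^+ 2 * - y.2 by rewrite ler_pM2r //; lra.
  by rewrite /parab addr0; lra.
have wo_le y : past y -> parab (L ^+ 2) 0 y <= 0 -> 0 <= parab A 0 y ->
    wo y <= (- y.2) `^ g * (L ^+ 2 - A) `^ g.
  rewrite /parab addr0 /past /= => py h h'; have LA : 0 <= L ^+ 2 - A.
    by rewrite subr_ge0 (le_trans A_L0).
  have s0 : 0 <= - y.2 by rewrite oppr_ge0 ltW.
  rewrite -powRM //; apply: ler_powR_nneg; [exact: ltW|by rewrite /parab addr0|].
  by rewrite /parab addr0; lra.
have wi_barrier xi : past xi -> parab (L ^+ 2) 0 xi <= 0 -> r <= rescaled_sqdist xhat xi ->
    local_barrier p wi xi.
  move=> pxi h rx; apply: inner_local_barrier => //; apply: slack; rewrite rx /=.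
  apply: rescaled_sqdist_le => //; first by lra.
  by move: h; rewrite /parab addr0 mulrN; lra.
have wo_barrier xi : 0 < parab A 0 xi -> local_barrier p wo xi.
  by move=> h; apply: outer_local_barrier => //; rewrite g0 g1.
have wi_bounds y (py : past y) (h : parab (L ^+ 2) 0 y <= 0) :=
  inner_bounds xhat k B g L y k0 g0 B12 py h.
have wo_bounds y (h : 0 < parab ((A + 1) ^+ 2) 0 y) := outer_bounds A g y A1 g0 h.
pose b := (B - 1) * ((L ^+ 2 + 1)^-1) `^ g.
pose c := Num.min b (2^-1 `^ g).
pose C := 2 + A `^ g.
have A0 := powR_ge0 A g.
have b0 : 0 < b.
  apply: mulr_gt0; first by case/andP: B12; lra.
  by apply: powR_gt0; rewrite invr_gt0 ltr_wpDl ?sqr_ge0.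
exists w, g, c, C; split.
- split=> //; last by rewrite ltr_pwDl.
  by rewrite lt_min b0 powR_gt0 ?invr_gt0.
- move=> xi xi0 tusk_xi.
  have [h0|h0] := leP (parab ((A + 1) ^+ 2) 0 xi) 0.
    have pxi : past xi := parab_past _ _ h0 L0p xi0.
    have hL : parab (L ^+ 2) 0 xi <= 0 by apply: le_trans (parab_antimono _ _ _ L0sq pxi) h0.
    apply: local_barrier_near (wi_barrier xi pxi hL (tusk_xi pxi)) _.
    have n1 : \forall y \near xi, past y by exact: open_nbhs_nbhs (conj open_past pxi).
    have n2 : \forall y \near xi, parab ((A + 2) ^+ 2) 0 y < 0.
      apply: (open_nbhs_nbhs (conj (open_parab_lt0 _ _) _)) => /=.
      exact: lt_le_trans (parab_anti_lt _ _ _ L01 pxi) h0.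
    near=> y; have py : past y by near: y.
    have hy : parab ((A + 2) ^+ 2) 0 y < 0 by near: y.
    rewrite /w /selfsimilar; case: ifPn => //; rewrite -ltNge => h1.
    have -> : 0 <= parab (L ^+ 2) 0 y = false.
      apply/negbTE; rewrite -ltNge; apply: le_lt_trans (parab_antimono _ _ _ _ py) hy.
      by apply: ltW; exact: lt_trans L0L L1.
    by apply: min_l; apply: le_trans (wi_le y py (ltW hy)) (wo_ge y py (ltW h1)).
  have hA : 0 < parab A 0 xi by exact: parab_gt0_mono h0.
  have [hL|hL] := leP 0 (parab (L ^+ 2) 0 xi).
    apply: local_barrier_near (wo_barrier xi hA) _.
    have n2 : \forall y \near xi, 0 < parab ((L - 1) ^+ 2) 0 y.
      apply: (open_nbhs_nbhs (conj (open_parab_gt0 _ _) _)) => /=.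
      have [py|py] := pselect (past xi).
        exact: le_lt_trans hL (parab_anti_lt _ _ _ L1 py).
      apply: parab_gt0_future => //; exact: lt_le_trans A_L1.
    near=> y; have hy : 0 < parab ((L - 1) ^+ 2) 0 y by near: y.
    rewrite /w /selfsimilar.
    have -> : parab ((A + 1) ^+ 2) 0 y <= 0 = false.
      apply/negbTE; rewrite -ltNge; apply: parab_gt0_mono hy => //.
      by apply: ltW; exact: lt_trans L0L.
    case: ifPn => //; rewrite -ltNge => h1.
    have py : past y.
      apply: contrapT => py; have yo : y != origin.
        apply/eqP => e; move: hy; rewrite e /parab /= dotv0l addr0 mulr0 addr0.
        by rewrite ltxx.
      have := parab_gt0_future (L ^+ 2) y _ yo py.
      by move=> /(_ (lt_le_trans L0p L0sq)) /lt_trans /(_ h1); rewrite ltxx.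
    apply: min_r; apply: le_trans (wo_le y py (ltW h1) _) (wi_ge y py (ltW hy)).
    by apply: ltW; exact: parab_gt0_mono hy.
  have pxi : past xi by apply: parab_past (ltW hL) _ xi0; exact: lt_le_trans L0sq.
  apply: local_barrier_near (local_barrier_min _ _ _ _
    (wi_barrier xi pxi (ltW hL) (tusk_xi pxi)) (wo_barrier xi hA)) _.
  have n1 : \forall y \near xi, 0 < parab ((A + 1) ^+ 2) 0 y.
    exact: (open_nbhs_nbhs (conj (open_parab_gt0 _ _) h0)).
  have n2 : \forall y \near xi, parab (L ^+ 2) 0 y < 0.
    exact: (open_nbhs_nbhs (conj (open_parab_lt0 _ _) hL)).
  near=> y; rewrite /w /selfsimilar.
  have -> : parab ((A + 1) ^+ 2) 0 y <= 0 = false.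
    by apply/negbTE; rewrite -ltNge; near: y.
  have -> // : 0 <= parab (L ^+ 2) 0 y = false.
  by apply/negbTE; rewrite -ltNge; near: y.
- move=> y yo; have t0 := powR_ge0 (sqgauge y) g.
  have c1 : c * sqgauge y `^ g <= b * sqgauge y `^ g by rewrite ler_wpM2r // ge_min lexx.
  have c2 : c * sqgauge y `^ g <= 2^-1 `^ g * sqgauge y `^ g.
    by rewrite ler_wpM2r // ge_min lexx orbT.
  have C1 : 2 * sqgauge y `^ g <= C * sqgauge y `^ g by rewrite ler_wpM2r // lerDl.
  have C2 : A `^ g * sqgauge y `^ g <= C * sqgauge y `^ g by rewrite ler_wpM2r // lerDr.
  have bi (py : past y) (h : parab (L ^+ 2) 0 y <= 0) :
      c * sqgauge y `^ g <= wi y <= C * sqgauge y `^ g.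
    have /andP[h1 h2] := wi_bounds y py h.
    by rewrite (le_trans c1 h1) (le_trans h2 C1).
  have bo (h : 0 < parab ((A + 1) ^+ 2) 0 y) :
      c * sqgauge y `^ g <= wo y <= C * sqgauge y `^ g.
    have /andP[h1 h2] := wo_bounds y h.
    by rewrite (le_trans c2 h1) (le_trans h2 C2).
  rewrite /w /selfsimilar; case: ifPn => h0.
    have py : past y := parab_past _ _ h0 L0p yo.
    by apply: bi => //; apply: le_trans (parab_antimono _ _ _ L0sq py) h0.
  rewrite -ltNge in h0.
  case: ifPn => h1; first exact: bo.
  rewrite -ltNge in h1.
  have py : past y by apply: parab_past (ltW h1) _ yo; exact: lt_le_trans L0sq.
  by rewrite /Num.min; case: ifP => _; [exact: bi (ltW h1)|exact: bo].
Unshelve. all: by end_near. Qed.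

End Glue.

(** * The barrier on a bounded set with the tusk condition *)

Section TuskBarrier.
Context {R : realType} {n : nat}.
Notation X := ('rV[R]_n * R)%type.
Implicit Types (xi y : X) (xhat : 'rV[R]_n) (Theta : set X).

Lemma bounded_closure_cbox Theta : bounded_set Theta -> exists2 M : R, 0 <= M &
  closure Theta `<=` cbox (const_mx (- M)) (const_mx M) (- M) M.
Proof.
move=> [M0 [_ hM]]; pose M := Num.max 0 (M0 + 1).
have MM : M0 < M by rewrite lt_max ltrDl ltr01 orbT.
exists M; first by rewrite le_max lexx.
have /closure_id -> := closed_cbox (const_mx (- M) : 'rV[R]_n) (const_mx M) (- M) M.
apply: closure_subset => y /(hM _ MM) hy.
have h1 : `|y.1| <= M by apply: le_trans hy; rewrite prod_normE le_max lexx.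
have h2 : `|y.2| <= M by apply: le_trans hy; rewrite prod_normE le_max lexx orbT.
split=> [i|]; last by rewrite -ler_norml.
rewrite !mxE -ler_norml; apply: le_trans h1.
rewrite [leRHS]/Num.norm /= mx_normrE; apply/bigmax_geP; right => /=.
by exists (ord0, i).
Qed.

Lemma cbox_sqdist_le (M : R) y : 0 <= M ->
  cbox (const_mx (- M)) (const_mx M) (- M) M y -> dotv y.1 y.1 <= n%:R * M ^+ 2.
Proof.
move=> M0 [h _]; rewrite /dotv -[n in leRHS]card_ord mulr_natl -sumr_const.
apply: ler_sum => i _; rewrite -expr2 -real_normK ?num_real // ler_sqr ?nnegrE //.
by have := h i; rewrite !mxE -ler_norml.
Qed.

Lemma rescaled_sqdist_near xhat xi (r : R) : past xi -> rescaled_sqdist xhat xi < r ->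
  \forall y \near xi, rescaled_sqdist xhat y < r.
Proof.
(* For [k = -1] and [B = g = 0] the function [inner] is [- exp (rescaled_sqdist)], so its continuity
   gives the claim. *)
move=> pxi rxi; have [f1 [f2 [sf _]]] := smooth2_inner xhat (-1) 0 0.
have [c _ _ _ _] := sf xi pxi.
have E y : inner xhat (-1) 0 0 y = - expR (rescaled_sqdist xhat y).
  by rewrite /inner powRr0 opprK !mul1r sub0r.
have : - expR r < inner xhat (-1) 0 0 xi by rewrite E ltrN2 ltr_expR.
by move/cvgr_gt : c => /[apply]; apply: filterS => y; rewrite E ltrN2 ltr_expR.
Qed.

(** The tusk is open, so a point of it in the closure of [Theta] would have points of [Theta] in the
    tusk nearby. *)
Lemma tusk_closure Theta xhat (r T : R) xi : 0 < r -> tusk xhat r T `<=` ~` Theta ->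
  closure Theta xi -> - T < xi.2 -> past xi -> r ^+ 2 <= rescaled_sqdist xhat xi.
Proof.
move=> r0 tT cxi Txi pxi; rewrite leNgt; apply/negP => lt_r.
have n1 := rescaled_sqdist_near xhat xi _ pxi lt_r.
have n2 : \forall y \near xi, past y by exact: open_nbhs_nbhs (conj open_past pxi).
have n3 : \forall y \near xi, - T < y.2.
  have : {for xi, continuous (snd : X -> R)} by exact: cvg_snd.
  by move/cvgr_gt; apply.
have [y [Ty [h1 [h2 h3]]]] := cxi _ (filterI n1 (filterI n2 n3)).
apply: (tT y) Ty; split; first by rewrite h3.
have s0 : 0 < - y.2 by move: h2; rewrite /past /=; lra.
by rewrite enorm_sqr -ltr_pdivrMr // -rescaled_sqdistE.
Qed.

(** The bound [gmax] serves the Hölder statement, where the barrier has to dominate a prescribed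
    power of the gauge near the origin. *)
Lemma tusk_barrier (p gmax : R) Theta : (0 < n)%N -> 1 < p -> bounded_set Theta ->
  tusk_condition Theta -> 0 < gmax -> exists (W : X -> R) (g c C D : R),
  [/\ [/\ 0 < g, g <= gmax, 0 < c, 0 < C & 0 < D],
      forall xi, closure Theta xi -> xi != origin -> local_barrier p W xi,
      forall y, closure Theta y -> y != origin ->
        c * sqgauge y `^ g <= W y <= C * sqgauge y `^ g &
      forall y, closure Theta y -> sqgauge y <= D].
Proof.
move=> n0 p1 bT [xhat [r [T [r0 T0 tT]]]] gmax0.
have np : 0 < n%:R + p - 2 :> R.
  have : 1 <= n%:R :> R by rewrite ler1n.
  lra.
have [w [g [c [C [[g0 gm c0 C0] wb wcC]]]]] :=
  selfsimilar_barrier p xhat (r ^+ 2) gmax n0 p1 (exprn_gt0 2 r0) gmax0.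
have [M M0 TM] := bounded_closure_cbox Theta bT.
pose A := 2 * (n%:R + p - 2) + 1.
have A1 : 1 < A by rewrite /A; lra.
(* The shift by [M + 1] makes [parab] at least 1 on the closure of [Theta], so that [V] is a barrier
   there with values between 1 and [Q]. *)
pose V := outer A (M + 1) 2^-1 : X -> R.
pose S := n%:R * M ^+ 2.
have S0 : 0 <= S by rewrite mulr_ge0 ?sqr_ge0.
pose Q := (S + A * (2 * M + 1)) `^ 2^-1.
have par y : closure Theta y -> 1 <= parab A (M + 1) y <= S + A * (2 * M + 1).
  move=> /TM hy; have h1 := cbox_sqdist_le M y M0 hy; have h2 := dotv_ge0 y.1.
  have [_ /andP[h3 h4]] := hy.
  have h5 : A * 1 <= A * (y.2 + (M + 1)) by rewrite ler_pM2l; lra.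
  have h6 : A * (y.2 + (M + 1)) <= A * (2 * M + 1) by rewrite ler_pM2l; lra.
  by rewrite /parab; apply/andP; split; rewrite /S in h1 *; lra.
have V1 y : closure Theta y -> 1 <= V y <= Q.
  move=> /par /andP[h1 h2]; apply/andP; split; last by apply: ler_powR_nneg; lra.
  have -> : 1 = 1 `^ 2^-1 :> R by rewrite powR1.
  by apply: ler_powR_nneg; lra.
have Q0 : 0 <= Q := powR_ge0 _ _.
have Vb y : closure Theta y -> local_barrier p V y.
  move=> /par /andP[h1 h2]; apply: outer_local_barrier => //.
  - by rewrite invr_gt0 ltr0n invf_lt1 ?ltr1n ?ltr0n.
  - by rewrite /A; lra.
  - lra.
(* For [t < - T / 4] the gauge is at least [T / 4], so this factor lifts [C1 w] to at least [Q + 1],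
   above [V]. The minimum is then [V] on both sides of the switching time [- T / 2]. *)
pose C1 := (Q + 1) / (c * (T / 4) `^ g).
have T4 : 0 < T / 4 by lra.
have cT : 0 < c * (T / 4) `^ g by rewrite mulr_gt0 ?powR_gt0.
have C10 : 0 < C1 by rewrite divr_gt0 //; lra.
have C1w y : y.2 < - (T / 4) -> Q + 1 <= C1 * w y.
  move=> yT; have yo : y != origin.
    by apply/eqP => e; move: yT; rewrite e /=; lra.
  have /andP[h _] := wcC y yo.
  have h1 : c * (T / 4) `^ g <= w y.
    apply: le_trans h; rewrite ler_pM2l //; apply: ler_powR_nneg; [exact: ltW|exact: ltW|].
    by apply: ler_sqgauge_past; exact: ltW.
  have -> : Q + 1 = C1 * (c * (T / 4) `^ g) by rewrite /C1 divfK // gt_eqF.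
  by rewrite ler_pM2l.
(* [w] is a barrier only as long as the tusk lasts; at earlier times, and far
   from the origin, [V] takes over. *)
pose W y := if y.2 <= - (T / 2) then V y else Num.min (C1 * w y + 0) (V y).
pose D := S + M + 1.
have D0 : 0 < D by rewrite /D; lra.
have Dy y : closure Theta y -> sqgauge y <= D.
  move=> /TM hy; have h1 := cbox_sqdist_le M y M0 hy.
  have [_ h2] := hy; rewrite -ler_norml in h2.
  by rewrite /sqgauge /D /S; lra.
pose c' := Num.min (C1 * c) (D `^ g)^-1.
have Dg : 0 < D `^ g by exact: powR_gt0.
have T2 : 0 < T / 2 by lra.
have Tg : 0 < (T / 2) `^ g by exact: powR_gt0.
pose C' := C1 * C + Q / (T / 2) `^ g.
have QT : 0 <= Q / (T / 2) `^ g by rewrite divr_ge0 // ltW.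
have C1C : 0 < C1 * C by exact: mulr_gt0.
exists W, g, c', C', D; split=> //.
- split=> //; last by rewrite ltr_pwDl.
  by rewrite lt_min mulr_gt0 // invr_gt0.
- move=> xi cxi xi0; have [xT|xT] := leP xi.2 (- (T / 2)).
    apply: local_barrier_near (Vb xi cxi) _.
    have n1 : \forall y \near xi, y.2 < - (T / 4).
      have : {for xi, continuous (snd : X -> R)} by exact: cvg_snd.
      by move/cvgr_lt; apply; rewrite /=; lra.
    have n2 : \forall y \near xi, V y < Q + 1.
      have [Vc _] := Vb xi cxi; move/cvgr_lt : Vc; apply.
      by have /andP[_] := V1 xi cxi; rewrite /=; lra.
    near=> y; rewrite /W; case: ifP => // _; apply: min_r.
    have h1 : V y < Q + 1 by near: y.
    have h2 : Q + 1 <= C1 * w y by apply: C1w; near: y.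
    by rewrite addr0; apply: le_trans h2; exact: ltW.
  have wbx : local_barrier p w xi.
    apply: wb => // pxi; apply: (tusk_closure Theta xhat r T) => //; lra.
  apply: local_barrier_near (local_barrier_min _ _ _ _
    (local_barrier_affine _ _ _ C1 0 C10 wbx) (Vb xi cxi)) _.
  have n1 : \forall y \near xi, - (T / 2) < y.2.
    have : {for xi, continuous (snd : X -> R)} by exact: cvg_snd.
    by move/cvgr_gt; apply.
  near=> y; rewrite /W ifF //; apply/negbTE; rewrite -ltNge; near: y; exact: n1.
- move=> y cy yo; have /andP[w1 w2] := wcC y yo; have /andP[v1 v2] := V1 y cy.
  have t0 := powR_ge0 (sqgauge y) g.
  have lowV : c' * sqgauge y `^ g <= V y.
    apply: le_trans v1; apply: (@le_trans _ _ ((D `^ g)^-1 * sqgauge y `^ g)).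
      by rewrite ler_wpM2r // ge_min lexx orbT.
    rewrite mulrC ler_pdivrMr // mul1r; apply: ler_powR_nneg; [exact: ltW| |exact: Dy].
    exact: sqgauge_ge0.
  have loww : c' * sqgauge y `^ g <= C1 * w y.
    apply: (@le_trans _ _ (C1 * c * sqgauge y `^ g)).
      by rewrite ler_wpM2r // ge_min lexx.
    by rewrite -mulrA ler_pM2l.
  have upw : C1 * w y <= C' * sqgauge y `^ g.
    apply: (@le_trans _ _ (C1 * C * sqgauge y `^ g)); first by rewrite -mulrA ler_pM2l.
    by rewrite ler_wpM2r // lerDl.
  rewrite /W; case: ifP => yT.
    rewrite lowV /=; apply: le_trans v2 _.
    apply: (@le_trans _ _ (Q / (T / 2) `^ g * sqgauge y `^ g)); last first.
      by rewrite ler_wpM2r // lerDr ltW.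
    rewrite mulrAC ler_pdivlMr // ler_wpM2l //.
    apply: ler_powR_nneg; [exact: ltW|exact: ltW|].
    by apply: ler_sqgauge_past => //; exact: ltW.
  by rewrite addr0 le_min loww lowV /= ge_min upw.
Unshelve. all: by end_near. Qed.

End TuskBarrier.

(** * Two-sided bounds for the Perron solution *)

Section Perron.
Context {R : realType} {n : nat}.
Notation X := ('rV[R]_n * R)%type.
Implicit Types (xi y zeta : X) (Theta : set X) (W : X -> R) (u : X -> \bar R).

Lemma le_limf_einf (F : set_system X) u (a : R) :
  F [set y | (a%:E <= u y)%E] -> (a%:E <= limf_einf u F)%E.
Proof.
move=> Fa; rewrite limf_einfE; apply: le_ereal_sup_tmp.
exists (ereal_inf (u @` [set y | (a%:E <= u y)%E])); first by exists [set y | (a%:E <= u y)%E].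
by apply: le_ereal_inf_tmp => _ [y /= h <-].
Qed.

Lemma limf_einf_gt (F : set_system X) u (a : R) : Filter F ->
  (a%:E < limf_einf u F)%E -> F [set y | (a%:E < u y)%E].
Proof.
move=> FF; rewrite limf_einfE => /ereal_sup_gt [_ [V FV <-]] h.
apply: filterS FV => y Vy /=; apply: lt_le_trans h _.
by apply: ereal_inf_lbound; exists y.
Qed.

Lemma superparabolic_lsc p Theta u xi (a : R) : open Theta -> superparabolic p Theta u ->
  Theta xi -> (a%:E < u xi)%E -> \forall y \near xi, (a%:E < u y)%E.
Proof.
move=> oT [[_ lsc _] _] Txi au.
have [V nV hV] := lsc xi a au.
have ix : Theta° (xi : X) by exact: open_nbhs_nbhs.
by move: nV; rewrite -(nbhs_subspace_interior ix); apply: filterS.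
Qed.

Lemma compact_closure_bounded Theta : bounded_set Theta -> compact (closure Theta).
Proof.
move=> bT; have [M M0 TM] := bounded_closure_cbox Theta bT.
apply: subclosed_compact (compact_cbox _ _ _ _) TM; exact: closed_closure.
Qed.

Section Estimate.
Variables (p : R) (Theta : set X) (f W : X -> R) (K e : R).
Hypotheses (n0 : (0 < n)%N) (p1 : 1 < p) (oT : open Theta) (bT : bounded_set Theta).
Hypothesis Torigin : boundary Theta origin.
Hypothesis WB : forall xi, closure Theta xi -> xi != origin -> local_barrier p W xi.
Hypothesis W0 : forall xi, closure Theta xi -> xi != origin -> 0 <= W xi.
Hypotheses (K0 : 0 < K) (e0 : 0 <= e).
Hypothesis fW : forall zeta, boundary Theta zeta -> zeta != origin ->
  `|f zeta - f origin| <= K * W zeta + e.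

Let T_origin xi : Theta xi -> xi != origin.
Proof.
move=> Txi; apply/eqP => exi; case: Torigin => _; apply; rewrite -exi.
exact: open_nbhs_nbhs.
Qed.

Let T_closure : Theta `<=` closure Theta.
Proof. exact: subset_closure. Qed.

(** The function on the right is itself a competitor in the infimum. *)
Lemma upper_perron_le xi : Theta xi ->
  (upper_perron p Theta f xi <= (f origin + (K * W xi + e))%:E)%E.
Proof.
move=> Txi; apply: ereal_inf_lbound.
exists (EFin \o (fun y => K * W y + (f origin + e))); last by rewrite /= addrCA.
split.
  apply: strict_superjet_superparabolic => // y Ty.
  by apply: local_barrier_affine => //; apply: WB; [exact: T_closure|exact: T_origin].
(* [W] is a barrier only away from the origin; at the origin the lower limit is bounded by means of
   [W >= 0] on [Theta]. *)
move=> zeta bz; have [zo|zo] := eqVneq zeta origin.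
  apply: le_limf_einf; rewrite zo; apply: filterS (withinT _ _) => y Ty /=.
  have := W0 _ (T_closure _ Ty) (T_origin _ Ty).
  by rewrite lee_fin => h; have := mulr_ge0 (ltW K0) h; have := e0; lra.
apply/lee_addgt0Pr => d d0; rewrite -leeBlDr // -EFinB.
have [c _] := local_barrier_affine p W zeta K (f origin + e) K0 (WB _ bz.1 zo).
apply: le_limf_einf.
have h : f zeta - d < K * W zeta + (f origin + e).
  by have := fW _ bz zo; rewrite ler_norml => /andP[_]; lra.
have n1 : \forall y \near zeta, f zeta - d < K * W y + (f origin + e).
  by move/cvgr_gt : c; apply.
by apply: filterS n1 => y /= h1 _; rewrite lee_fin ltW.
Qed.

(** If the infimum of [u - v] over [Theta] is negative, take a cluster point [z] of its sublevel
    sets. For [z] in [Theta], semicontinuity makes it a minimum point, where the inverted paraboloid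
    of [W] touches [u] from below. For [z] on the boundary, the boundary values of [u] and [v] are
    in the wrong order. *)
Lemma superparabolic_ge u xi : superparabolic p Theta u ->
  (forall zeta, boundary Theta zeta ->
     ((f zeta)%:E <= limf_einf u (within Theta (nbhs zeta)))%E) ->
  Theta xi -> ((f origin - (K * W xi + e))%:E <= u xi)%E.
Proof.
move=> su fu Txi.
pose v y := f origin - (K * W y + e).
pose d y := (u y - (v y)%:E)%E.
rewrite leNgt; apply/negP => lt_v.
have d_xi : (d xi < 0)%E.
  move: lt_v; rewrite /d -/(v xi); case: (u xi) => [s| |] //=.
    by rewrite -EFinB !lte_fin; lra.
  by rewrite addNye.
pose m := ereal_inf (d @` Theta).
have m0 : (m < 0)%E by apply: le_lt_trans d_xi; apply: ereal_inf_lbound; exists xi.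
have m_le y : Theta y -> (m <= d y)%E by move=> Ty; apply: ereal_inf_lbound; exists y.
(* The levels above [m] give a filter whether [m] is finite or [-oo]; its cluster point replaces the
   limit of a minimizing sequence. *)
pose I := [set t : R | (m < t%:E)%E].
pose S t := [set y | Theta y /\ (d y < t%:E)%E].
have I0 : I 0 by exact: m0.
have FF : Filter (filter_from I S).
  apply: filter_from_filter; first by exists 0.
  move=> i j Ii Ij; exists (Num.min i j).
    by rewrite /I /= EFin_min lt_min Ii Ij.
  by move=> y [Ty]; rewrite EFin_min lt_min => /andP[? ?]; split; split.
have PF : ProperFilter (filter_from I S).
  apply: filter_from_proper => t It.
  by have [_ [y Ty <-] dy] := ereal_inf_lt It; exists y.
have [|z [cz clz]] := compact_closure_bounded _ bT _ PF.
  by exists 0 => // y [/T_closure].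
have v_near : z != origin -> forall a : R, 0 < a -> \forall y \near z, v y < v z + a.
  move=> zo a a0; have [c _] := local_barrier_affine p W z K 0 K0 (WB _ cz zo).
  have : K * W z + 0 - a < K * W z + 0 by lra.
  by move/cvgr_gt : c => /[apply]; apply: filterS => y; rewrite /v; lra.
have [Tz|nTz] := pselect (Theta z).
  have zo := T_origin _ Tz.
  have d_lsc (a : R) : (a%:E < d z)%E -> \forall y \near z, (a%:E < d y)%E.
    move=> adz.
    have [b /andP[ab bz]] : exists b : R, (a < b) && ((b + v z)%:E < u z)%E.
      move: adz; rewrite /d; case: (u z) => [s||] //=; last by exists (a + 1); rewrite ltrDl ltr01 ltry.
      rewrite -EFinB lte_fin => h; exists ((a + (s - v z)) / 2); rewrite lte_fin.
      by apply/andP; split; lra.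
    have n1 := superparabolic_lsc p Theta u z _ oT su Tz bz.
    have n2 := v_near zo (b - a) ltac:(lra).
    apply: filterS2 n1 n2 => y; rewrite /d; case: (u y) => [s| |] h1 h2.
    - by rewrite -EFinB lte_fin; move: h1; rewrite lte_fin; lra.
    - by rewrite addye // ltry.
    - by move: h1; rewrite ltNge leNye.
  have dz_m : (d z <= m)%E.
    rewrite leNgt; apply/negP => mdz.
    have [t /andP[mt td]] : exists t : R, (m < t%:E)%E && (t%:E < d z)%E.
      move: mdz m0; case: (m) => [s| |] //=; case: (d z) => [s'| |] //=; rewrite ?lte_fin.
      - by move=> h _; exists ((s + s') / 2); rewrite !lte_fin; apply/andP; split; lra.
      - by move=> _ _; exists (s + 1); rewrite lte_fin ltry ltrDl ltr01.
      - by move=> _ _; exists (s' - 1); rewrite lte_fin ltNyr ltrBlDr ltrDl ltr01.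
      - by move=> _ _; exists 0; rewrite ltNyr ltry.
    have FS : filter_from I S (S t) by exists t.
    have [y [[_ h1] h2]] := clz _ _ FS (d_lsc t td).
    by move: (lt_trans h1 h2); rewrite ltxx.
  have uz_fin : u z \is a fin_num.
    rewrite fin_numE; case: su => -[/(_ _ Tz) -> _ _] _ /=.
    apply/eqP => uz; move: (le_lt_trans dz_m m0); rewrite /d uz.
    by rewrite addye // ltNge leey.
  have [W_c [b [q [beta [k [N [beta0 k0 slack W_le]]]]]]] :=
    local_barrier_affine p W z K 0 K0 (WB _ cz zo).
  apply: (superparabolic_no_touching p Theta u z (fine (u z)) b beta k N q) => //.
    by rewrite fineK.
  have nT : \forall y \near z, Theta y by exact: open_nbhs_nbhs.
  apply: filterS2 nT W_le => y Ty Wy.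
  have : (d z <= d y)%E by apply: le_trans dz_m (m_le y Ty).
  rewrite /d -(fineK uz_fin); move: (fine (u z)) => c; case: (u y) => [s| |] //=.
    by rewrite -!EFinB !lee_fin /v; lra.
  by move=> _; rewrite leey.
(* Near [z] the function [u] exceeds [f z + t / 2] and [v] is below [f z - t / 2], so [d > t],
   against [d < t] on [S t]. *)
have bz : boundary Theta z by split=> // /interior_subset.
have [t /andP[mt t0]] : exists t : R, (m < t%:E)%E && (t < 0).
  move: m0; case: (m) => [s| |] //=; rewrite ?lte_fin.
    by move=> h; exists (s / 2); rewrite !lte_fin; apply/andP; split; lra.
  by move=> _; exists (-1); rewrite ltNyr ltrN10.
have n1 : within Theta (nbhs z) [set y | ((f z + t / 2)%:E < u y)%E].
  apply: limf_einf_gt; apply: lt_le_trans (fu z bz); rewrite lte_fin; lra.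
have n2 : \forall y \near z, Theta y -> v y < f z - t / 2.
  have [zo|zo] := eqVneq z origin.
    near=> y => Ty; have := W0 _ (T_closure _ Ty) (T_origin _ Ty).
    by move=> /(mulr_ge0 (ltW K0)); have := e0; rewrite zo /v; lra.
  have := fW z bz zo; rewrite ler_norml => /andP[h1 h2].
  have t2 : 0 < - t / 2 by lra.
  have n2 := v_near zo _ t2; apply: filterS n2 => y h _.
  by apply: lt_le_trans h _; rewrite /v; lra.
have FS : filter_from I S (S t) by exists t.
have n12 : \forall y \near z,
    (Theta y -> ((f z + t / 2)%:E < u y)%E) /\ (Theta y -> v y < f z - t / 2).
  have n1' : \forall y \near z, Theta y -> ((f z + t / 2)%:E < u y)%E by exact: n1.
  by apply: filterS2 n1' n2 => y ? ?.
have [y [[Ty h1] [h2 h3]]] := clz _ _ FS n12.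
have := h2 Ty; have := h3 Ty; move: h1; rewrite /d /=; case: (u y) => [s| |] //=.
by rewrite -EFinB !lte_fin; lra.
Unshelve. all: by end_near. Qed.

End Estimate.

End Perron.

(** * The gauge near the origin and the parabolic distance *)

Section Gauge.
Context {R : realType} {n : nat}.
Notation X := ('rV[R]_n * R)%type.
Implicit Types (xi y : X).

(** The gauge is the larger of the two continuous functions [|x|^2 + t] and [|x|^2 - t]. *)
Lemma near_origin_sqgauge (e : R) : 0 < e -> \forall y \near (origin : X), sqgauge y < e.
Proof.
move=> e0.
have h M : \forall y \near (origin : X), parab M 0 y < e.
  have c : {for (origin : X), continuous (parab M 0)} by exact: continuous_parab.
  by move/cvgr_lt : c; apply; rewrite /parab /= dotv0l addr0 mulr0 addr0.
apply: filterS2 (h 1) (h (-1)) => y; rewrite /parab /sqgauge !addr0 mul1r mulN1r => h1 h2.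
by have [y0|y0] := lerP 0 y.2; rewrite ?(ger0_norm y0) ?(ltr0_norm y0).
Qed.

Lemma sqgauge_cbox (r : R) y : 0 < r -> sqgauge y < Num.min r (r ^+ 2) ->
  (forall i, `|y.1 0 i| < r) /\ `|y.2| < r.
Proof.
rewrite lt_min /sqgauge => r0 /andP[h1 h2]; have h3 := dotv_ge0 y.1.
have h4 : 0 <= `|y.2| by []; split=> [i|]; last by lra.
rewrite -(@ltr_pXn2r _ 2) ?nnegrE // ?(ltW r0) // -normrX ger0_norm ?sqr_ge0 //.
by apply: le_lt_trans (sqr_coord_le_dotv y.1 i) _; lra.
Qed.

Lemma sqgauge_le_sqr y : sqgauge y <= (enorm y.1 + Num.sqrt `|y.2|) ^+ 2.
Proof.
rewrite sqrrD enorm_sqr sqr_sqrtr // /sqgauge.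
by have := mulr_ge0 (enorm_ge0 y.1) (sqrtr_ge0 `|y.2|); lra.
Qed.

Lemma sqr_le_sqgauge y : (enorm y.1 + Num.sqrt `|y.2|) ^+ 2 <= 2 * sqgauge y.
Proof.
have := sqr_ge0 (enorm y.1 - Num.sqrt `|y.2|).
by rewrite sqrrB sqrrD !enorm_sqr !sqr_sqrtr // /sqgauge; lra.
Qed.

Lemma powR_sqr (x a : R) : 0 <= x -> (x ^+ 2) `^ a = x `^ (2 * a).
Proof. by move=> x0; rewrite powRrM powR_mulrn. Qed.

End Gauge.

Lemma cvg_EFin_dist {R : realType} {T : Type} (F : set_system T) (g : T -> \bar R) (l : R) :
  Filter F ->
  (forall e : R, 0 < e -> \forall x \near F, ((l - e)%:E <= g x <= (l + e)%:E)%E) ->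
  g @ F --> l%:E.
Proof.
move=> FF h A /= nA.
have /nbhs_ballP [e /= e0 he] : nbhs l (fun r : R => A r%:E) by exact: nA.
have e2 : 0 < e / 2 by lra.
apply: filterS (h _ e2) => x /=; case: (g x) => [r| |] //=.
  rewrite !lee_fin => /andP[h1 h2]; apply: he; rewrite /ball /= ltr_norml.
  by apply/andP; split; lra.
by move=> /andP[_]; rewrite leNgt ltry.
Qed.

Section PerronEstimate.
Context {R : realType} {n : nat}.
Notation X := ('rV[R]_n * R)%type.

Lemma upper_perron_dist (p : R) (Theta : set X) (f W : X -> R) (K e : R) xi :
  (0 < n)%N -> 1 < p -> open Theta -> bounded_set Theta -> boundary Theta origin ->
  (forall xi, closure Theta xi -> xi != origin -> local_barrier p W xi) ->
  (forall xi, closure Theta xi -> xi != origin -> 0 <= W xi) ->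
  0 < K -> 0 <= e ->
  (forall zeta, boundary Theta zeta -> zeta != origin ->
     `|f zeta - f origin| <= K * W zeta + e) ->
  Theta xi ->
  ((f origin - (K * W xi + e))%:E <= upper_perron p Theta f xi
    <= (f origin + (K * W xi + e))%:E)%E.
Proof.
move=> n0 p1 oT bT bo WB W0 K0 e0 fW Txi; apply/andP; split.
  apply: le_ereal_inf_tmp => _ [u [su fu] <-].
  by apply: (superparabolic_ge p Theta f W K e).
by apply: (upper_perron_le p Theta f W K e).
Qed.

End PerronEstimate.

(** * Regularity and Hölder continuity from the barrier *)

Theorem theorem1p1 (R : realType) (n : nat) (p : R) (Theta : set ('rV[R]_n * R)) :
  (0 < n)%N -> 1 < p ->
  open Theta -> bounded_set Theta -> boundary Theta origin ->
  tusk_condition Theta ->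
  regular_point p Theta origin /\
  forall f : 'rV[R]_n * R -> R,
    bounded_set (f @` boundary Theta) ->
    holder_at_origin (boundary Theta) (EFin \o f) ->
    holder_at_origin (Theta `|` [set origin]) (upper_perron0 p Theta f).
Proof.
move=> n0 p1 oT bT bo tc.
have To xi : Theta xi -> xi != origin.
  move=> Txi; apply/eqP => e; case: bo => _; apply; rewrite -e.
  exact: open_nbhs_nbhs.
split.
  have [W [g [c [C [D [[g0 _ c0 C0 D0] WB Wb _]]]]]] :=
    tusk_barrier p 1 Theta n0 p1 bT tc ltr01.
  have W0 xi : closure Theta xi -> xi != origin -> 0 <= W xi.
    move=> cx xo; have /andP[h _] := Wb xi cx xo; apply: le_trans h.
    by rewrite mulr_ge0 ?powR_ge0 // ltW.
  move=> f fc; apply: cvg_EFin_dist => e e0.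
  have e2 : 0 < e / 2 by lra.
  have [r r0 fr] : exists2 r : R, 0 < r & forall zeta, boundary Theta zeta ->
      sqgauge zeta < r -> `|f zeta - f origin| < e / 2.
    have h : within (boundary Theta) (nbhs (origin : 'rV[R]_n * R))
        [set y | `|f origin - f y| < e / 2].
      rewrite (nbhs_subspace_in bo).
      by have /cvgrPdist_lt /(_ _ e2) := fc origin.
    have h' : \forall y \near (origin : 'rV[R]_n * R),
        boundary Theta y -> `|f origin - f y| < e / 2 by exact: h.
    have [r r0 hr] := nbhs_cbox _ _ h'.
    exists (Num.min r (r ^+ 2)); first by rewrite lt_min r0 exprn_gt0.
    move=> zeta bz /(sqgauge_cbox _ _ r0) [h1 h2].
    by rewrite distrC; apply: hr => // [i|]; rewrite ?mxE subr0.
  (* The boundary is compact, so the continuous [f] has a finite oscillation [S] on it. *)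
  have cb : compact (boundary Theta).
    apply: (subclosed_compact _ (compact_closure_bounded _ bT)); last by move=> y [].
    rewrite /boundary setDE; apply: closedI; first exact: closed_closure.
    by apply: open_closedC; exact: open_interior.
  have [y1 _ h1] := compact_EVT_max (ex_intro _ origin bo) cb fc.
  have [y2 _ h2] := compact_EVT_min (ex_intro _ origin bo) cb fc.
  pose S := f y1 - f y2.
  have fS zeta : boundary Theta zeta -> `|f zeta - f origin| <= S.
    move=> bz; have k1 := h1 _ (mem_set bz); have k2 := h2 _ (mem_set bz).
    have k3 := h1 _ (mem_set bo); have k4 := h2 _ (mem_set bo).
    by rewrite ler_norml /S; apply/andP; split; lra.
  have S0 : 0 <= S by apply: le_trans (fS _ bo).
  have rg : 0 < c * r `^ g by rewrite mulr_gt0 // powR_gt0.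
  (* With this factor [K W >= S] where the gauge is at least [r]; closer to the origin the
     continuity of [f] provides [e / 2]. *)
  pose K := S / (c * r `^ g) + 1.
  have SK : 0 <= S / (c * r `^ g) by rewrite divr_ge0 // ltW.
  have K0 : 0 < K by rewrite /K; lra.
  have fW zeta : boundary Theta zeta -> zeta != origin ->
      `|f zeta - f origin| <= K * W zeta + e / 2.
    move=> bz zo; have KW : 0 <= K * W zeta.
      by apply: mulr_ge0 (W0 _ bz.1 zo); exact: ltW.
    have [lt_r|ge_r] := ltP (sqgauge zeta) r; first by have := fr _ bz lt_r; lra.
    have : S <= K * W zeta.
      have /andP[h _] := Wb _ bz.1 zo.
      have h3 : c * r `^ g <= W zeta.
        apply: le_trans h; rewrite ler_pM2l //.
        by apply: ler_powR_nneg => //; exact: ltW.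
      apply: (@le_trans _ _ (K * (c * r `^ g))); last by rewrite ler_pM2l.
      by rewrite /K mulrDl divfK ?gt_eqF //; lra.
    by have := fS _ bz; lra.
  have KC0 : 0 < K * C by exact: mulr_gt0.
  (* Chosen so that [K C eta^g = e / 2]. *)
  pose eta := (e / 2 / (K * C)) `^ g^-1.
  have eKC : 0 < e / 2 / (K * C) by exact: divr_gt0.
  have eta0 : 0 < eta by exact: powR_gt0.
  have n1 : \forall y \near (origin : 'rV[R]_n * R), sqgauge y < eta.
    exact: near_origin_sqgauge.
  have n2 : \forall y \near (origin : 'rV[R]_n * R), Theta y ->
     ((f origin - e)%:E <= upper_perron p Theta f y <= (f origin + e)%:E)%E.
    apply: filterS n1 => y ye Ty; have yo := To _ Ty.
    have cy : closure Theta y by exact: subset_closure.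
    have := upper_perron_dist p Theta f W K (e / 2) y n0 p1 oT bT bo WB W0 K0 (ltW e2) fW Ty.
    have KWe : K * W y <= e / 2.
      have /andP[_ h] := Wb _ cy yo.
      have hg : sqgauge y `^ g <= e / 2 / (K * C).
        have -> : e / 2 / (K * C) = eta `^ g.
          by rewrite /eta -powRrM mulVf ?gt_eqF // powRr1 // ltW.
        by apply: ler_powR_nneg; [exact: ltW|exact: sqgauge_ge0|exact: ltW].
      apply: (@le_trans _ _ (K * (C * sqgauge y `^ g))); first by rewrite ler_pM2l.
      by rewrite mulrA mulrC -ler_pdivlMr.
    move=> /andP[k1 k2]; apply/andP; split.
      by apply: le_trans k1; rewrite lee_fin; lra.
    by apply: le_trans k2 _; rewrite lee_fin; lra.
  exact: n2.
move=> f _ [Cf [beta [Cf0 beta0 fH]]].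
have b2 : 0 < beta / 2 by lra.
have [W [g [c [C [D [[g0 gb c0 C0 D0] WB Wb WD]]]]]] :=
  tusk_barrier p (beta / 2) Theta n0 p1 bT tc b2.
have W0 xi : closure Theta xi -> xi != origin -> 0 <= W xi.
  move=> cx xo; have /andP[h _] := Wb xi cx xo; apply: le_trans h.
  by rewrite mulr_ge0 ?powR_ge0 // ltW.
(* With [N] the gauge, [(|x| + sqrt |t|)^beta <= (2 N)^(beta / 2)], and
   [N^(beta / 2) <= D^(beta / 2 - g) N^g] because [N <= D] and [g <= beta / 2]; dividing by [c]
   passes from [N^g] to [W]. *)
pose K := Cf * (2 `^ (beta / 2) * D `^ (beta / 2 - g)) / c.
have K0 : 0 < K by rewrite divr_gt0 // !mulr_gt0 // powR_gt0.
have fW zeta : boundary Theta zeta -> zeta != origin ->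
    `|f zeta - f origin| <= K * W zeta + 0.
  move=> bz zo; rewrite addr0.
  have := fH _ bz; rewrite /= lee_fin => h; apply: le_trans h _.
  have N0 := sqgauge_ge0 zeta.
  have Np : 0 < sqgauge zeta by rewrite sqgauge_gt0.
  have rho0 : 0 <= enorm zeta.1 + Num.sqrt `|zeta.2|.
    by rewrite addr_ge0 ?enorm_ge0 ?sqrtr_ge0.
  have /andP[hW _] := Wb _ bz.1 zo.
  apply: (@le_trans _ _ (K * (c * sqgauge zeta `^ g))); last by rewrite ler_pM2l.
  have -> : K * (c * sqgauge zeta `^ g) =
      Cf * (2 `^ (beta / 2) * (D `^ (beta / 2 - g) * sqgauge zeta `^ g)).
    by rewrite /K; field; rewrite gt_eqF.
  rewrite ler_pM2l //.
  have -> : beta = 2 * (beta / 2) by field.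
  rewrite -powR_sqr // -[2 * (beta / 2) / 2]/(2 * (beta / 2) / 2).
  have -> : 2 * (beta / 2) / 2 = beta / 2 by field.
  apply: (@le_trans _ _ ((2 * sqgauge zeta) `^ (beta / 2))).
    by apply: ler_powR_nneg; [exact: ltW|exact: sqr_ge0|exact: sqr_le_sqgauge].
  rewrite powRM // ler_pM2l ?powR_gt0 //.
  have -> : sqgauge zeta `^ (beta / 2) =
      sqgauge zeta `^ (beta / 2 - g) * sqgauge zeta `^ g.
    by rewrite -powRD ?subrK //; apply/implyP => _; rewrite gt_eqF.
  rewrite ler_wpM2r ?powR_ge0 //; apply: ler_powR_nneg => //; first by lra.
  exact: WD bz.1.
have KC0 : 0 < K * C by exact: mulr_gt0.
(* The exponent doubles because the gauge is bounded by the square of the parabolic distance. *)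
exists (K * C), (2 * g); split=> //; first exact: mulr_gt0.
move=> xi Dxi; rewrite /upper_perron0 eqxx.
have rho0 : 0 <= enorm xi.1 + Num.sqrt `|xi.2|.
  by rewrite addr_ge0 ?enorm_ge0 ?sqrtr_ge0.
case: eqP => [->|/eqP xo].
  rewrite -EFinB subrr /= normr0 lee_fin mulr_ge0 ?powR_ge0 //.
  by apply: ltW; exact: mulr_gt0.
have Txi : Theta xi by case: Dxi => // e; rewrite e eqxx in xo.
have cx : closure Theta xi by exact: subset_closure.
have := upper_perron_dist p Theta f W K 0 xi n0 p1 oT bT bo WB W0 K0 (lexx _) fW Txi.
have KW : K * W xi <= K * C * (enorm xi.1 + Num.sqrt `|xi.2|) `^ (2 * g).
  have /andP[_ h] := Wb _ cx xo.
  apply: (@le_trans _ _ (K * (C * sqgauge xi `^ g))); first by rewrite ler_pM2l.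
  rewrite mulrA ler_pM2l ?KC0 // -(powR_sqr _ _ rho0).
  by apply: ler_powR_nneg; [exact: ltW|exact: sqgauge_ge0|exact: sqgauge_le_sqr].
case: (upper_perron p Theta f xi) => [s| |] /andP[k1 k2].
- rewrite -EFinB /= lee_fin; move: k1 k2; rewrite !lee_fin => k1 k2.
  by rewrite ler_norml; apply/andP; split; lra.
- by move: k2; rewrite leNgt ltry.
- by move: k1; rewrite leNgt ltNyr.
Qed.
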